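(* Let $D=\mathbb S^2\setminus\bigcup_i\Delta_i$ be a spherical billiard with circular obstacles $\Delta_i$, of radii $r_i<\pi/2$, and write $r_{\max}=\max_i r_i$. For all $\delta_1\in(0,\pi/2-r_{\max})$, there exists $\delta_2>0$ such that, for any surface $\Sigma$ in the Euclidean space $\mathbb R^3$ (endowed with the induced metric) with $\pi(\Sigma)=D$ and $\partial\Delta_i\subseteq\Sigma$ for all $i$, which satisfies the following two conditions, the geodesic flow of $\Sigma$ has conjugate points: 1. (Symmetry.) The neighborhood $V_i^{\delta_1}$ is invariant by rotation in $\mathbb R^3$ around the axis $(0,c_i)$, where $c_i$ is the center of $\Delta_i$. 2. (Approximation of the billiard.) The surface $\Sigma\setminus\bigcup_i V_i^{\delta_2}$ is $\delta_2$-$C^2$-close to $D$.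
   Context: A spherical billiard with circular obstacles is a set $D=\mathbb S^2\setminus\bigcup_i\Delta_i$, where $(\Delta_i)$ is a finite family of open disks of the round unit sphere $\mathbb S^2\subset\mathbb R^3$ whose closures are disjoint and whose spherical radii $r_i$ satisfy $r_i<\pi/2$. The center $c_i\in\mathbb S^2$ of $\Delta_i$ is its center as a spherical disk, and the axis $(0,c_i)$ is the line through the origin and $c_i$. The map $\pi:\mathbb R^3\setminus\{0\}\to\mathbb S^2$ is the radial projection $q\mapsto q/\|q\|$. For $\delta>0$, $V_i^\delta$ denotes the open neighborhood of $\partial\Delta_i$ in $\Sigma$ which consists of all points at distance less than $\delta$ from $\partial\Delta_i$. A surface is said to be $\epsilon$-$C^2$-close to the billiard $D$ if there exist locally a parametrization $f_1$ of the surface and a parametrization $f_2$ of $D$ such that $\|f_1-f_2\|_{C^2}\le\epsilon$ for the $C^2$-norm in the Euclidean $\mathbb R^3$. ''The geodesic flow has conjugate points'' means that some geodesic of $\Sigma$ contains a pair of distinct conjugate points.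
   Formalization: The surface Σ is additionally assumed geodesically complete (so its geodesic flow is defined for all time; closed surfaces qualify); for incomplete surfaces, such as thin annuli at the obstacles together with small disjoint caps, the claim as written fails. *)

(* Defs.v *)
From HB Require Import structures.
From mathcomp Require Import all_boot all_order all_algebra.
From mathcomp Require Import all_classical all_reals all_analysis.

Set Implicit Arguments.
Unset Strict Implicit.
Unset Printing Implicit Defensive.
Import Order.TTheory GRing.Theory Num.Theory.
Import numFieldNormedType.Exports.
Local Open Scope classical_set_scope.
Local Open Scope ring_scope.

(** * Euclidean space

    The library norm on row vectors is the sup norm; it is used here only for
    the topology and for differentiation.  All metric notions go through [dot]
    and [enorm]. *)

Definition dot (R : realType) (u v : 'rV[R]_3) : R :=
  \sum_i u ord0 i * v ord0 i.

Definition enorm (R : realType) (u : 'rV[R]_3) : R := Num.sqrt (dot u u).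

Definition sphere (R : realType) : set 'rV[R]_3 := [set q | enorm q = 1].

(* The map called pi in the mathematics (junk value at the origin). *)
Definition radial_proj (R : realType) (q : 'rV[R]_3) : 'rV[R]_3 :=
  (enorm q)^-1 *: q.

(* Rotations about the line through 0 and c: direct isometries fixing c. *)
Definition rotation_about (R : realType) (c : 'rV[R]_3) (A : 'M[R]_3) : Prop :=
  [/\ A *m A^T = 1%:M, \det A = 1 & c *m A = c].

Definition rotation_invariant (R : realType) (c : 'rV[R]_3)
    (V : set 'rV[R]_3) : Prop :=
  forall A, rotation_about c A -> [set q *m A | q in V] = V.

(** * Spherical billiards with circular obstacles *)

Definition sphere_disk (R : realType) (c : 'rV[R]_3) (r : R) : set 'rV[R]_3 :=
  [set q | sphere q /\ acos (dot c q) < r].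

(* [closure] is taken in R^3; as the sphere is closed and the disk is open in
   it, this is the boundary of the disk in the sphere. *)
Definition disk_boundary (R : realType) (c : 'rV[R]_3) (r : R) :
    set 'rV[R]_3 :=
  closure (sphere_disk c r) `\` sphere_disk c r.

Definition circular_obstacles (R : realType) (n : nat)
    (c : 'I_n -> 'rV[R]_3) (r : 'I_n -> R) : Prop :=
  [/\ forall i, sphere (c i),
      forall i, 0 < r i < pi / 2 &
      forall i j, i != j ->
        closure (sphere_disk (c i) (r i)) `&`
        closure (sphere_disk (c j) (r j)) = set0].

Definition billiard (R : realType) (n : nat)
    (c : 'I_n -> 'rV[R]_3) (r : 'I_n -> R) : set 'rV[R]_3 :=
  @sphere R `\` \bigcup_i sphere_disk (c i) (r i).

Definition rmax (R : realType) (n : nat) (r : 'I_n.+1 -> R) : R :=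
  \big[Num.max/r ord0]_i r i.

(** * Smooth embedded surfaces in R^3 *)

(* Iterated partial derivative, in the coordinate directions listed in s. *)
Definition iter_partial (R : realType) (s : seq 'I_2)
    (f : 'rV[R]_2 -> 'rV[R]_3) : 'rV[R]_2 -> 'rV[R]_3 :=
  foldr (fun j g => 'D_(delta_mx ord0 j) g) f s.

Definition smooth_on (R : realType) (U : set 'rV[R]_2)
    (f : 'rV[R]_2 -> 'rV[R]_3) : Prop :=
  forall s u, U u -> differentiable (iter_partial s f) u.

(* The last two clauses say that f is a homeomorphism from U onto a relatively
   open subset of S. *)
Definition parametrization (R : realType) (S : set 'rV[R]_3)
    (U : set 'rV[R]_2) (f : 'rV[R]_2 -> 'rV[R]_3) : Prop :=
  [/\ open U,
      smooth_on U f,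
      forall u w, U u -> 'D_w f u = 0 -> w = 0,
      set_inj U f &
      forall O, open O -> O `<=` U ->
        exists2 W, open W & f @` O = S `&` W].

(* Surfaces have no boundary, and need not be connected. *)
Definition surface (R : realType) (S : set 'rV[R]_3) : Prop :=
  forall p, S p -> exists U f u, [/\ parametrization S U f, U u & f u = p].

Definition tangent (R : realType) (S : set 'rV[R]_3) (p v : 'rV[R]_3) : Prop :=
  exists U f u w, [/\ parametrization S U f, U u, f u = p & v = 'D_w f u].

(** * Distance and collars *)

Definition C1_path (R : realType) (S : set 'rV[R]_3) (p q : 'rV[R]_3)
    (g : R -> 'rV[R]_3) : Prop :=
  [/\ forall t, derivable g t 1,
      continuous (derive1 g),
      forall t, 0 <= t <= 1 -> S (g t),
      g 0 = p &
      g 1 = q].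

Definition path_length (R : realType) (g : R -> 'rV[R]_3) : \bar R :=
  (\int[lebesgue_measure]_(t in `[0%R, 1%R]) (enorm (derive1 g t))%:E)%E.

(* Distance of the induced metric.  Velocities may vanish, so piecewise C^1
   paths are covered up to reparametrization. *)
Definition surface_dist (R : realType) (S : set 'rV[R]_3) (p q : 'rV[R]_3) :
    \bar R :=
  ereal_inf [set path_length g | g in C1_path S p q].

(* The neighborhood of A in S called V^delta in the mathematics. *)
Definition collar (R : realType) (S A : set 'rV[R]_3) (delta : R) :
    set 'rV[R]_3 :=
  [set q | S q /\
     (ereal_inf [set surface_dist S p q | p in A] < delta%:E)%E].

(** * C^2-closeness *)

(* If x is a plane curve with x(0) = u, x'(0) = v and x''(0) = a, this is the
   second derivative at 0 of f \o x. *)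
Definition accel (R : realType) (f : 'rV[R]_2 -> 'rV[R]_3)
    (u v a : 'rV[R]_2) : 'rV[R]_3 :=
  'D_v ('D_v f) u + 'D_a f u.

(* Pointwise C^2-norm of f1 - f2 at u, where f2 parametrizes the unit sphere.
   Derivatives are those of (f1 - f2) \o x for the plane curves x such that
   f2 \o x is a great circle; the hypothesis on accel f2 u v a says that f2 \o x
   is one to second order at u.  They are normalized by the speed of f2 \o x,
   i.e. taken with respect to arc length.  Raw partial derivatives in u would
   not do: they can be made arbitrarily small by rescaling the coordinates of
   f1 and f2 simultaneously, and would control only the C^0 distance. *)
Definition C2_dist_le (R : realType) (e : R)
    (f1 f2 : 'rV[R]_2 -> 'rV[R]_3) (u : 'rV[R]_2) : Prop :=
  [/\ enorm (f1 u - f2 u) <= e,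
      forall v, enorm ('D_v f1 u - 'D_v f2 u) <= e * enorm ('D_v f2 u) &
      forall v a, accel f2 u v a = - (enorm ('D_v f2 u) ^+ 2) *: f2 u ->
        enorm (accel f1 u v a - accel f2 u v a)
          <= e * enorm ('D_v f2 u) ^+ 2].

(* The part S of the surface Sigma is e-C^2-close to the part D of the unit
   sphere.  S and D may have a boundary: their parametrizations are the
   restrictions to the preimage of S of parametrizations of Sigma and of the
   sphere. *)
Definition C2_close (R : realType) (e : R) (Sigma S D : set 'rV[R]_3) : Prop :=
  forall p, S p -> exists U f1 f2,
    [/\ parametrization Sigma U f1,
        parametrization (@sphere R) U f2,
        exists2 u, U u & f1 u = p &
        forall u, U u -> S (f1 u) -> D (f2 u) /\ C2_dist_le e f1 f2 u].

(** * Geodesics and conjugate points *)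

Definition geodesic (R : realType) (S : set 'rV[R]_3) (I : set R)
    (g : R -> 'rV[R]_3) : Prop :=
  forall t, I t ->
    [/\ S (g t),
        derivable g t 1 /\ derivable (derive1 g) t 1,
        derive1 g t != 0 &
        forall v, tangent S (g t) v -> dot (derive1 (derive1 g) t) v = 0].

(* The geodesic flow is defined for all times. *)
Definition geodesically_complete (R : realType) (S : set 'rV[R]_3) : Prop :=
  forall p v, S p -> tangent S p v -> v != 0 ->
    exists g, [/\ geodesic S setT g, g 0 = p & derive1 g 0 = v].

(* K = (LN - M^2) / (EG - F^2), with nu a unit normal vector at p. *)
Definition gauss_curvature (R : realType) (S : set 'rV[R]_3) (p : 'rV[R]_3)
    (K : R) : Prop :=
  exists U f u nu,
    let d0 : 'rV[R]_2 := delta_mx ord0 0 in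
    let d1 : 'rV[R]_2 := delta_mx ord0 1 in
    let E := dot ('D_d0 f u) ('D_d0 f u) in
    let F := dot ('D_d0 f u) ('D_d1 f u) in
    let G := dot ('D_d1 f u) ('D_d1 f u) in
    let L := dot ('D_d0 ('D_d0 f) u) nu in
    let M := dot ('D_d0 ('D_d1 f) u) nu in
    let N := dot ('D_d1 ('D_d1 f) u) nu in
    [/\ parametrization S U f, U u /\ f u = p,
        enorm nu = 1 /\ (forall v, tangent S p v -> dot v nu = 0) &
        K = (L * N - M ^+ 2) / (E * G - F ^+ 2)].

(* Y is the covariant derivative of the vector field X along g, that is, the
   tangential part of X'. *)
Definition covariant_derivative (R : realType) (S : set 'rV[R]_3) (I : set R)
    (g X Y : R -> 'rV[R]_3) : Prop :=
  forall t, I t ->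
    [/\ derivable X t 1,
        tangent S (g t) (Y t) &
        forall v, tangent S (g t) v -> dot (derive1 X t - Y t) v = 0].

(* J'' + R(J, g') g' = 0, the curvature tensor of a surface being
   R(J, g') g' = K (|g'|^2 J - <J, g'> g'). *)
Definition jacobi_field (R : realType) (S : set 'rV[R]_3) (I : set R)
    (g J : R -> 'rV[R]_3) : Prop :=
  (forall t, I t -> tangent S (g t) (J t)) /\
  exists J1 J2 : R -> 'rV[R]_3,
    [/\ covariant_derivative S I g J J1,
        covariant_derivative S I g J1 J2 &
        forall t, I t -> exists2 K, gauss_curvature S (g t) K &
          J2 t + K *: (dot (derive1 g t) (derive1 g t) *: J t
                       - dot (J t) (derive1 g t) *: derive1 g t) = 0].

Definition conjugate_along (R : realType) (S : set 'rV[R]_3) (I : set R)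
    (g : R -> 'rV[R]_3) (a b : R) : Prop :=
  exists J, [/\ jacobi_field S I g J,
                exists2 t, I t & J t != 0,
                J a = 0 &
                J b = 0].

Definition has_conjugate_points (R : realType) (S : set 'rV[R]_3) : Prop :=
  exists (I : set R) (g : R -> 'rV[R]_3) (a b : R),
    [/\ open I /\ is_interval I,
        geodesic S I g,
        I a /\ I b,
        g a != g b &
        conjugate_along S I g a b].

(* Main.v *)
(** Let [gamma] be the geodesic of the surface that leaves a point [p0] of the
    rim of one obstacle with velocity [p0]; this radial direction is tangent to
    the surface because the surface is projected outside the obstacle. By
    Clairaut's relation [gamma] stays in the plane of [p0] and the axis while it
    is in the collar of width [delta1], which is therefore a surface of
    revolution whose profile is [gamma], at distance [rho] from the axis.

    If [rho > rho a] on [(a, b)] and [rho' a > 0], the geodesic tangent to the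
    parallel [s = a] comes down to it and goes up again symmetrically, and it
    carries an explicit even Jacobi field [j]. As soon as [j < 0] somewhere, there
    are conjugate points on both sides of the turning point. If [rho'] becomes
    negative, then [rho b = rho a] for some [a < b] as above, and [j] becomes
    negative before [b]. Otherwise [gamma] has to follow the sphere, hence
    [rho' <= 1 - eta], from a distance [delta2] of the rim on, and it can do so
    only by turning horizontally ([rho' = 1]) at some [a = O(delta2)]. For this
    [a], the derivative of [j] is at most [- eta / (2 (delta2 + s))] up to
    constants; the integral of this bound is of the order of
    [- ln (1 / delta2)], so [j < 0] when [delta2] is small. *)
Require Import Defs.
From HB Require Import structures.
From mathcomp Require Import all_boot all_order all_algebra.
From mathcomp Require Import all_classical all_reals all_analysis.
From mathcomp Require Import ring lra.
Set Implicit Arguments.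
Unset Strict Implicit.
Unset Printing Implicit Defensive.
Import Order.TTheory GRing.Theory Num.Theory.
Import numFieldNormedType.Exports.
Local Open Scope classical_set_scope.
Local Open Scope ring_scope.

(** * Derivatives of functions of a real variable *)

(** The rotations about the axis supply the Jacobi component [k], and reduction of order turns the
    constant Wronskian [W = rho1 a] into [(j / k)' = - G W / k ^+ 2]. The sign of [j] is then
    governed by upper bounds on [k ^+ 2 = (rho + rho a) (rho - rho a)], that is, by the profile
    staying low above its turning parallel.

    Near the rim, closeness to the sphere says nothing, and further on it bounds the slope only once
    [rho] exceeds its rim value by [d]. In between, the profile might stay in a thin band above the
    parallel [a]. There a height of at most [d] makes [j] lose at least [1 / (2 d)] per unit of
    [s - rho], so that such a band has length at most [3 d].

    The definitions work with charts, whereas [gamma] is a curve in space. Curves have to be lifted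
    through charts to see that their velocities are tangent vectors, and the continuity of [rho''],
    which a twice differentiable geodesic does not provide, is recovered from the curvature formula
    in a smooth chart. *)

Section Derivatives.
Variable R : realType.

Lemma der_eq (V W : normedModType R) (f : V -> W) (x v : V) (l l' : W) :
  is_derive x v f l -> l = l' -> is_derive x v f l'.
Proof. by move=> ? <-. Qed.

Lemma derD (V W : normedModType R) (f g : V -> W) (x v : V) (l l' : W) :
  is_derive x v f l -> is_derive x v g l' ->
  is_derive x v (fun y => f y + g y) (l + l').
Proof. exact: is_deriveD. Qed.

Lemma derB (V W : normedModType R) (f g : V -> W) (x v : V) (l l' : W) :
  is_derive x v f l -> is_derive x v g l' ->
  is_derive x v (fun y => f y - g y) (l - l').
Proof. exact: is_deriveB. Qed.

Lemma derN (V W : normedModType R) (f : V -> W) (x v : V) (l : W) :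
  is_derive x v f l -> is_derive x v (fun y => - f y) (- l).
Proof. exact: is_deriveN. Qed.

Lemma derC (V W : normedModType R) (c : W) (x v : V) :
  is_derive x v (fun _ => c) 0.
Proof. exact: is_derive_cst. Qed.

Lemma derI (x : R) : is_derive x (1 : R) (fun y => y) 1.
Proof. exact: is_derive_id. Qed.

Lemma derM (V : normedModType R) (f g : V -> R) (x v : V) (l l' : R) :
  is_derive x v f l -> is_derive x v g l' ->
  is_derive x v (fun y => f y * g y) (l * g x + f x * l').
Proof.
move=> hf hg; apply: der_eq (is_deriveM hf hg) _.
by rewrite /GRing.scale /=; ring.
Qed.

Lemma derV (f : R -> R) (x l : R) : f x != 0 ->
  is_derive x 1 f l -> is_derive x 1 (fun y => (f y)^-1) (- l / f x ^+ 2).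
Proof.
move=> f0 hf; apply: der_eq (is_deriveV f0 hf) _.
by rewrite /GRing.scale /=; field.
Qed.

Lemma der_comp (f g : R -> R) (x l l' : R) :
  is_derive (g x) 1 f l -> is_derive x 1 g l' ->
  is_derive x 1 (fun y => f (g y)) (l * l').
Proof. exact: is_derive1_comp. Qed.

Lemma der_div (f g : R -> R) (x l l' : R) : g x != 0 ->
  is_derive x 1 f l -> is_derive x 1 g l' ->
  is_derive x 1 (fun y => f y / g y) ((l * g x - f x * l') / g x ^+ 2).
Proof.
move=> g0 hf hg; apply: der_eq (derM hf (derV g0 hg)) _.
by field.
Qed.

Lemma der_near (V W : normedModType R) (f g : V -> W) (x v : V) (l : W) :
  (\near x, f x = g x) -> is_derive x v f l -> is_derive x v g l.
Proof. exact: near_eq_is_derive. Qed.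

Lemma der_uniq (V W : normedModType R) (f : V -> W) (x v : V) (l l' : W) :
  is_derive x v f l -> is_derive x v f l' -> l = l'.
Proof. by move=> [_ <-] [_ <-]. Qed.

Lemma der_cont (W : normedModType R) (f : R -> W) (x : R) (l : W) :
  is_derive x 1 f l -> {for x, continuous f}.
Proof. by move=> [h _]; apply/differentiable_continuous/derivable1_diffP. Qed.

Lemma near_itv (a b x : R) : a < x < b -> \near x, a < x < b.
Proof.
move=> /andP[ax xb]; near=> y; apply/andP; split; near: y.
  exact: lt_nbhsr.
exact: lt_nbhsl.
Unshelve. all: by end_near. Qed.

Lemma cont_seg (a b : R) (f : R -> R) : (forall x, a <= x <= b -> {for x, continuous f}) ->
  {within `[a, b], continuous f}.
Proof.
move=> h; apply: continuous_in_subspaceT => x /set_mem /=.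
by rewrite in_itv /= => /h.
Qed.

Lemma mvt (f df : R -> R) (a b : R) : a < b ->
  (forall x, a <= x <= b -> is_derive x 1 f (df x)) ->
  exists2 x, a < x < b & f b - f a = df x * (b - a).
Proof.
move=> ab h; have [x||x] := @MVT R f df a b ab.
- by rewrite in_itv /= => /andP[/ltW ? /ltW ?]; apply: h; apply/andP.
- by apply: cont_seg => x /h /der_cont.
- by rewrite in_itv /=; exists x.
Qed.

Lemma der_noninc (f df : R -> R) (a b : R) :
  (forall x, a < x < b -> is_derive x 1 f (df x)) ->
  (forall x, a < x < b -> df x <= 0) ->
  forall x y, a < x -> x <= y -> y < b -> f y <= f x.
Proof.
move=> h h0 x y ax; rewrite le_eqVlt => /predU1P[->//|xy] yb.
have [z /andP[xz zy]|z /andP[xz zy] e] := @mvt f df x y xy.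
  by apply: h; rewrite (lt_le_trans ax) ?(le_lt_trans zy).
rewrite -subr_le0 e pmulr_lle0 ?subr_gt0// h0//.
by rewrite (lt_trans ax) ?(lt_trans zy).
Qed.

Lemma der_decr (f df : R -> R) (a b : R) :
  (forall x, a < x < b -> is_derive x 1 f (df x)) ->
  (forall x, a < x < b -> df x < 0) ->
  forall x y, a < x -> x < y -> y < b -> f y < f x.
Proof.
move=> h h0 x y ax xy yb.
have [z /andP[xz zy]|z /andP[xz zy] e] := @mvt f df x y xy.
  by apply: h; rewrite (lt_le_trans ax) ?(le_lt_trans zy).
rewrite -subr_lt0 e pmulr_llt0 ?subr_gt0// h0//.
by rewrite (lt_trans ax) ?(lt_trans zy).
Qed.

Lemma ivt_dec (f : R -> R) (a b l : R) : a <= b ->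
  (forall x, a <= x <= b -> {for x, continuous f}) ->
  f b <= l <= f a -> exists2 x, a <= x <= b & f x = l.
Proof.
move=> ab h /andP[bl la].
have [|x] := @IVT R f a b l ab (cont_seg h); last first.
  by rewrite in_itv /=; exists x.
by apply/andP; split; rewrite ?ge_min ?le_max ?bl ?la ?orbT.
Qed.

Lemma ivt_inc (f : R -> R) (a b l : R) : a <= b ->
  (forall x, a <= x <= b -> {for x, continuous f}) ->
  f a <= l <= f b -> exists2 x, a <= x <= b & f x = l.
Proof.
move=> ab h /andP[bl la].
have [|x] := @IVT R f a b l ab (cont_seg h); last first.
  by rewrite in_itv /=; exists x.
by apply/andP; split; rewrite ?ge_min ?le_max ?bl ?la ?orbT.
Qed.


Lemma primitive_seg (X : R) (h : R -> R) : 0 < X ->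
  (forall x, - X <= x <= X -> {for x, continuous h}) ->
  exists H : R -> R, (forall x, - X < x < X -> is_derive x 1 H (h x)) /\ H 0 = 0.
Proof.
move=> X0 hc.
pose F x := (\int[@lebesgue_measure R]_(t in [set` `[- X, x]]) (h t))%R.
have Fd x : - X < x < X -> is_derive x 1 F (h x).
  move=> /andP[Xx xX].
  have [|//||d e] := @continuous_FTC1_closed R h (- X) x X xX.
  - apply: continuous_compact_integrable; first exact: segment_compact.
    exact: cont_seg.
  - by apply: hc; rewrite !ltW.
  by apply: (DeriveDef d); rewrite -derive1E e.
exists (fun x => F x - F 0); split; last by rewrite subrr.
by move=> x /Fd hx; apply: der_eq (derB hx (derC _ _ _)) _; rewrite subr0.
Qed.

Lemma der0_const (f : R -> R) (a b : R) :
  (forall x, a < x < b -> is_derive x 1 f 0) ->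
  forall x y, a < x < b -> a < y < b -> f x = f y.
Proof.
move=> h x y; wlog xy : x y / x <= y.
  by move=> H hx hy; case/orP: (le_total x y) => e; [exact: H|exact/esym/H].
move=> /andP[ax xb] /andP[ay yb]; apply/eqP; rewrite eq_le; apply/andP; split.
  rewrite -lerN2; apply: (@der_noninc (fun x => - f x) (fun=> 0) a b) => //.
  by move=> z /h hz; apply: der_eq (derN hz) _; rewrite oppr0.
by apply: (@der_noninc f (fun=> 0) a b).
Qed.

(** [h] may blow up at the ends of the open interval, so it is integrated only over compact
    subintervals. The primitives vanishing at 0 agree on overlaps and are glued; oddness follows
    because [H x + H (- x)] has zero derivative. *)
Lemma primitive_odd (X : R) (h : R -> R) : 0 < X ->
  (forall x, - X < x < X -> {for x, continuous h}) ->
  (forall x, h (- x) = h x) ->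
  exists H : R -> R, (forall x, - X < x < X -> is_derive x 1 H (h x)) /\
                     (forall x, - X < x < X -> H (- x) = - H x).
Proof.
move=> X0 hc he.
have HY Y : exists H : R -> R, 0 < Y -> Y < X ->
    (forall x, - Y < x < Y -> is_derive x 1 H (h x)) /\ H 0 = 0.
  have [Y0|Y0] := ltP 0 Y; last by exists (fun=> 0).
  have [YX|YX] := ltP Y X; last by exists (fun=> 0); lra.
  have [|H HH] := @primitive_seg Y h Y0; last by exists H.
  by move=> x xY; apply: hc; lra.
have {HY} [P HP] := choice HY.
(* Half-length of the interval used at [x]: midway between [|x|] and [X], so that [x] is interior
   and the ends stay inside the domain. *)
pose y (x : R) := (`|x| + X) / 2.
have Pu Y Z x : 0 < Y < X -> 0 < Z < X -> `|x| < Y -> `|x| < Z -> P Y x = P Z x.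
  wlog YZ : Y Z / Y <= Z.
    move=> H hY hZ xY xZ; case/orP: (le_total Y Z) => e; first exact: H.
    exact/esym/H.
  move=> /andP[Y0 YX] /andP[Z0 ZX]; rewrite !ltr_norml => xY xZ.
  have [d1 P1] := HP Y Y0 YX; have [d2 P2] := HP Z Z0 ZX.
  have := @der0_const (fun x => P Y x - P Z x) (- Y) Y _ x 0 xY.
  rewrite P1 P2 subrr => H; apply/eqP; rewrite -subr_eq0; apply/eqP/H; last lra.
  move=> t tY; have tZ : - Z < t < Z by lra.
  by apply: der_eq (derB (d1 t tY) (d2 t tZ)) _; rewrite subrr.
have Hd x : - X < x < X -> is_derive x 1 (fun x => P (y x) x) (h x).
  rewrite -ltr_norml => xX; have yX : 0 < y x < X.
    by have := normr_ge0 x; rewrite /y; lra.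
  have xy : `|x| < y x by rewrite /y; lra.
  have := xy; rewrite ltr_norml => xy'; have /andP[Y0 YX] := yX.
  have [d _] := HP _ Y0 YX.
  apply: der_near (d _ xy'); near=> t; apply: Pu => //.
  - have : `|t| < X; last by have := normr_ge0 t; rewrite /y; lra.
    rewrite ltr_norml; near: t; apply: near_itv; rewrite -ltr_norml; lra.
  - by rewrite ltr_norml; near: t; exact: near_itv.
  - have : `|t| < X; last by rewrite /y; lra.
    rewrite ltr_norml; near: t; apply: near_itv; rewrite -ltr_norml; lra.
exists (fun x => P (y x) x); split=> // x xX.
have Hc t : - X < t < X -> is_derive t 1 (fun x => P (y x) x + P (y (- x)) (- x)) 0.
  move=> tX; have tX' : - X < - t < X by lra.
  have ht := Hd t tX; have hmt := Hd (- t) tX'.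
  apply: der_eq (derD ht (der_comp (f := fun x => P (y x) x) hmt (derN (derI t)))) _.
  by rewrite he mulrN1 subrr.
have y0 : 0 < y 0 < X by rewrite /y normr0; lra.
have [_ P0] := let: conj a b := andP y0 in HP _ a b.
have := der0_const Hc xX (_ : - X < 0 < X).
rewrite /= oppr0 !P0 addr0 => H; apply/eqP; rewrite -addr_eq0 addrC H//; lra.
Unshelve. all: by end_near. Qed.

End Derivatives.

(** * Change of time parameter and difference quotients *)

Section TimeChange.
Variable R : realType.

(** [y] inverts a primitive of [G]: it is the coordinate [x] as a function of the time along the
    geodesic. Taking [X0 < X] keeps the primitive continuous up to the ends, since nothing is known
    about [G] near [X]. *)
Lemma time_change (X X0 : R) (G : R -> R) : 0 < X0 < X ->
  (forall x, - X < x < X -> {for x, continuous G}) ->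
  (forall x, - X < x < X -> 0 < G x) ->
  (forall x, G (- x) = G x) ->
  exists (T1 T2 : R) (y : R -> R),
    (forall t, T1 < t < T2 -> - X0 < y t < X0 /\ is_derive t 1 y (G (y t))^-1) /\
    (forall x, - X0 < x < X0 -> exists2 t, T1 < t < T2 & y t = x).
Proof.
move=> /andP[X00 X0X] Gc G0 Ge.
have [|tau [taud _]] := primitive_odd _ Gc Ge; first lra.
have taui x z : - X < x -> x < z -> z < X -> tau x < tau z.
  move=> Xx xz zX; rewrite -ltrN2.
  apply: (der_decr (f := fun x => - tau x) (df := fun x => - G x) (a := - X) (b := X)) => //.
    by move=> t /taud /derN.
  by move=> t /G0; rewrite oppr_lt0.
have tauI x z : - X < x < X -> - X < z < X -> tau x = tau z -> x = z.
  move=> /andP[Xx xX] /andP[Xz zX] e.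
  have [xz|xz|//] := ltgtP x z.
    by have := taui x z Xx xz zX; rewrite e ltxx.
  by have := taui z x Xz xz xX; rewrite e ltxx.
have tauc x : - X0 <= x <= X0 -> {for x, continuous tau}.
  by move=> h; have /taud /der_cont : - X < x < X by lra.
have ex t : exists x, tau (- X0) < t < tau X0 -> - X0 < x < X0 /\ tau x = t.
  have [/andP[h1 h2]|] := boolP (tau (- X0) < t < tau X0); last by exists 0.
  have [||x /andP[]] := @ivt_inc _ tau (- X0) X0 t _ tauc; [lra|by rewrite !ltW|].
  rewrite le_eqVlt => /predU1P[<- _ e|h3]; first by move: h1; rewrite e ltxx.
  rewrite le_eqVlt => /predU1P[e' e|h4 e]; first by move: h2; rewrite -e e' ltxx.
  by exists x; rewrite h3 h4.
have [y yP] := choice ex.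
have tauP x : - X0 < x < X0 -> tau (- X0) < tau x < tau X0.
  by move=> /andP[h1 h2]; apply/andP; split; apply: taui; lra.
have yK x : - X0 < x < X0 -> y (tau x) = x.
  by move=> h; have [h1 h2] := yP _ (tauP _ h); apply: tauI h2; lra.
exists (tau (- X0)), (tau X0), y; split=> [t /yP[h e]|x h]; last first.
  by exists (tau x); [exact: tauP|exact: yK].
split=> //; rewrite -{1}e; apply: is_derive_inverse.
- by near=> z; apply: yK; near: z; exact: near_itv.
- near=> z; have /taud/der_cont : - X < z < X; last by [].
  by near: z; apply: near_itv; lra.
- by apply: taud; lra.
- by rewrite gt_eqF// G0; lra.
Unshelve. all: by end_near. Qed.

(** Caratheodory's slope function is continuous at [a], and elsewhere it is an honest quotient. It
    serves to divide [rho ^+ 2 - rho a ^+ 2] and [rho1 - rho1 a] by [s - a = x ^+ 2]. *)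
Lemma difference_quotient (f df : R -> R) (a b : R) : a < b ->
  (forall s, a <= s < b -> is_derive s 1 f (df s)) ->
  exists g : R -> R, [/\ forall z, f z - f a = g z * (z - a), g a = df a &
    forall s, a <= s < b -> {for s, continuous g}].
Proof.
move=> ab h; have /is_derive1_caratheodory [g [gE gc ga]] : is_derive a 1 f (df a).
  by apply: h; lra.
exists g; split=> // s /andP[]; rewrite le_eqVlt => /predU1P[<-//|as_ sb].
have sab : a <= s < b by lra.
have hd := derB (derI s) (derC a s 1).
have hn := derB (h s sab) (derC (f a) s 1).
have s0 : s - a != 0 by rewrite subr_eq0 gt_eqF.
have hs := der_div (g := fun z => z - a) s0 hn hd.
have : (f z - f a) / (z - a) @[z --> s] --> (f s - f a) / (s - a) := der_cont hs.
rewrite gE mulfK// => hc; apply: cvg_trans hc.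
apply: near_eq_cvg; near=> z.
rewrite gE mulfK// subr_eq0 gt_eqF//.
by near: z; exact: lt_nbhsr.
Unshelve. all: by end_near. Qed.

End TimeChange.

(** * Jacobi fields at a turning point *)

(* On a surface of revolution of profile [rho], parametrized by arc length,
   the geodesic tangent to the parallel [s = a] at the lowest point of its
   course is smooth in the coordinate [x] with [s = a + x ^+ 2]. Its time
   parameter [t] satisfies [dt/dx = G]; the normal components of two Jacobi
   fields along it are [k], given by the rotations, and [j], and [tf_W] is their
   Wronskian. *)
Record turning_family (R : realType) (rho rho1 rho2 : R -> R) (a X : R)
    (G k j j1 : R -> R) : Prop := TurningFamily {
  tf_Gc : forall x, - X < x < X -> {for x, continuous G};
  tf_G0 : forall x, - X < x < X -> 0 < G x;
  tf_Ge : forall x, G (- x) = G x;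
  tf_Gk : forall x, - X < x < X -> G x * k x = 2 * x * rho (a + x ^+ 2);
  tf_k2 : forall x, - X < x < X -> k x ^+ 2 = rho (a + x ^+ 2) ^+ 2 - rho a ^+ 2;
  tf_k0 : forall x, 0 < x < X -> 0 < k x;
  tf_ko : forall x, k (- x) = - k x;
  tf_je : forall x, - X < x < X -> j (- x) = j x;
  tf_dk : forall x, - X < x < X -> is_derive x 1 k (G x * rho1 (a + x ^+ 2));
  tf_dj : forall x, - X < x < X -> is_derive x 1 j (G x * j1 x);
  tf_dj1 : forall x, - X < x < X ->
    is_derive x 1 j1 (G x * (rho2 (a + x ^+ 2) / rho (a + x ^+ 2) * j x));
  tf_W : forall x, - X < x < X -> j x * rho1 (a + x ^+ 2) - j1 x * k x = rho1 a;
  tf_j0 : j 0 = 1;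
  tf_j10 : j1 0 = 0 }.

(** * Construction of the Jacobi fields across the turning point *)

Section Turning.
Variable R : realType.
Variables (rho rho1 rho2 : R -> R) (a b : R).
Hypothesis ab : a < b.
Hypothesis drho : forall s, a <= s < b -> is_derive s 1 rho (rho1 s).
Hypothesis drho1 : forall s, a <= s < b -> is_derive s 1 rho1 (rho2 s).
Hypothesis crho2 : forall s, a <= s < b -> {for s, continuous rho2}.
Hypothesis rho_gt0 : forall s, a <= s < b -> 0 < rho s.
Hypothesis W_gt0 : 0 < rho1 a.
Hypothesis rho_gt : forall s, a < s < b -> rho a < rho s.

Let X := Num.sqrt (b - a).
Let S (x : R) := a + x ^+ 2.

Lemma turning_X0 : 0 < X. Proof. by rewrite sqrtr_gt0 subr_gt0. Qed.

Lemma turning_dom x : - X < x < X -> a <= a + x ^+ 2 < b.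
Proof.
rewrite -ltr_norml => h; rewrite lerDl sqr_ge0 /=.
have : `|x| ^+ 2 < X ^+ 2 by rewrite ltr_pXn2r// nnegrE ?normr_ge0// ltW// turning_X0.
by rewrite real_normK ?num_real// sqr_sqrtr ?subr_ge0 ?ltW//; lra.
Qed.

Let dS (x : R) : is_derive x (1 : R) S (2 * x).
Proof.
apply: der_eq (derD (derC a x 1) (derM (derI x) (derI x))) _.
by rewrite add0r mul1r mulr1; ring.
Qed.

Let cS (x : R) : {for x, continuous S}. Proof. exact: der_cont (dS x). Qed.

Let cont_S (f : R -> R) (x : R) : - X < x < X -> (forall s, a <= s < b -> {for s, continuous f}) ->
  {for x, continuous (fun x => f (S x))}.
Proof.
move=> hx h; apply: continuous_comp; first exact: cS.
exact/h/turning_dom.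
Qed.

(** Clairaut's relation gives [ds/dt = k / rho] with [k ^+ 2 = rho ^+ 2 - rho a ^+ 2], which
    vanishes like [s - a = x ^+ 2]. Extracting [k = x * m] with [m > 0] leaves
    [dt/dx = 2 * rho / m], regular across [x = 0]. *)
Lemma turning_family_exists :
  exists G k j j1, turning_family rho rho1 rho2 a X G k j j1.
Proof.
have X0 := turning_X0.
have zX : - X < 0 < X by lra.
have drho_sq s : a <= s < b ->
    is_derive s 1 (fun z => rho z * rho z) (2 * rho s * rho1 s).
  by move=> /drho h; apply: der_eq (derM h h) _; ring.
have [g [gE ga gc]] := difference_quotient ab drho_sq.
have [h [hE ha hc]] := difference_quotient ab drho1.
pose W := rho1 a; have Wn0 : W != 0 by rewrite gt_eqF.
have g0 s : a <= s < b -> 0 < g s.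
  move=> /andP[]; rewrite le_eqVlt => /predU1P[<- _|as_ sb].
    by rewrite ga !mulr_gt0// rho_gt0// lexx.
  rewrite -(pmulr_lgt0 (x := s - a)) ?subr_gt0// -gE -!expr2 subr_gt0.
  rewrite ltr_pXn2r ?nnegrE// ?rho_gt ?as_//; apply/ltW/rho_gt0; lra.
pose M x := g (S x); pose m x := Num.sqrt (M x).
have M0 x : - X < x < X -> 0 < M x by move=> /turning_dom; exact: g0.
have m0 x : - X < x < X -> 0 < m x by move=> /M0; rewrite sqrtr_gt0.
have r0 x : - X < x < X -> 0 < rho (S x) by move=> /turning_dom; exact: rho_gt0.
have m2 x : - X < x < X -> m x ^+ 2 = M x by move=> /M0/ltW; exact: sqr_sqrtr.
have ME x : rho (S x) ^+ 2 - rho a ^+ 2 = M x * x ^+ 2.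
  by rewrite !expr2 gE /M /S; ring.
have hEx x : rho1 (S x) - W = h (S x) * x ^+ 2 by rewrite hE /S; ring.
have Se x : S (- x) = S x by rewrite /S sqrrN.
have Mc x : - X < x < X -> {for x, continuous M}.
  by move=> hx; apply: cont_S.
have mc x : - X < x < X -> {for x, continuous m}.
  by move=> /Mc hx; apply: continuous_comp; [exact: hx|exact: sqrt_continuous].
have rhoc x : - X < x < X -> {for x, continuous (fun x => rho (S x))}.
  by move=> hx; apply: cont_S => // s /drho/der_cont.
pose k x := x * m x; pose G x := 2 * rho (S x) / m x.
have Gc x : - X < x < X -> {for x, continuous G}.
  move=> hx; apply: continuousM; last first.
    by apply: continuousV; [rewrite gt_eqF// m0|exact: mc].
  by apply: continuousM; [exact: cst_continuous|exact: rhoc].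
have G0 x : - X < x < X -> 0 < G x.
  by move=> hx; rewrite divr_gt0 ?mulr_gt0 ?m0 ?r0.
have k2 x : - X < x < X -> k x ^+ 2 = rho (S x) ^+ 2 - rho a ^+ 2.
  by move=> hx; rewrite ME exprMn m2// mulrC.
have Gk x : - X < x < X -> G x * k x = 2 * x * rho (S x).
  by move=> hx; rewrite /G /k; have := m0 x hx; move=> /lt0r_neq0 ?; field.
have k_n0 x : - X < x < X -> x != 0 -> k x != 0.
  by move=> hx x0; rewrite mulf_neq0// gt_eqF// m0.
have sqc (f : R -> R) (x : R) :
    {for x, continuous f} -> {for x, continuous (fun x => f x ^+ 2)}.
  move=> hf; apply: (@continuous_comp _ _ _ f (fun y : R => y ^+ 2)) => //.
  exact: exprn_continuous.
have nearX x : - X < x < X -> \near x, - X < x < X by exact: near_itv.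
have dk x : - X < x < X -> is_derive x 1 k (G x * rho1 (S x)).
  (* Only continuity of [m] is available, so at 0 the derivative is read off from [k x = x * m x] as
     a Caratheodory slope. Elsewhere the square root of [rho ^+ 2 - rho a ^+ 2] is differentiated,
     with the sign of [x] put back. *)
  move=> hx; have [->|x0] := eqVneq x 0.
    apply/is_derive1_caratheodory; exists m; split.
    - by move=> z; rewrite /k mul0r !subr0 mulrC.
    - exact: mc.
    have m00 := m0 _ zX; apply: (mulfI (lt0r_neq0 m00)); rewrite -expr2 m2//.
    rewrite /G /M /S expr0n /= addr0 ga; field; exact: lt0r_neq0.
  have sgnear : \forall z \near x, Num.sg x = Num.sg z.
    move: x0; rewrite neq_lt => /orP[x0|x0]; near=> z.
      by rewrite !ltr0_sg//; near: z; exact: lt_nbhsl.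
    by rewrite !gtr0_sg//; near: z; exact: lt_nbhsr.
  pose c := Num.sg x.
  have knear : \near x, c * Num.sqrt (rho (S x) * rho (S x) - rho a ^+ 2) = k x.
    near=> z; rewrite -!expr2 ME sqrtrM ?ltW ?M0//; last by near: z; exact: nearX.
    rewrite sqrtr_sqr /c; have -> : Num.sg x = Num.sg z by near: z.
    by rewrite mulrCA -numEsg /k [RHS]mulrC.
  have pos : 0 < rho (S x) * rho (S x) - rho a ^+ 2.
    by rewrite -expr2 ME mulr_gt0 ?M0// lt_def sqr_ge0 sqrf_eq0 x0.
  have d1 := drho (turning_dom hx).
  have d2 := der_comp (f := rho) (g := S) d1 (dS x).
  have d3 := derB (derM d2 d2) (derC (rho a ^+ 2) x 1).
  have d4 := der_comp (f := Num.sqrt)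
    (g := fun x => rho (S x) * rho (S x) - rho a ^+ 2) (is_derive1_sqrt pos) d3.
  have d5 := derM (derC c x 1) d4.
  have E := nbhs_singleton knear.
  apply: der_near knear _; apply: der_eq d5 _.
  rewrite mul0r add0r subr0 -/(S x).
  have kn := k_n0 x hx x0; have mn := lt0r_neq0 (m0 x hx).
  have c2 : c ^+ 2 = 1 by rewrite sqr_sg x0.
  move: E; set q := Num.sqrt _ => E.
  have qn : q != 0 by apply: contraNneq kn => q0; rewrite -E q0 mulr0.
  have Eq : q = c * k x by rewrite -E mulrA -expr2 c2 mul1r.
  have cn : c != 0 by rewrite sgr_eq0.
  rewrite Eq /G /k; field.
  by rewrite x0 mn cn.
(* Since [(j / k)' = - W G / k ^+ 2] blows up at 0, the quotient is regularized
   into [(2 W - rho1) / (W k)] plus a primitive of [B G]. *)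
pose B x := rho2 (S x) / (W * rho (S x)) - h (S x) ^+ 2 * x ^+ 2 / (W * M x).
have Bc x : - X < x < X -> {for x, continuous (fun x => B x * G x)}.
  move=> hx; apply: continuousM; last exact: Gc.
  apply: continuousB.
    apply: continuousM; first exact: cont_S.
    apply: continuousV; first by rewrite mulf_neq0// gt_eqF// r0.
    by apply: continuousM; [exact: cst_continuous|exact: rhoc].
  apply: continuousM.
    apply: continuousM; last exact: exprn_continuous.
    by apply: sqc; exact: cont_S.
  apply: continuousV; first by rewrite mulf_neq0// gt_eqF// M0.
  by apply: continuousM; [exact: cst_continuous|exact: Mc].
have Ge x : G (- x) = G x by rewrite /G /m /M Se.
have [|beta [dbeta betaN]] := primitive_odd X0 Bc.
  by move=> x; rewrite Ge /B /M Se sqrrN.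
pose j x := (2 * W - rho1 (S x)) / W + k x * beta x.
(* Equal to [(W - rho1) ^+ 2 / k] off 0. The numerator [2 W - rho1] of [j] completes a square, [(2 W
   - rho1) rho1 + (W - rho1) ^+ 2 = W ^+ 2], so that the singular part of the derivative of
   [(2 W - rho1) / (W k)] is exactly [- W G / k ^+ 2]. *)
pose T x := h (S x) ^+ 2 * x ^+ 3 / m x.
pose j1 x := rho1 (S x) * beta x - T x / W.
have dr1 x : - X < x < X -> is_derive x 1 (fun x => rho1 (S x)) (rho2 (S x) * (2 * x)).
  move=> hx; exact: (der_comp (f := rho1) (g := S) (drho1 (turning_dom hx)) (dS x)).
have dT x : - X < x < X -> is_derive x 1 T
    (G x * (- 2 * (W - rho1 (S x)) * rho2 (S x) / rho (S x)
      - rho1 (S x) * (h (S x) ^+ 2 * x ^+ 2 / M x))).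
  move=> hx; have [->|x0] := eqVneq x 0.
    apply/is_derive1_caratheodory; exists (fun x => h (S x) ^+ 2 * x ^+ 2 / m x).
    split.
    - by move=> z; rewrite /T expr0n /= mulr0 mul0r !subr0 exprS; ring.
    - apply: continuousM; last by apply: continuousV; [rewrite gt_eqF// m0|exact: mc].
      apply: continuousM; last exact: exprn_continuous.
      by apply: sqc; exact: cont_S.
    by rewrite /S expr0n /= addr0 /W; ring.
  have xnear : \forall z \near x, z != 0.
    move: (x0); rewrite neq_lt => /orP[x_0|x_0]; near=> z.
      by rewrite lt_eqF//; near: z; exact: lt_nbhsl.
    by rewrite gt_eqF//; near: z; exact: lt_nbhsr.
  have Tnear : \near x, (W - rho1 (S x)) ^+ 2 / k x = T x.
    near=> z; have zn0 : z != 0 by near: z.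
    have zX' : - X < z < X by near: z; exact: nearX.
    have mn := lt0r_neq0 (m0 z zX').
    by rewrite -sqrrN opprB hEx /T /k; field; rewrite zn0 mn.
  have dr := derB (derC W x 1) (dr1 x hx).
  have dr2 : is_derive x 1 (fun x => (W - rho1 (S x)) ^+ 2) _ := derM dr dr.
  apply: der_near Tnear _; apply: der_eq (der_div (k_n0 x hx x0) dr2 (dk x hx)) _.
  have hE2 : h (S x) = (rho1 (S x) - W) / x ^+ 2 by rewrite hEx mulfK// expf_neq0.
  have mn := lt0r_neq0 (m0 x hx); have rn := lt0r_neq0 (r0 x hx).
  by rewrite hE2 -(m2 x hx) /k /G; field; rewrite x0 mn rn.
exists G, k, j, j1; split; [exact: Gc|exact: G0|exact: Ge|exact: Gk|exact: k2| | | |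
  exact: dk| | | | |].
- move=> x /andP[x0 xX]; rewrite mulr_gt0// m0//; lra.
- by move=> x; rewrite /k /m /M Se mulNr.
- by move=> x hx; rewrite /j Se /k /m /M Se betaN// mulNr mulrNN.
- move=> x hx.
  have d1 := derM (derB (derC (2 * W) x 1) (dr1 x hx)) (derC W^-1 x 1).
  apply: der_eq (derD d1 (derM (dk x hx) (dbeta x hx))) _.
  have mn := lt0r_neq0 (m0 x hx); have rn := lt0r_neq0 (r0 x hx).
  rewrite /j1 /B /T -(m2 x hx) /k /G; field.
  by rewrite mn rn Wn0.
- move=> x hx.
  apply: der_eq (derB (derM (dr1 x hx) (dbeta x hx)) (derM (dT x hx) (derC W^-1 x 1))) _.
  have mn := lt0r_neq0 (m0 x hx); have rn := lt0r_neq0 (r0 x hx).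
  rewrite /j /B -(m2 x hx) /k /G; field.
  by rewrite mn rn Wn0.
- move=> x hx; rewrite /j /j1 /T /k -/W -/(S x).
  have mn := lt0r_neq0 (m0 x hx).
  have -> : rho1 (S x) = W + h (S x) * x ^+ 2 by rewrite -hEx; ring.
  by field; rewrite mn Wn0.
- by rewrite /j /k /S expr0n /= addr0 !mul0r addr0 -/W; field.
- have b0 : beta 0 = 0.
    apply/eqP; have := betaN 0 zX; rewrite oppr0 => /eqP.
    by rewrite -addr_eq0 -mulr2n mulrn_eq0.
  by rewrite /j1 /T b0 expr0n /= !mulr0 !mul0r subr0.
Unshelve. all: by end_near. Qed.

End Turning.

(** * Conditions that force the Jacobi field [j] to become negative *)

Section Focusing.
Variable R : realType.
Variables (rho rho1 rho2 : R -> R) (a b : R).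
Let X := Num.sqrt (b - a).
Variables (G k j j1 : R -> R).
Hypothesis ab : a < b.
Hypothesis fam : turning_family rho rho1 rho2 a X G k j j1.
Hypothesis W_gt0 : 0 < rho1 a.
Hypothesis C_gt0 : 0 < rho a.

Let X0 : 0 < X. Proof. by rewrite sqrtr_gt0 subr_gt0. Qed.
Let X2 : X ^+ 2 = b - a. Proof. by rewrite sqr_sqrtr// subr_ge0 ltW. Qed.

Let dQ x : 0 < x < X ->
  is_derive x 1 (fun x => j x / k x) (- (G x * rho1 a) / k x ^+ 2).
Proof.
move=> hx; have hx' : - X < x < X by lra.
have kn := lt0r_neq0 (tf_k0 fam hx).
apply: der_eq (der_div kn (tf_dj fam hx') (tf_dk fam hx')) _.
by rewrite -(tf_W fam hx'); congr (_ / _); ring.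
Qed.

Let dQ_lt0 x : 0 < x < X -> - (G x * rho1 a) / k x ^+ 2 < 0.
Proof.
move=> hx; rewrite mulNr oppr_lt0 divr_gt0 ?exprn_gt0 ?(tf_k0 fam)// mulr_gt0//.
by apply: (tf_G0 fam); lra.
Qed.

(* As [j] is even and [k] is odd, [j + eps * k] vanishes at [x2] and [- x1]. The
   geodesic may pass through the same point at the zeros [xs] and [- xs] of [j],
   but not at [x2] and [- x1], which lie on different parallels. *)
Lemma focusing_zeros x0 : 0 < x0 < X -> j x0 < 0 ->
  exists2 xs, 0 < xs < X & forall e, 0 < e ->
    exists x1 x2 eps, [/\ 0 < x1 < xs, xs < x2 < X, xs - e < x1 /\ x2 < xs + e,
      j x2 + eps * k x2 = 0 & j x1 - eps * k x1 = 0].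
Proof.
move=> x0X j0.
have jc x : - X < x < X -> {for x, continuous j} by move=> /(tf_dj fam)/der_cont.
have [|x hx||xs xs0 jxs] := @ivt_dec _ j 0 x0 0.
- lra.
- by apply: jc; lra.
- by rewrite (tf_j0 fam) ler01 ltW.
have xs_n0 : xs != 0.
  by apply: contra_eq_neq jxs => ->; rewrite (tf_j0 fam) oner_neq0.
have xs_gt0 : 0 < xs by rewrite lt_def xs_n0; lra.
exists xs => [|e e0]; first lra.
pose Q x := j x / k x.
have Qc x : 0 < x < X -> {for x, continuous Q} by move=> /dQ/der_cont.
have Qd := der_decr dQ dQ_lt0.
have Qs : Q xs = 0 by rewrite /Q jxs mul0r.
(* The quotient [j / k] decreases strictly through 0 at [xs]. With a small common [eps] it takes the
   value [eps] before [xs] and [- eps] after it, within the window allowed by [e] and by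
   [(0, X)]. *)
pose y1 := Num.max (xs - e / 2) (xs / 2).
pose y2 := Num.min (xs + e / 2) ((xs + X) / 2).
have [y1a y1b y1c] : [/\ 0 < y1, y1 < xs & xs - e < y1].
  by rewrite /y1; split; rewrite ?lt_max ?gt_max; lra.
have [y2a y2b y2c] : [/\ xs < y2, y2 < X & y2 < xs + e].
  by rewrite /y2; split; rewrite ?lt_min ?gt_min; lra.
have Q1 : 0 < Q y1 by rewrite -Qs; apply: Qd => //; lra.
have Q2 : Q y2 < 0 by rewrite -Qs; apply: Qd => //; lra.
pose eps := Num.min (Q y1) (- Q y2).
have [e1 e2 e3] : [/\ 0 < eps, eps <= Q y1 & eps <= - Q y2].
  by rewrite /eps; split; rewrite ?lt_min ?ge_min; lra.
have [|x hx||x1 hx1 Qx1] := @ivt_dec _ Q y1 xs eps.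
- by rewrite ltW.
- by apply: Qc; lra.
- by rewrite Qs e2 ltW.
have [|x hx||x2 hx2 Qx2] := @ivt_dec _ Q xs y2 (- eps).
- by rewrite ltW.
- by apply: Qc; lra.
- by rewrite Qs; lra.
have x1s : x1 != xs by apply: contra_eq_neq Qx1 => ->; rewrite Qs lt_eqF.
have x2s : x2 != xs.
  by apply: contra_eq_neq Qx2 => ->; rewrite Qs gt_eqF// oppr_lt0.
have x1s' : x1 < xs by rewrite lt_neqAle x1s; lra.
have x2s' : xs < x2 by rewrite lt_neqAle eq_sym x2s; lra.
exists x1, x2, eps; split; try lra.
  have kn : k x2 != 0 by rewrite gt_eqF// (tf_k0 fam)//; lra.
  by rewrite -[j x2](divfK kn) -/(Q x2) Qx2; ring.
have kn : k x1 != 0 by rewrite gt_eqF// (tf_k0 fam)//; lra.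
by rewrite -[j x1](divfK kn) -/(Q x1) Qx1; ring.
Qed.

Let GE x : 0 < x < X -> G x = 2 * x * rho (a + x ^+ 2) / k x.
Proof.
move=> hx; rewrite -(tf_Gk fam); last lra.
by rewrite mulfK// gt_eqF// (tf_k0 fam).
Qed.

Let dS (x : R) : is_derive x (1 : R) (fun x => a + x ^+ 2) (2 * x).
Proof.
apply: der_eq (derD (derC a x 1) (derM (derI x) (derI x))) _.
by rewrite add0r mul1r mulr1; ring.
Qed.

Let dom (x : R) : 0 < x < X -> a < a + x ^+ 2 < b.
Proof.
move=> /andP[x0 xX]; have : x ^+ 2 < X ^+ 2 by rewrite ltr_pXn2r// nnegrE ltW.
by have : 0 < x ^+ 2 by [rewrite exprn_gt0]; rewrite X2; lra.
Qed.

Hypothesis rho_le2 : forall s, a < s < b -> rho s <= 2.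
Hypothesis rho_gt : forall s, a < s < b -> rho a < rho s.

Let k2E x : 0 < x < X -> k x ^+ 2 =
  (rho (a + x ^+ 2) + rho a) * (rho (a + x ^+ 2) - rho a).
Proof. by move=> hx; rewrite (tf_k2 fam); [ring|lra]. Qed.

(* [j / k] decreases to [-oo] at [s = b], at least like a multiple of
   [ln (b - s)]. *)
Lemma focusing_return : (forall s, a < s < b -> rho s - rho a <= b - s) ->
  exists2 x, 0 < x < X & j x < 0.
Proof.
move=> hb; apply: contrapT => nj; have C0 := C_gt0; have X0' := X0.
have j0 x : 0 < x < X -> 0 <= j x.
  by move=> hx; rewrite leNgt; apply/negP => jx; apply: nj; exists x.
(* From [k <= 2] and [k ^+ 2 <= 4 * (b - s)] comes [k ^+ 3 <= 8 * (b - s)]. With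
   [G = 2 * x * rho / k], this bounds the derivative of [j / k] above by that of
   [c * ln (b - s)]. *)
pose c := rho a * rho1 a / 8.
have c0 : 0 < c by rewrite divr_gt0 ?mulr_gt0.
pose y (x : R) := b - (a + x ^+ 2).
have y0 x : 0 < x < X -> 0 < y x by move=> /dom; rewrite /y; lra.
have dy (x : R) : is_derive x (1 : R) y (- (2 * x)).
  by apply: der_eq (derB (derC b x 1) (dS x)) _; rewrite sub0r.
have dF x : 0 < x < X -> is_derive x 1 (fun x => j x / k x - c * ln (y x))
    (- (G x * rho1 a) / k x ^+ 2 - (0 * ln (y x) + c * ((y x)^-1 * - (2 * x)))).
  move=> hx; apply: derB (dQ hx) (derM (derC c x 1) _).
  exact: (der_comp (f := @ln R) (g := y) (is_derive1_ln (y0 x hx)) (dy x)).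
have F0 x : 0 < x < X ->
    - (G x * rho1 a) / k x ^+ 2 - (0 * ln (y x) + c * ((y x)^-1 * - (2 * x))) <= 0.
  move=> hx; have k0 := tf_k0 fam hx; have yx := y0 x hx.
  have hs := dom hx; have r2 := rho_le2 hs; have rg := rho_gt hs.
  have k24 : k x ^+ 2 <= 4 * y x.
    rewrite k2E// ler_pM//; [lra|lra|lra|].
    exact: hb.
  have k2 : k x <= 2.
    rewrite -(ler_pXn2r (n := 2))// ?nnegrE ?ltW// k2E//.
    have := mulr_ge0 (_ : 0 <= 2 - rho (a + x ^+ 2)) (_ : 0 <= 2 + rho (a + x ^+ 2)).
    by move=> /(_ ltac:(lra) ltac:(have := C_gt0; lra)); have := sqr_ge0 (rho a); nra.
  have k3 : k x ^+ 3 <= 8 * y x.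
    have -> : 8 * y x = 2 * (4 * y x) by ring.
    by rewrite exprS ler_pM// ltW// exprn_gt0.
  have -> : - (G x * rho1 a) / k x ^+ 2 - (0 * ln (y x) + c * ((y x)^-1 * - (2 * x))) =
      - (2 * x * rho1 a * (rho (a + x ^+ 2) / k x ^+ 3 - rho a / (8 * y x))).
    by rewrite GE// /c; field; rewrite !gt_eqF.
  rewrite oppr_le0 mulr_ge0 ?mulr_ge0 ?subr_ge0 ?(ltW W_gt0)//; [lra|].
  rewrite ler_pM ?invr_ge0 ?mulr_ge0 ?(ltW yx) ?(ltW C_gt0) ?(ltW rg)//.
  by rewrite lef_pV2// posrE ?mulr_gt0 ?exprn_gt0.
have Fd := der_noninc dF F0.
pose x1 := X / 2; have x1X : 0 < x1 < X by rewrite /x1; lra.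
pose Q1 := j x1 / k x1.
have Q10 : 0 <= Q1 by rewrite divr_ge0 ?j0// ltW ?(tf_k0 fam).
(* The value of [b - s] at which the logarithmic bound has brought [j / k] from [Q1] down to at most
   [- 1]. *)
pose z := y x1 * expR (- (Q1 + 1) / c).
have z0 : 0 < z by rewrite mulr_gt0 ?y0// expR_gt0.
have zy : z < y x1.
  by rewrite gtr_pMr ?y0// expR_lt1 mulNr oppr_lt0 divr_gt0// ltr_wpDl.
have zX : z < X ^+ 2 by apply: (lt_le_trans zy); rewrite X2 /y; have := sqr_ge0 x1; lra.
pose x2 := Num.sqrt (X ^+ 2 - z).
have x22 : x2 ^+ 2 = X ^+ 2 - z by rewrite sqr_sqrtr ?subr_ge0 ?ltW.
have yx2 : y x2 = z by rewrite /y x22 X2; ring.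
have x20 : 0 < x2 by rewrite sqrtr_gt0 subr_gt0.
have x2X : x2 < X.
  by rewrite -(ltr_pXn2r (n := 2)) ?nnegrE ?ltW// x22; lra.
have x12 : x1 < x2.
  rewrite -(ltr_pXn2r (n := 2)) ?nnegrE ?ltW//; last lra.
  by move: zy; rewrite x22 X2 /y; lra.
have := Fd x1 x2; rewrite -/Q1 yx2 => /(_ _ (ltW x12) x2X).
rewrite {1}/z lnM ?posrE ?y0 ?expR_gt0// expRK => /(_ ltac:(lra)).
have Q20 : 0 <= j x2 / k x2 by rewrite divr_ge0 ?j0 ?x20// ltW ?(tf_k0 fam) ?x20.
have : c * (- (Q1 + 1) / c) = - (Q1 + 1) by field; rewrite gt_eqF.
by rewrite mulrDr; lra.
Qed.

Hypothesis W1 : rho1 a = 1.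
Hypothesis rho1_ge0 : forall s, a < s < b -> 0 <= rho1 s <= 1.
Hypothesis crho1 : {for a, continuous rho1}.

(** With slope 1 at the turning point, the Wronskian identity makes [(j - 1) / k] nonincreasing;
    since [j - 1] has zero slope at 0 while [k] has a positive one, the quotient cannot become
    positive. The bound on [G * j1], the derivative of [j] in [x], then follows from
    [j1 * k = j * rho1 - 1]. *)
Lemma focusing_slope : (forall x, 0 < x < X -> 0 <= j x) ->
  forall x, 0 < x < X -> j x <= 1 /\
    G x * j1 x <= - (2 * x * (rho (a + x ^+ 2) * (1 - rho1 (a + x ^+ 2)) / k x ^+ 2)).
Proof.
have X0' := X0; move=> j0; suff jle1 x : 0 < x < X -> j x <= 1.
  move=> x hx; have jx := jle1 x hx; split=> //.
  have k0 := tf_k0 fam hx; have jx0 := j0 x hx.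
  have hs := dom hx; have /andP[r10 r11] := rho1_ge0 hs.
  have rg : 0 < rho (a + x ^+ 2) := lt_trans C_gt0 (rho_gt hs).
  have hx' : - X < x < X by lra.
  have j1E : j1 x = (j x * rho1 (a + x ^+ 2) - 1) / k x.
    by rewrite -W1 -(tf_W fam hx'); field; rewrite gt_eqF.
  have -> : G x * j1 x =
      - (2 * x * (rho (a + x ^+ 2) * (1 - j x * rho1 (a + x ^+ 2)) / k x ^+ 2)).
    by rewrite GE// j1E; field; rewrite gt_eqF.
  rewrite lerN2 ler_wpM2l//; first lra.
  rewrite ler_wpM2r ?invr_ge0 ?sqr_ge0// ler_wpM2l ?(ltW rg)//.
  by nra.
move=> hx; rewrite leNgt; apply/negP => jx1.
have k0 := tf_k0 fam.
have df z : 0 < z < X -> is_derive z 1 (fun x => (j x - 1) / k x)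
    (G z * (rho1 (a + z ^+ 2) - 1) / k z ^+ 2).
  move=> hz; have hz' : - X < z < X by lra.
  have kn := lt0r_neq0 (k0 z hz).
  have d1 := derB (tf_dj fam hz') (derC (1 : R) z 1).
  have d2 := der_div (f := fun x => j x - 1) kn d1 (tf_dk fam hz').
  apply: der_eq d2 _.
  have := tf_W fam hz'; rewrite W1 => E.
  by rewrite -[in RHS]E; congr (_ / _); ring.
have df0 z : 0 < z < X -> G z * (rho1 (a + z ^+ 2) - 1) / k z ^+ 2 <= 0.
  move=> hz; have /andP[r10 r11] := rho1_ge0 (dom hz).
  rewrite pmulr_lle0 ?invr_gt0 ?exprn_gt0 ?k0// pmulr_rle0; first lra.
  by apply: (tf_G0 fam); lra.
(* If [j x > 1], monotonicity gives [j - 1 >= del * k] on [(0, x)], whereas [j - 1 - del * k]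
   vanishes at 0 with slope [- del * G 0 < 0]. *)
pose del := (j x - 1) / k x.
have del0 : 0 < del by rewrite divr_gt0 ?k0// subr_gt0.
have jge z : 0 < z < x -> del * k z <= j z - 1.
  move=> /andP[z0 zx]; have zX : 0 < z < X by lra.
  rewrite -ler_pdivlMr ?k0//.
  by apply: (der_noninc df df0); lra.
have dD (w : R) : - X < w < X -> is_derive w 1 (fun x => j x - 1 - del * k x)
    (G w * (j1 w - del * rho1 (a + w ^+ 2))).
  move=> hw; have d1 := derB (tf_dj fam hw) (derC (1 : R) w 1).
  by apply: der_eq (derB d1 (derM (derC del w 1) (tf_dk fam hw))) _; ring.
have zX : - X < 0 < X by lra.
have cE : {for 0, continuous (fun z => j1 z - del * rho1 (a + z ^+ 2))}.
  apply: continuousB; first exact: der_cont (tf_dj1 fam zX).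
  apply: continuousM; first exact: cst_continuous.
  apply: (@continuous_comp _ _ _ (fun z : R => a + z ^+ 2) rho1).
    exact: (der_cont (dS 0)).
  by rewrite expr0n /= addr0.
have : \forall z \near (0 : R), j1 z - del * rho1 (a + z ^+ 2) < 0.
  apply: (cvgr_lt _ cE); rewrite (tf_j10 fam) expr0n /= addr0 W1; lra.
move=> /nbhs_ballP[e /= e0 he].
pose y := Num.min (e / 2) (x / 2).
have [y0 ye yx] : [/\ 0 < y, y < e & y < x].
  by rewrite /y; split; rewrite ?lt_min ?gt_min; lra.
have [|u hu] := @mvt R (fun x => j x - 1 - del * k x)
    (fun x => G x * (j1 x - del * rho1 (a + x ^+ 2))) 0 y y0.
  by move=> w hw; apply: dD; lra.
have k00 : k 0 = 0.
  by apply/eqP; have := tf_ko fam 0; rewrite oppr0 => /eqP; rewrite -addr_eq0 -mulr2n mulrn_eq0.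
rewrite (tf_j0 fam) k00 mulr0 !subr0 subrr subr0 => E.
have hb : ball 0 e u by rewrite /ball /= sub0r normrN gtr0_norm; lra.
have := he _ hb; have := jge y ltac:(lra).
have Gu : 0 < G u by apply: (tf_G0 fam); lra.
rewrite -subr_ge0 E => h1 h2.
have : G u * (j1 u - del * rho1 (a + u ^+ 2)) * y < 0.
  by rewrite pmulr_llt0// pmulr_rlt0.
by rewrite ltNge h1.
Qed.

(** Height at most [d] gives [k ^+ 2 <= 2 * rho * d], so [j + (s - rho) / (2 * d)] is nonincreasing.
    As [j] stays between 0 and 1, [s - rho] grows by at most [2 * d], and [rho] itself by at most
    [d]. *)
Lemma focusing_short d : 0 < d -> (forall x, 0 < x < X -> 0 <= j x) ->
  (forall s, a < s < b -> rho s - rho a <= d) ->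
  (forall s, a < s < b -> is_derive s 1 rho (rho1 s)) ->
  forall s1 s2, a < s1 -> s1 < s2 -> s2 < b -> s2 - s1 <= 3 * d.
Proof.
move=> d0 j0 hd drho s1 s2 as1 s12 s2b; have C0 := C_gt0.
have sl := focusing_slope j0.
pose c := (2 * d)^-1; have c0 : 0 < c by rewrite invr_gt0 mulr_gt0.
have dF x : 0 < x < X ->
    is_derive x 1 (fun x => j x + c * (a + x ^+ 2 - rho (a + x ^+ 2)))
      (G x * j1 x + (0 * (a + x ^+ 2 - rho (a + x ^+ 2)) +
        c * (2 * x - rho1 (a + x ^+ 2) * (2 * x)))).
  move=> hx; have hx' : - X < x < X by lra.
  have d1 := der_comp (f := rho) (g := fun x => a + x ^+ 2) (drho _ (dom hx)) (dS x).
  exact: derD (tf_dj fam hx') (derM (derC c x 1) (derB (dS x) d1)).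
have F0 x : 0 < x < X -> G x * j1 x + (0 * (a + x ^+ 2 - rho (a + x ^+ 2)) +
        c * (2 * x - rho1 (a + x ^+ 2) * (2 * x))) <= 0.
  move=> hx; have [_ h] := sl x hx; have k0 := tf_k0 fam hx.
  have hs := dom hx; have /andP[r10 r11] := rho1_ge0 hs.
  have rg := rho_gt hs; have rd := hd _ hs.
  have ck : c <= rho (a + x ^+ 2) / k x ^+ 2.
    rewrite /c -[X in X <= _]mul1r ler_pdivrMr ?mulr_gt0// mulrAC.
    rewrite ler_pdivlMr ?exprn_gt0// mul1r k2E//; nra.
  apply: (le_trans (lerD h (lexx _))).
  have -> : - (2 * x * (rho (a + x ^+ 2) * (1 - rho1 (a + x ^+ 2)) / k x ^+ 2)) +
     (0 * (a + x ^+ 2 - rho (a + x ^+ 2)) + c * (2 * x - rho1 (a + x ^+ 2) * (2 * x))) =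
     - (2 * x * (1 - rho1 (a + x ^+ 2)) * (rho (a + x ^+ 2) / k x ^+ 2 - c)) by ring.
  by rewrite oppr_le0 !mulr_ge0 ?subr_ge0//; lra.
pose x1 := Num.sqrt (s1 - a); pose x2 := Num.sqrt (s2 - a).
have e1 : x1 ^+ 2 = s1 - a by rewrite sqr_sqrtr; lra.
have e2 : x2 ^+ 2 = s2 - a by rewrite sqr_sqrtr; lra.
have x10 : 0 < x1 by rewrite sqrtr_gt0; lra.
have x12 : x1 < x2 by rewrite ltr_sqrt; lra.
have x2X : x2 < X by rewrite ltr_sqrt; lra.
have := der_noninc dF F0 x10 (ltW x12) x2X.
rewrite e1 e2 !(addrC a) !subrK.
have [j1le _] := sl x1 ltac:(lra); have j2ge := j0 x2 ltac:(lra).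
have r2 := hd s2 ltac:(lra); have r1 := rho_gt (s := s1) ltac:(lra).
rewrite -lerBrDr => h; have : c * (s2 - s1 - d) <= 1.
  apply: le_trans (_ : c * (s2 - s1 - (rho s2 - rho s1)) <= _); last first.
    by rewrite -(lerD2l (j x2)); lra.
  by rewrite ler_pM2l//; lra.
by rewrite mulrC ler_pdivrMr ?mulr_gt0// mul1r; lra.
Qed.

(** Here [k ^+ 2 <= 2 * rho * (d + (s - s0))] and [1 - rho1 >= eta], so [j] falls at least as fast
    as [eta / 2 * ln (d + (s - s0))] rises, and it can fall by at most 1. Allowing [s0] beyond [a]
    skips the stretch where the slope is not yet bounded away from 1. *)
Lemma focusing_long d eta s0 : 0 < d -> 0 < eta -> a <= s0 ->
  (forall x, 0 < x < X -> 0 <= j x) ->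
  (forall s, s0 < s < b -> rho s - rho a <= d + (s - s0) /\ rho1 s <= 1 - eta) ->
  forall s1 s2, s0 < s1 -> s1 < s2 -> s2 < b ->
    eta / 2 * (ln (d + (s2 - s0)) - ln (d + (s1 - s0))) <= 1.
Proof.
move=> d0 eta0 as0 j0 hd s1 s2 s01 s12 s2b; have C0 := C_gt0.
have sl := focusing_slope j0.
pose x0 := Num.sqrt (s0 - a).
have e0 : x0 ^+ 2 = s0 - a by rewrite sqr_sqrtr; lra.
have x00 : 0 <= x0 by exact: sqrtr_ge0.
have dom0 x : x0 < x < X -> s0 < a + x ^+ 2.
  move=> /andP[x0x _]; rewrite -ltrBlDl -e0 ltr_pXn2r// nnegrE; lra.
pose y (x : R) := d + (a + x ^+ 2 - s0).
have y0 x : x0 < x < X -> 0 < y x by move=> /dom0; rewrite /y; lra.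
have dy (x : R) : is_derive x (1 : R) y (2 * x).
  apply: der_eq (derD (derC d x 1) (derB (dS x) (derC s0 x 1))) _.
  by rewrite add0r subr0.
have dF x : x0 < x < X -> is_derive x 1 (fun x => j x + eta / 2 * ln (y x))
      (G x * j1 x + (0 * ln (y x) + eta / 2 * ((y x)^-1 * (2 * x)))).
  move=> hx; have hx' : - X < x < X by have := X0; lra.
  have d1 := der_comp (f := @ln R) (g := y) (is_derive1_ln (y0 x hx)) (dy x).
  exact: derD (tf_dj fam hx') (derM (derC (eta / 2) x 1) d1).
have F0 x : x0 < x < X ->
    G x * j1 x + (0 * ln (y x) + eta / 2 * ((y x)^-1 * (2 * x))) <= 0.
  move=> hx; have hx' : 0 < x < X by lra.
  have [_ h] := sl x hx'; have k0 := tf_k0 fam hx'.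
  have hs := dom hx'; have hs0 := dom0 x hx.
  have [rd r1] : rho (a + x ^+ 2) - rho a <= y x /\ rho1 (a + x ^+ 2) <= 1 - eta.
    by apply: hd; lra.
  have rg := rho_gt hs; have yx := y0 x hx.
  have ck : (2 * y x)^-1 <= rho (a + x ^+ 2) / k x ^+ 2.
    rewrite -[X in X <= _]mul1r ler_pdivrMr ?mulr_gt0// mulrAC.
    rewrite ler_pdivlMr ?exprn_gt0// mul1r k2E//; nra.
  apply: (le_trans (lerD h (lexx _))).
  have -> : - (2 * x * (rho (a + x ^+ 2) * (1 - rho1 (a + x ^+ 2)) / k x ^+ 2)) +
     (0 * ln (y x) + eta / 2 * ((y x)^-1 * (2 * x))) =
     - (2 * x * ((1 - rho1 (a + x ^+ 2)) * (rho (a + x ^+ 2) / k x ^+ 2)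
                  - eta * (2 * y x)^-1)).
    by field; rewrite !gt_eqF.
  rewrite oppr_le0 mulr_ge0 ?subr_ge0//; first lra.
  apply: ler_pM => //; rewrite ?invr_ge0 ?mulr_ge0 ?(ltW yx) ?(ltW eta0)//; lra.
pose x1 := Num.sqrt (s1 - a); pose x2 := Num.sqrt (s2 - a).
have e1 : x1 ^+ 2 = s1 - a by rewrite sqr_sqrtr; lra.
have e2 : x2 ^+ 2 = s2 - a by rewrite sqr_sqrtr; lra.
have x01 : x0 < x1 by rewrite ltr_sqrt; lra.
have x12 : x1 < x2 by rewrite ltr_sqrt; lra.
have x2X : x2 < X by rewrite ltr_sqrt; lra.
have := der_noninc dF F0 x01 (ltW x12) x2X.
rewrite /y e1 e2 !(addrC a) !subrK.
have [j1le _] := sl x1 ltac:(lra); have j2ge := j0 x2 ltac:(lra).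
by rewrite mulrBr; lra.
Qed.

End Focusing.

(** * Profiles close to a great circle *)

Section Profiles.
Variable R : realType.

Lemma der_gt0_right (f : R -> R) (x l : R) : is_derive x 1 f l -> 0 < l ->
  \forall y \near x^'+, f x < f y.
Proof.
move=> /is_derive1_caratheodory [g [gE gc gx]] l0.
have : \forall y \near x, 0 < g y by apply: (cvgr_gt _ gc); rewrite gx.
move=> h; near=> y; rewrite -subr_gt0 gE mulr_gt0 ?subr_gt0//.
by near: y; apply: cvg_within; exact: h.
Unshelve. all: by end_near. Qed.

Lemma der_gt0_left (f : R -> R) (x l : R) : is_derive x 1 f l -> l < 0 ->
  \forall y \near x^'-, f x < f y.
Proof.
move=> /is_derive1_caratheodory [g [gE gc gx]] l0.
have : \forall y \near x, g y < 0 by apply: (cvgr_lt _ gc); rewrite gx.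
move=> h; near=> y; rewrite -subr_gt0 gE nmulr_rgt0 ?subr_lt0//.
by near: y; apply: cvg_within; exact: h.
Unshelve. all: by end_near. Qed.

Lemma near_right_ex (P : R -> Prop) (x y : R) : x < y ->
  (\forall z \near x^'+, P z) -> exists2 z, x < z < y & P z.
Proof.
move=> xy h; have [z [zP zx]] : exists z, P z /\ x < z < y.
  near (x^'+) => z; exists z; split; first by near: z.
  by apply/andP; split; near: z; [exact: nbhs_right_gt|exact: nbhs_right_lt].
by exists z.
Unshelve. all: by end_near. Qed.

Lemma near_left_ex (P : R -> Prop) (x y : R) : y < x ->
  (\forall z \near x^'-, P z) -> exists2 z, y < z < x & P z.
Proof.
move=> xy h; have [z [zP zx]] : exists z, P z /\ y < z < x.
  near (x^'-) => z; exists z; split; first by near: z.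
  by apply/andP; split; near: z; [exact: nbhs_left_gt|exact: nbhs_left_lt].
by exists z.
Unshelve. all: by end_near. Qed.

(** [b] is the infimum of the later points where [f] is back at or below [f a]; the positive slope
    at [a] keeps these points away from [a]. *)
Lemma first_return (f : R -> R) (a s l : R) : a < s ->
  (forall t, a <= t <= s -> {for t, continuous f}) ->
  is_derive a 1 f l -> 0 < l -> f s < f a ->
  exists2 b, a < b <= s & f b = f a /\ forall t, a < t < b -> f a < f t.
Proof.
move=> as_ fc fa l0 fs.
have : \forall y \near a^'+, f a < f y by exact: der_gt0_right fa l0.
move=> /nbhs_ballP [e /= e0 he].
have right t : a < t < a + e -> f a < f t.
  move=> /andP[h1 h2]; apply: he => //=.
  by rewrite /ball /= ltr0_norm; lra.
pose B := [set t : R | a < t <= s /\ f t <= f a].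
have Bs : B s by split; [lra|exact: ltW].
have lbB : lbound B a by move=> t [/andP[/ltW]].
have hB : has_inf B by split; [exists s|exists a].
have bs : inf B <= s by apply: ge_inf => //; exists a.
have ab : a < inf B.
  apply: (@lt_le_trans _ _ (a + e)); first by rewrite ltrDl.
  apply: lb_le_inf; first by exists s.
  move=> t [/andP[h1 h2] h3]; rewrite leNgt; apply/negP => h4.
  by have := right t; rewrite h1 h4 ltNge h3 => /(_ isT).
have below t : a < t < inf B -> f a < f t.
  move=> /andP[h1 h2]; rewrite ltNge; apply/negP => h3.
  have : B t by split => //; rewrite h1; lra.
  by move=> /(ge_inf (ex_intro _ a lbB)); rewrite leNgt h2.
have fb : f (inf B) <= f a.
  rewrite leNgt; apply/negP => h.
  have cb : {for inf B, continuous f} by apply: fc; lra.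
  have : \forall t \near inf B, f a < f t by exact: (cvgr_gt _ cb).
  move=> /nbhs_ballP [d /= d0 hd].
  have [t [/andP[h1 h2] h3] h4] := inf_adherent d0 hB.
  have h5 : inf B <= t by apply: ge_inf; [exists a|split=> //; rewrite h1].
  have /hd : ball (inf B) d t by rewrite /ball /= ler0_norm; lra.
  by rewrite ltNge h3.
exists (inf B); first by rewrite ab.
split=> //; apply/eqP; rewrite eq_le fb /= leNgt; apply/negP => h.
have [t /andP[h1 h2] h3] := near_right_ex ab (der_gt0_right fa l0).
have [||t' h4 h5] := @ivt_dec _ f t (inf B) (f a) (ltW h2).
- by move=> x hx; apply: fc; lra.
- by rewrite (ltW h) (ltW h3).
have t'n : t' != inf B by apply: contraTneq h => <-; rewrite h5 ltxx.
have t'b : t' < inf B by rewrite lt_neqAle t'n; lra.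
by have := below t'; rewrite h5 ltxx t'b => /(_ ltac:(lra)).
Unshelve. all: by end_near. Qed.

(** A maximum of [f] would only give slope 0, but a turning geodesic has to start where the slope is
    positive. Tilting [f] by a small slope [kap] moves the maximum to a point where [df] equals
    [kap]. *)
Lemma steep_point (f df : R -> R) (s : R) : 0 < s ->
  (forall t, 0 <= t <= s -> is_derive t 1 f (df t)) ->
  0 < df 0 -> df s < 0 ->
  exists2 a, 0 < a < s & 0 < df a /\ f s < f a.
Proof.
move=> s0 fd d0 ds.
have h0 : is_derive (0 : R) 1 f (df 0) by apply: fd; lra.
have hs : is_derive s 1 f (df s) by apply: fd; lra.
have [u us ul] : exists2 u, 0 < u < s & f 0 < f u /\ f s < f u.
  have [h|h] := leP (f 0) (f s).
    have [u us fu] := near_left_ex s0 (der_gt0_left hs ds).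
    by exists u => //; split=> //; exact: le_lt_trans fu.
  have [u us fu] := near_right_ex s0 (der_gt0_right h0 d0).
  by exists u => //; split=> //; exact: lt_trans fu.
pose l := Num.max (f 0) (f s).
have [l1 l2 lu] : [/\ f 0 <= l, f s <= l & l < f u].
  by rewrite /l; case: ul => ? ?; split; rewrite ?le_max ?gt_max; lra.
(* Over the whole interval the tilt takes away half of the gap [f u - l], so the maximum of [h] is
   attained where [f > l], hence at neither end. *)
pose kap := (f u - l) / (2 * s).
have kap0 : 0 < kap by rewrite divr_gt0 ?mulr_gt0 ?subr_gt0.
have kapE : kap * s = (f u - l) / 2 by rewrite /kap; field; rewrite gt_eqF.
pose h t := f t - kap * t.
have hd t : 0 <= t <= s -> is_derive t 1 h (df t - kap).
  move=> /fd ht; apply: der_eq (derB ht (derM (derC kap t 1) (derI t))) _.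
  by rewrite mul0r add0r mulr1.
have [|a] := @EVT_max R h 0 s (ltW s0).
  by apply: cont_seg => t /hd/der_cont.
rewrite in_itv /= => as_ amax.
have au : f u - kap * u <= f a - kap * a.
  by apply: (amax u); rewrite in_itv /=; lra.
have fal : l < f a.
  have : kap * a >= 0 by rewrite mulr_ge0 ?(ltW kap0)//; lra.
  have : kap * u <= kap * s by rewrite ler_pM2l//; lra.
  by rewrite kapE; lra.
have an0 : a != 0 by apply: contraTneq fal => ->; rewrite -leNgt.
have ans : a != s by apply: contraTneq fal => ->; rewrite -leNgt.
have as' : 0 < a < s by rewrite !lt_neqAle eq_sym an0 ans.
exists a => //; split; last lra.
have : is_derive a 1 h 0.
  apply: (@derive1_at_max _ h 0 s a (ltW s0)).
  - move=> t; rewrite in_itv /= => ht; have [] // : is_derive t 1 h (df t - kap).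
    by apply: hd; lra.
  - by rewrite in_itv.
  - by move=> t; rewrite in_itv /= => ht; apply: amax; rewrite in_itv /=; lra.
move=> h1; have := der_uniq h1 (hd a as_) => e; lra.
Qed.
End Profiles.

(** The interface between the one-variable analysis of profiles, which produces these data, and the
    geometry, which turns them into conjugate points. *)
Definition focusing (R : realType) (rho rho1 rho2 : R -> R) (sigma : R) :=
  exists a b G k j j1 x, [/\ 0 <= a < b /\ b < sigma,
    0 < rho1 a /\ (forall s, a < s < b -> rho a < rho s),
    turning_family rho rho1 rho2 a (Num.sqrt (b - a)) G k j j1 &
    0 < x < Num.sqrt (b - a) /\ j x < 0].

Section Profile.
Variable R : realType.
Variables (sigma d sr cr : R) (rho rho1 rho2 z z1 : R -> R).
Hypothesis sigma0 : 0 < sigma.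
Hypothesis d0 : 0 < d.
Hypothesis sr0 : 0 < sr.
Hypothesis cr0 : 0 < cr.
Hypothesis srcr : sr ^+ 2 + cr ^+ 2 = 1.
Let mu := Num.min sr cr.
(** Small enough that a slope [rho1 > 1 - eta] forces [|z1| <= sr / 8]. *)
Let eta := sr ^+ 2 / 128.
Hypothesis d_sr : d <= sr / 12.
Hypothesis d_sigma : 2 * d / mu <= sigma / 16.
Hypothesis d_eta : 16 * d * expR (2 / eta) < sigma.
Hypothesis drho : forall s, 0 <= s < sigma -> is_derive s 1 rho (rho1 s).
Hypothesis drho1 : forall s, 0 <= s < sigma -> is_derive s 1 rho1 (rho2 s).
Hypothesis crho2 : forall s, 0 <= s < sigma -> {for s, continuous rho2}.
Hypothesis dz : forall s, 0 <= s < sigma -> is_derive s 1 z (z1 s).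
Hypothesis cz1 : forall s, 0 <= s < sigma -> {for s, continuous z1}.
Hypothesis unit_speed : forall s, 0 <= s < sigma -> rho1 s ^+ 2 + z1 s ^+ 2 = 1.
Hypothesis rho_bnd : forall s, 0 <= s < sigma -> 0 < rho s <= 2.
Hypothesis z_bnd : forall s, 0 <= s < sigma -> `|z s| <= 2.
Hypothesis rho_0 : rho 0 = sr.
Hypothesis z_0 : z 0 = cr.
Hypothesis rho1_0 : rho1 0 = sr.
Hypothesis z1_0 : z1 0 = cr.
(** The form in which closeness to the unit sphere reaches the profile; [(sr, cr)] is the rim point
    in the half-plane of the meridian. *)
Hypothesis far_spherical : forall s, 0 <= s < sigma ->
  d ^+ 2 <= (rho s - sr) ^+ 2 + (z s - cr) ^+ 2 ->
  rho s ^+ 2 + z s ^+ 2 <= (1 + d) ^+ 2 /\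
  `|rho s * rho1 s + z s * z1 s| <= 3 * d.

Let rho1_le1 s : 0 <= s < sigma -> `|rho1 s| <= 1.
Proof.
move=> /unit_speed h; rewrite -(ler_pXn2r (n := 2)) ?nnegrE// expr1n.
by rewrite real_normK ?num_real//; have := sqr_ge0 (z1 s); lra.
Qed.

Let family_at a b : 0 <= a < b -> b < sigma -> 0 < rho1 a ->
  (forall s, a < s < b -> rho a < rho s) ->
  exists G k j j1, turning_family rho rho1 rho2 a (Num.sqrt (b - a)) G k j j1.
Proof.
move=> hab hb r1 hgt.
apply: turning_family_exists => //; first lra.
- by move=> s hs; apply: drho; lra.
- by move=> s hs; apply: drho1; lra.
- by move=> s hs; apply: crho2; lra.
- by move=> s hs; have /andP[] : 0 < rho s <= 2 by apply: rho_bnd; lra.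
Qed.

Let rho_lip s t : 0 <= s -> s <= t -> t < sigma -> `|rho t - rho s| <= t - s.
Proof.
move=> s0; rewrite le_eqVlt => /predU1P[<- _|st ts]; first by rewrite !subrr normr0.
have [|u hu ->] := @mvt R rho rho1 s t st.
  by move=> x hx; apply: drho; lra.
rewrite normrM [X in _ * X]gtr0_norm ?subr_gt0// ler_piMl ?subr_ge0 ?(ltW st)//.
by apply: rho1_le1; lra.
Qed.

(** A descent of [rho] yields a parallel [a] of positive slope to which the profile returns at some
    [b]. Unit speed bounds [rho s - rho a = rho s - rho b] by [b - s], as [focusing_return]
    requires. *)
Lemma profile_monotone : ~ focusing rho rho1 rho2 sigma ->
  forall s, 0 <= s < sigma -> 0 <= rho1 s.
Proof.
move=> nf s hs; rewrite leNgt; apply/negP => r1s.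
have s_gt0 : 0 < s.
  rewrite lt_neqAle; case/andP: hs => -> _; rewrite andbT.
  by apply: contraTneq r1s => <-; rewrite rho1_0 -leNgt ltW.
have [|||a has [r1a ra]] := @steep_point R rho rho1 s s_gt0 => //.
- by move=> t ht; apply: drho; lra.
- by rewrite rho1_0.
have [|||||b hb [rb rgt]] := @first_return R rho a s (rho1 a) => //.
- by case/andP: has.
- by move=> t ht; apply: (der_cont (drho _)); lra.
- by apply: drho; lra.
have hab : 0 <= a < b by lra.
have bs : b < sigma by lra.
have [G [k [j [j1 fam]]]] := family_at hab bs r1a rgt.
have ab : a < b by lra.
have [||||x hx jx] := focusing_return ab fam r1a.
- by have /andP[] : 0 < rho a <= 2 by apply: rho_bnd; lra.
- by move=> t ht; have /andP[] : 0 < rho t <= 2 by apply: rho_bnd; lra.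
- exact: rgt.
- move=> t ht; rewrite -rb.
  have := @rho_lip t b; rewrite distrC => /(_ ltac:(lra) ltac:(lra) bs).
  by rewrite ler_norml => /andP[_].
by apply: nf; exists a, b, G, k, j, j1, x.
Qed.

Let mu0 : 0 < mu. Proof. by rewrite lt_min sr0. Qed.

Let rho_mono s t : (forall s, 0 <= s < sigma -> 0 <= rho1 s) ->
  0 <= s -> s <= t -> t < sigma -> rho s <= rho t.
Proof.
move=> r1; move=> s0; rewrite le_eqVlt => /predU1P[<-//|st ts].
have [|u hu e] := @mvt R rho rho1 s t st.
  by move=> x hx; apply: drho; lra.
rewrite -subr_ge0 e mulr_ge0 ?subr_ge0 ?(ltW st)//; apply: r1; lra.
Qed.

(* If [z1 > 0] throughout, the profile moves away from the origin fast enough to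
   leave the ball of radius [1 + d]. *)
Lemma profile_flat_point : (forall s, 0 <= s < sigma -> 0 <= rho1 s) ->
  exists2 a, 0 <= a <= 2 * d / mu & rho1 a = 1.
Proof.
move=> r1; pose e := 2 * d / mu; rewrite -/e.
have m0 := mu0; have s0 := sigma0; have d0' := d0.
have e0 : 0 < e by rewrite divr_gt0 ?mulr_gt0.
have es : e < sigma by have : e <= sigma / 16 := d_sigma; lra.
have mue : mu * e = 2 * d by rewrite /e; field; rewrite gt_eqF.
have mu1 : mu <= 1.
  have : sr <= 1 by have := sqr_ge0 cr; have := srcr; have := sr0; nra.
  by apply: le_trans; rewrite ge_min lexx.
(* The slope is 1 where [z1 = 0], which continuity provides as soon as [z1], initially [cr > 0], is
   no longer positive. *)
suff [t ht z1t] : exists2 t, 0 <= t <= e & z1 t <= 0.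
  have [|x hx||a ha z1a] := @ivt_dec R z1 0 t 0; first lra.
  - by apply: cz1; lra.
  - by rewrite z1t z1_0 ltW.
  exists a; first lra.
  have has : 0 <= a < sigma by lra.
  have := unit_speed has; rewrite z1a expr0n /= addr0 => /eqP.
  by rewrite sqrp_eq1 ?r1// => /eqP.
apply: contrapT => nt.
have z1p t : 0 <= t <= e -> 0 < z1 t.
  by move=> ht; rewrite ltNge; apply/negP => h; apply: nt; exists t.
have zge : z 0 <= z e.
  have [|u hu E] := @mvt R z z1 0 e e0; first by move=> x hx; apply: dz; lra.
  by rewrite -subr_ge0 E mulr_ge0 ?subr_ge0 ?(ltW e0)// ltW// z1p; lra.
have rge : rho 0 <= rho e by apply: rho_mono => //; exact: ltW.
(* A unit vector with nonnegative coordinates has coordinate sum at least 1. *)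
have sge : e <= rho e - rho 0 + (z e - z 0).
  have [|u hu E] := @mvt R (fun s => rho s + z s) (fun s => rho1 s + z1 s) 0 e e0.
    by move=> x hx; apply: derD; [apply: drho|apply: dz]; lra.
  have hus : 0 <= u < sigma by lra.
  have := unit_speed hus; have := r1 u hus; have := z1p u ltac:(lra) => h1 h2 h3.
  have h4 : 1 <= rho1 u + z1 u by nra.
  have : 1 * e <= (rho1 u + z1 u) * (e - 0) by rewrite subr0 ler_pM2r.
  by rewrite -E /=; lra.
have he : 0 <= e < sigma by lra.
move: zge rge sge (far_spherical he); rewrite z_0 rho_0 => h1 h2 h3.
pose p := rho e - sr; pose q := z e - cr.
have p0 : 0 <= p by rewrite subr_ge0.
have q0 : 0 <= q by rewrite subr_ge0.
have e2d : 2 * d <= e by rewrite -mue; nra.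
have pq : e <= p + q by rewrite /p /q; lra.
have pq2 : (2 * d) ^+ 2 <= (p + q) ^+ 2.
  by rewrite ler_pXn2r ?nnegrE ?mulr_ge0 ?(addr_ge0 p0 q0) ?(ltW d0')//; lra.
have far : d ^+ 2 <= (rho e - sr) ^+ 2 + (z e - cr) ^+ 2.
  rewrite -/p -/q; have -> : p ^+ 2 + q ^+ 2 = ((p + q) ^+ 2 + (p - q) ^+ 2) / 2 by field.
  by move: pq2; rewrite exprMn; have := sqr_ge0 (p - q); have := sqr_ge0 d; lra.
move=> /(_ far)[h _].
(* As [(sr, cr)] is a unit vector, a displacement [(p, q)] with [p + q >= e] raises the squared norm
   to at least [1 + 2 * mu * e = 1 + 4 * d], more than [(1 + d) ^+ 2] because [d <= 1]. *)
have h5 : 1 + 2 * (sr * p + cr * q) <= rho e ^+ 2 + z e ^+ 2.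
  have -> : rho e = sr + p by rewrite /p; ring.
  have -> : z e = cr + q by rewrite /q; ring.
  by have := srcr; nra.
have h6 : mu * e <= sr * p + cr * q.
  have [h7 h8] : mu <= sr /\ mu <= cr by rewrite !ge_min !lexx orbT.
  by apply: (@le_trans _ _ (mu * (p + q))); [rewrite ler_pM2l|nra].
have sr1 : sr <= 1 by have := sqr_ge0 cr; have := srcr; have := sr0; nra.
have d1 : d <= 1 by have := d_sr; lra.
by nra.
Qed.

Let eta0 : 0 < eta. Proof. by rewrite divr_gt0 ?exprn_gt0. Qed.

(** A slope above [1 - eta] leaves [|z1| <= sr / 8], hence [rho * rho1 + z * z1 >= sr * (1 - 1 /
    128) - sr / 4]. This exceeds the [3 * d <= sr / 4] allowed by [far_spherical]. *)
Lemma far_slope s : (forall s, 0 <= s < sigma -> 0 <= rho1 s) ->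
  0 <= s < sigma -> sr + d <= rho s -> rho1 s <= 1 - eta.
Proof.
move=> r1 hs rs; have s1 := sr0; have dd := d0; have dsr := d_sr.
have [|_] := far_spherical hs.
  by have := sqr_ge0 (z s - cr); nra.
rewrite ler_norml => /andP[_ h].
have zs := z_bnd hs; have r1s := r1 s hs; have u := unit_speed hs.
rewrite leNgt; apply/negP => h1.
have srle1 : sr <= 1 by have := sqr_ge0 cr; have := srcr; nra.
have eta1 : eta <= 1 by rewrite /eta; nra.
have z1s : `|z1 s| <= sr / 8.
  rewrite -(ler_pXn2r (n := 2)) ?nnegrE//; last lra.
  rewrite real_normK ?num_real//; move: h1; rewrite /eta => h1.
  by have : 1 - sr ^+ 2 / 64 <= rho1 s ^+ 2; nra.
have : - (z s * z1 s) <= 2 * (sr / 8).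
  by rewrite -normrN in zs *; rewrite -mulNr; apply: le_trans (ler_norm _) _; rewrite normrM ler_pM.
have : sr * (1 - eta) <= rho s * rho1 s.
  by apply: ler_pM; lra.
have : sr * eta <= sr / 128 by rewrite ler_pM2l// /eta; nra.
by lra.
Qed.

Lemma profile_focusing : focusing rho rho1 rho2 sigma.
Proof.
apply: contrapT => nf.
have r1 := profile_monotone nf.
have [a ha r1a] := profile_flat_point r1.
have s0 := sigma0; have dd := d0; have sr_ := sr0; have ds := d_sigma; have e0 := eta0.
have e2d : 2 * d <= 2 * d / mu.
  have mu1 : mu <= 1.
    have : sr <= 1 by have := sqr_ge0 cr; have := srcr; nra.
    by apply: le_trans; rewrite ge_min lexx.
  by rewrite ler_pdivlMr ?mu0//; nra.
have C0 : sr <= rho a by rewrite -rho_0; apply: rho_mono => //; lra.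
have Cpos : 0 < rho a by lra.
have W0 : 0 < rho1 a by rewrite r1a.
have rgt s : a < s < sigma -> rho a < rho s.
  move=> /andP[as_ ss]; have ha' : is_derive a 1 rho (rho1 a) by apply: drho; lra.
  have [u hu ru] := near_right_ex as_ (der_gt0_right ha' W0).
  by apply: (lt_le_trans ru); apply: rho_mono => //; lra.
have main b : a < b -> b < sigma -> exists G k j j1,
    turning_family rho rho1 rho2 a (Num.sqrt (b - a)) G k j j1 /\
    forall x, 0 < x < Num.sqrt (b - a) -> 0 <= j x.
  move=> ab bs; have hab : 0 <= a < b by lra.
  have rgt' s : a < s < b -> rho a < rho s by move=> hs; apply: rgt; lra.
  have [G [k [j [j1 fam]]]] := family_at hab bs W0 rgt'.
  exists G, k, j, j1; split=> // x hx; rewrite leNgt; apply/negP => jx.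
  by apply: nf; exists a, b, G, k, j, j1, x.
have cr1 : {for a, continuous rho1} by apply: (der_cont (drho1 _)); lra.
have r101 b : b < sigma -> forall s, a < s < b -> 0 <= rho1 s <= 1.
  move=> bs s hs; rewrite r1/=; last lra.
  by apply: le_trans (ler_norm _) (rho1_le1 _); lra.
(* Either [rho] stays within [d] of its rim value up to [sigma / 2], a band too long for
   [focusing_short], or the slope is at most [1 - eta] from some [s1 <= sigma / 2] on and
   [focusing_long] applies. *)
have [h|h] := leP (rho (sigma / 2)) (sr + d).
  have ab : a < sigma / 2 by lra.
  have bs : sigma / 2 < sigma by lra.
  have [G [k [j [j1 [fam j0]]]]] := main _ ab bs.
  have := focusing_short ab fam Cpos _ r1a (r101 _ bs) cr1 dd j0.
  move=> /(_ _ _ _ (a + sigma / 16) (sigma / 2 - sigma / 16)).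
  (* As [a] and [2 * d] are at most [sigma / 16], the right side is at least [5 * sigma / 16] and
     the left side at most [3 * sigma / 32]. *)
  have H : 3 * d < sigma / 2 - sigma / 16 - (a + sigma / 16) by lra.
  rewrite leNgt H => /(_ _ _ _ ltac:(lra) ltac:(lra) ltac:(lra)) H2; apply/notF/H2.
  - by move=> s hs; apply: rgt; lra.
  - move=> s hs; have : rho s <= rho (sigma / 2) by apply: rho_mono => //; lra.
    lra.
  - by move=> s hs; apply: drho; lra.
have [s1 hs1 [h1 h2]] : exists2 s1, a <= s1 <= sigma / 2 &
    sr + d <= rho s1 /\ rho s1 - rho a <= d.
  (* The turning parallel may already be above the height [sr + d]; otherwise [s1] is where this
     height is reached, and [rho s1 - rho a <= d] because [sr <= rho a]. *)
  have [ra|ra] := leP (sr + d) (rho a); first by exists a; [lra|rewrite subrr; lra].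
  have [|x hx||s1 hs1 e] := @ivt_inc R rho a (sigma / 2) (sr + d); first lra.
  - by apply: (der_cont (drho _)); lra.
  - by rewrite !ltW.
  by exists s1 => //; rewrite e; lra.
have ab : a < 3 * sigma / 4 by lra.
have bs : 3 * sigma / 4 < sigma by lra.
have [G [k [j [j1 [fam j0]]]]] := main _ ab bs.
have as1 : a <= s1 by lra.
have := @focusing_long R rho rho1 rho2 a _ _ _ _ _ ab fam Cpos.
move=> /(_ _ r1a (r101 _ bs) cr1 d eta s1 dd e0 as1 j0 _ (s1 + d) (5 * sigma / 8)).
have -> : d + (s1 + d - s1) = 2 * d by ring.
move=> H; have {H} : eta / 2 * (ln (d + (5 * sigma / 8 - s1)) - ln (2 * d)) <= 1.
  apply: H; try lra.
  - by move=> s hs; apply: rgt; lra.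
  - move=> s hs; have hss : 0 <= s < sigma by lra.
    split; last first.
      apply: far_slope => //; apply: (le_trans h1); apply: rho_mono => //; lra.
    have := @rho_lip s1 s ltac:(lra) ltac:(lra) ltac:(lra).
    by rewrite ler_norml => /andP[_]; lra.
(* Between [s1 + d] and [5 * sigma / 8] the argument of the logarithm grows from [2 * d] to more
   than [sigma / 8], and [d_eta] makes this ratio exceed [expR (2 / eta)]. *)
have : 2 * d * expR (2 / eta) < d + (5 * sigma / 8 - s1).
  by have := d_eta; lra.
rewrite -ltr_ln ?posrE ?mulr_gt0 ?expR_gt0//; last lra.
rewrite lnM ?posrE ?mulr_gt0 ?expR_gt0// expRK => H1.
have H2 : 2 / eta < ln (d + (5 * sigma / 8 - s1)) - ln (2 * d) by lra.
move: H2; rewrite -(ltr_pM2l (x := eta / 2)); last lra.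
have -> : eta / 2 * (2 / eta) = 1 by field; rewrite gt_eqF.
by move=> H3 H4; lra.
Qed.

End Profile.

(** * Curves on surfaces *)

Section VectorCalculus.
Variable R : realType.

Lemma cvg_der (V : normedModType R) (f : R -> V) (x : R) (l : V) :
  h^-1 *: (f (h + x) - f x) @[h --> 0^'] --> l -> is_derive x 1 f l.
Proof.
move=> h.
have h' : h^-1 *: ((f \o shift x) (h *: 1) - f x) @[h --> 0^'] --> l.
  by under eq_fun do rewrite /= [_ *: 1]mulr1.
by apply: DeriveDef; [apply/cvg_ex; exists l|exact: cvg_lim h'].
Qed.

Lemma der_cvg (V : normedModType R) (f : R -> V) (x : R) (l : V) :
  is_derive x 1 f l -> h^-1 *: (f (h + x) - f x) @[h --> 0^'] --> l.
Proof.
move=> [df <-]; have : h^-1 *: ((f \o shift x) (h *: 1) - f x) @[h --> 0^'] --> 'D_1 f x.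
  exact: df.
by under eq_fun do rewrite /= [_ *: 1]mulr1.
Qed.

Lemma der_mx (V : normedModType R) m n (f : V -> 'M[R]_(m, n)) (x v : V) (l : 'M[R]_(m, n)) :
  (forall i j, is_derive x v (fun y => f y i j) (l i j)) -> is_derive x v f l.
Proof.
move=> h; have df : derivable f x v by apply/derivable_mxP => i j; case: (h i j).
apply: DeriveDef => //; rewrite derive_mx//; apply/matrixP => i j.
by rewrite !mxE; have [_ ->] := h i j.
Qed.

Lemma der_coord (V : normedModType R) m n (f : V -> 'M[R]_(m, n)) (x v : V) (l : 'M[R]_(m, n)) i j :
  is_derive x v f l -> is_derive x v (fun y => f y i j) (l i j).
Proof.
move=> [df <-]; have := (derivable_mxP _ _ _).1 df i j => dij.
by apply: DeriveDef => //; rewrite derive_mx// mxE.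
Qed.

Lemma der_sum (V W : normedModType R) n (f : 'I_n -> V -> W) (x v : V)
    (l : 'I_n -> W) : (forall i, is_derive x v (f i) (l i)) ->
  is_derive x v (fun y => \sum_i f i y) (\sum_i l i).
Proof.
move=> h; have := @is_derive_sum R V W n f x v l h.
by congr is_derive; apply/funext => y; rewrite fct_sumE.
Qed.

Lemma der_scale (V : normedModType R) m n (f : V -> R) (w : V -> 'M[R]_(m, n))
    (x v : V) (l : R) (l' : 'M[R]_(m, n)) :
  is_derive x v f l -> is_derive x v w l' ->
  is_derive x v (fun y => f y *: w y) (l *: w x + f x *: l').
Proof.
move=> hf hw; apply: der_mx => i j.
have := derM hf (der_coord i j hw); rewrite !mxE.
by congr is_derive; apply/funext => y; rewrite mxE.
Qed.

Lemma der_mulmx (V : normedModType R) m n p (f : V -> 'M[R]_(m, n)) (A : 'M[R]_(n, p))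
    (x v : V) (l : 'M[R]_(m, n)) :
  is_derive x v f l -> is_derive x v (fun y => f y *m A) (l *m A).
Proof.
move=> hf; apply: der_mx => i j.
have -> : (fun y => (f y *m A) i j) = (fun y => \sum_k f y i k * A k j).
  by apply/funext => y; rewrite mxE.
rewrite mxE; apply: der_sum => k.
by apply: der_eq (derM (der_coord i k hf) (derC (A k j) x v)) _; rewrite mulr0 addr0.
Qed.

Lemma der_dot (V : normedModType R) (f g : V -> 'rV[R]_3) (x v : V) (l l' : 'rV[R]_3) :
  is_derive x v f l -> is_derive x v g l' ->
  is_derive x v (fun y => dot (f y) (g y)) (dot l (g x) + dot (f x) l').
Proof.
move=> hf hg; rewrite /dot -big_split /=; apply: der_sum => i.
exact: derM (der_coord _ _ hf) (der_coord _ _ hg).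
Qed.

Implicit Types u v w : 'rV[R]_3.

Lemma dotC u v : dot u v = dot v u.
Proof. by apply: eq_bigr => i _; rewrite mulrC. Qed.

Lemma dotDl u v w : dot (u + v) w = dot u w + dot v w.
Proof. by rewrite /dot -big_split; apply: eq_bigr => i _; rewrite mxE mulrDl. Qed.

Lemma dotZl a u v : dot (a *: u) v = a * dot u v.
Proof. by rewrite /dot mulr_sumr; apply: eq_bigr => i _; rewrite mxE mulrA. Qed.

Lemma dotDr u v w : dot u (v + w) = dot u v + dot u w.
Proof. by rewrite dotC dotDl !(dotC u). Qed.

Lemma dotZr a u v : dot u (a *: v) = a * dot u v.
Proof. by rewrite dotC dotZl dotC. Qed.

Lemma dotNl u v : dot (- u) v = - dot u v.
Proof. by rewrite -scaleN1r dotZl mulN1r. Qed.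

Lemma dotNr u v : dot u (- v) = - dot u v.
Proof. by rewrite dotC dotNl dotC. Qed.

Lemma dot0l u : dot 0 u = 0.
Proof. by rewrite -(scale0r u) dotZl mul0r. Qed.

Lemma dot0r u : dot u 0 = 0. Proof. by rewrite dotC dot0l. Qed.

Lemma dot_ge0 u : 0 <= dot u u.
Proof. by apply: sumr_ge0 => i _; rewrite -expr2 sqr_ge0. Qed.

Lemma dot_eq0 u : dot u u = 0 -> u = 0.
Proof.
move=> h; apply/rowP => i; rewrite mxE; apply/eqP; rewrite -sqrf_eq0 expr2.
have /psumr_eq0P := h; move=> -> // j _; by rewrite -expr2 sqr_ge0.
Qed.

Lemma enorm_ge0 u : 0 <= enorm u. Proof. exact: sqrtr_ge0. Qed.

Lemma enorm_sqr u : enorm u ^+ 2 = dot u u.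
Proof. by rewrite sqr_sqrtr// dot_ge0. Qed.

Lemma enorm_le u c : 0 <= c -> (enorm u <= c) = (dot u u <= c ^+ 2).
Proof. by move=> c0; rewrite -enorm_sqr ler_pXn2r// nnegrE// enorm_ge0. Qed.

Lemma enormZ a u : enorm (a *: u) = `|a| * enorm u.
Proof.
by rewrite /enorm dotZl dotZr mulrA -expr2 sqrtrM ?sqr_ge0// sqrtr_sqr.
Qed.

Lemma cauchy_schwarz u v : `|dot u v| <= enorm u * enorm v.
Proof.
rewrite -(ler_pXn2r (n := 2)) ?nnegrE ?mulr_ge0 ?enorm_ge0//.
rewrite exprMn !enorm_sqr real_normK ?num_real//.
have [v0|v0] := eqVneq (dot v v) 0.
  by rewrite (dot_eq0 v0) !dot0r mulr0 expr0n.
have vp : 0 < dot v v by rewrite lt_def v0 dot_ge0.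
have := dot_ge0 (dot v v *: u - dot u v *: v).
have -> : dot (dot v v *: u - dot u v *: v) (dot v v *: u - dot u v *: v) =
    dot v v * (dot u u * dot v v - dot u v ^+ 2).
  by rewrite !(dotDl, dotDr, dotNl, dotNr, dotZl, dotZr) (dotC v u); ring.
by rewrite pmulr_rge0// subr_ge0.
Qed.

Lemma enormD u v : enorm (u + v) <= enorm u + enorm v.
Proof.
rewrite enorm_le ?addr_ge0 ?enorm_ge0// sqrrD !enorm_sqr dotDl !dotDr (dotC v u).
have := le_trans (ler_norm _) (cauchy_schwarz u v); lra.
Qed.

Lemma enormB u v : enorm (v - u) = enorm (u - v).
Proof. by rewrite -opprB -scaleN1r enormZ normrN1 mul1r. Qed.

Lemma enorm_triangle u v w : enorm (u - w) <= enorm (u - v) + enorm (v - w).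
Proof. by have := enormD (u - v) (v - w); rewrite addrA subrK. Qed.

Lemma cont_dot (T : topologicalType) (f g : T -> 'rV[R]_3) (x : T) :
  {for x, continuous f} -> {for x, continuous g} ->
  {for x, continuous (fun y => dot (f y) (g y))}.
Proof.
move=> hf hg; rewrite /continuous_at /dot; apply: cvg_big => [|i _].
  exact: add_continuous.
apply: cvgM.
  exact: (@continuous_comp _ _ _ f (fun M => M ord0 i) _ hf (@coord_continuous _ _ _ _ _ _)).
exact: (@continuous_comp _ _ _ g (fun M => M ord0 i) _ hg (@coord_continuous _ _ _ _ _ _)).
Qed.

End VectorCalculus.

(** * Lifting curves through charts *)

Section InverseParametrization.
Variable R : realType.

Lemma mulmx_norm_le m n p (v : 'M[R]_(m.+1, n.+1)) (P : 'M[R]_(n.+1, p.+1)) :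
  `|v *m P| <= `|v| * (n.+1%:R * `|P|).
Proof.
have coord_le a b (A : 'M[R]_(a.+1, b.+1)) i j : `|A i j| <= `|A|.
  by rewrite [leRHS]/Num.Def.normr/= mx_normrE (le_bigmax _ _ (i, j)).
rewrite [leLHS]/Num.Def.normr/= mx_normrE; apply: bigmax_le => /=.
  by rewrite !mulr_ge0.
move=> [i j] _ /=; rewrite mxE; apply: (le_trans (ler_norm_sum _ _ _)).
have -> : `|v| * (n.+1%:R * `|P|) = \sum_(k < n.+1) `|v| * `|P|.
  by rewrite sumr_const card_ord -[RHS]mulr_natl; ring.
by apply: ler_sum => k _; rewrite normrM ler_pM.
Qed.

Lemma der_diff (f : 'rV[R]_2 -> 'rV[R]_3) (y : R -> 'rV[R]_2) (t : R) w :
  differentiable f (y t) -> is_derive t 1 y w ->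
  is_derive t 1 (fun s => f (y s)) ('D_w f (y t)).
Proof.
move=> df dy; have dyd : differentiable y t by apply/derivable1_diffP; case: dy.
have dfy : differentiable (f \o y) t by exact: differentiable_comp.
apply: DeriveDef; first by apply/derivable1_diffP.
rewrite [LHS]deriveE// diff_comp//= [RHS]deriveE//; congr ('d _ _ _).
by rewrite -deriveE//; case: dy.
Qed.

(** The inverse of a chart is given only as a continuous map. Differentiability of the lift comes
    from the injective differential: its left inverse [P] turns [x] into a differentiable plane
    curve that differs from [y] by a term negligible against the increment of [y]. *)
Lemma lift_curve (S : set 'rV[R]_3) U f u0 (x : R -> 'rV[R]_3) (t0 : R) v :
  parametrization S U f -> U u0 -> f u0 = x t0 ->
  (\forall t \near t0, S (x t)) -> is_derive t0 1 x v ->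
  exists y w, [/\ y t0 = u0, {for t0, continuous y},
    \forall t \near t0, U (y t) /\ f (y t) = x t,
    is_derive t0 1 y w & 'D_w f u0 = v].
Proof.
move=> [oU fsm finj fI fo] Uu0 fu0 Sx dx.
have cx := der_cont dx.
have lift (O : set 'rV[R]_2) : open O -> O `<=` U -> O u0 ->
    \forall t \near t0, exists2 u, O u & f u = x t.
  move=> oO OU Ou0; have [W oW fW] := fo O oO OU.
  have Wx0 : W (x t0).
    by have : (S `&` W) (x t0) by [rewrite -fW -fu0; exists u0]; case.
  near=> t; have : (S `&` W) (x t).
    by split; [near: t|near: t; apply: cx; exact: open_nbhs_nbhs].
  by rewrite -fW => -[u Ou fu]; exists u.
have ex t : exists u, (exists2 u, U u & f u = x t) -> U u /\ f u = x t.
  have [[u Uu fu]|h] := pselect (exists2 u, U u & f u = x t).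
    by exists u.
  by exists u0 => /h.
have [y yP] := choice ex.
have yE u t : U u -> f u = x t -> y t = u.
  move=> Uu fu; have [|Uy fy] := yP t; first by exists u.
  by apply: fI; rewrite ?inE// fy.
have y0 : y t0 = u0 by exact: yE.
have ynear : \forall t \near t0, U (y t) /\ f (y t) = x t.
  have := lift U oU (@subset_refl _ _) Uu0; apply: filterS => t h; exact: yP.
have cy : {for t0, continuous y}.
  apply/cvgrPdist_lt => e e0; rewrite y0.
  have oO : open (U `&` ball u0 e) by apply: openI => //; exact: ball_open.
  have := lift _ oO (@subIsetl _ _ _) (conj Uu0 (ballxx _ e0)).
  apply: filterS => t [u [Uu be] fu]; rewrite (yE u t Uu fu).
  by move: be; rewrite -ball_normE.
have df : differentiable f u0 by apply: (fsm [::] u0 Uu0).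
pose A := lin1_mx ('d f u0); pose P := pinvmx A.
(* Matrices act on row vectors from the right, so the left inverse of the differential is a right
   inverse of its matrix. *)
have AP : A *m P = 1%:M.
  apply: mulmxVp; apply: inj_row_free => w; rewrite mul_rV_lin1 => h.
  by apply: (finj u0 w Uu0); rewrite deriveE.
pose K := 3%:R * `|P| + 1.
have K0 : 0 < K by rewrite ltr_wpDl// mulr_ge0.
pose p t := x t *m P.
have dp : is_derive t0 1 p (v *m P) := der_mulmx P dx.
have est e : 0 < e -> \forall t \near t0,
    `|p t - p t0 - (y t - u0)| <= e * `|y t - u0|.
  move=> e0; have /diff_locallyP [_ /eqaddoP fo'] := df.
  have eK : 0 < e / K by rewrite divr_gt0.
  have := fo' _ eK; rewrite near_simpl => hn.
  have cyu : y t - u0 @[t --> t0] --> (0 : 'rV[R]_2).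
    rewrite -(subrr u0) -{2}y0; apply: cvgB; [exact: cy|exact: cvg_cst].
  have hn' : \forall t \near t0,
      `|f (y t) - f u0 - 'd f u0 (y t - u0)| <= e / K * `|y t - u0|.
    near=> t.
    have : `|(f \o shift u0 - (cst (f u0) + 'd f u0)) (y t - u0)| <=
        e / K * `|y t - u0| by near: t; exact: (cyu _ hn).
    by rewrite !fctE /= subrK opprD addrA.
  near=> t.
  have [_ fy] : U (y t) /\ f (y t) = x t by near: t.
  have : `|f (y t) - f u0 - 'd f u0 (y t - u0)| <= e / K * `|y t - u0|.
    by near: t.
  rewrite fy fu0 => h.
  have -> : p t - p t0 - (y t - u0) = (x t - x t0 - 'd f u0 (y t - u0)) *m P.
    have -> : 'd f u0 (y t - u0) = (y t - u0) *m A by rewrite mul_rV_lin1.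
    by rewrite 2!mulmxBl -(mulmxA _ A) AP mulmx1.
  apply: (le_trans (mulmx_norm_le _ _)).
  have : `|x t - x t0 - 'd f u0 (y t - u0)| * K <= e * `|y t - u0|.
    by rewrite -ler_pdivlMr// mulrAC.
  by apply: le_trans; rewrite ler_wpM2l// lerDl.
have dy : is_derive t0 1 y (v *m P).
  apply: cvg_der; rewrite y0; apply/cvgrPdist_le => e e0.
  set q := v *m P.
  have q0 : 0 < `|q| + 1 by rewrite ltr_wpDl.
  (* The bound [1 / 2] allows the error to be absorbed, so that the quotient of [y] is at most
     [2 * (|q| + 1)]; the other bound then makes the error at most [e / 2]. *)
  pose e1 := Num.min (1 / 2) (e / (4 * (`|q| + 1))).
  have e10 : 0 < e1 by rewrite lt_min !divr_gt0 ?mulr_gt0.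
  have e1h : e1 <= 1 / 2 by rewrite ge_min lexx.
  have e1q : e1 * (4 * (`|q| + 1)) <= e.
    by rewrite -ler_pdivlMr ?mulr_gt0// ge_min lexx orbT.
  have ct : h + t0 @[h --> (0 : R)] --> t0.
    by rewrite -[X in _ --> X]add0r; apply: cvgD; [exact: cvg_id|exact: cvg_cst].
  have en : \forall h \near 0^',
      `|p (h + t0) - p t0 - (y (h + t0) - u0)| <= e1 * `|y (h + t0) - u0|.
    rewrite near_withinE; near=> h => _; near: h; exact: (ct _ (est _ e10)).
  have e2 : 0 < Num.min 1 (e / 2) by rewrite lt_min ltr01 divr_gt0.
  have := (cvgrPdist_le _ _).1 (der_cvg dp) _ e2.
  move=> pn; near=> h.
  have : `|q - h^-1 *: (p (h + t0) - p t0)| <= Num.min 1 (e / 2).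
    by near: h; exact: pn.
  rewrite le_min => /andP[h1 h2].
  have h3 : `|p (h + t0) - p t0 - (y (h + t0) - u0)| <= e1 * `|y (h + t0) - u0|.
    by near: h; exact: en.
  set dpv := p (h + t0) - p t0 in h1 h2 h3 *.
  set dyv := y (h + t0) - u0 in h3 *.
  have h4 : `|h^-1 *: dpv - h^-1 *: dyv| <= e1 * `|h^-1 *: dyv|.
    by rewrite -scalerBr !normrZ mulrCA ler_wpM2l.
  have h5 : `|h^-1 *: dyv| <= `|h^-1 *: dpv| + `|h^-1 *: dpv - h^-1 *: dyv|.
    rewrite -{1}[h^-1 *: dyv](subKr (h^-1 *: dpv)).
    exact: ler_normB.
  have h6 : `|h^-1 *: dpv| <= `|q| + 1.
    rewrite -{1}[h^-1 *: dpv](subKr q); apply: (le_trans (ler_normB _ _)).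
    by rewrite lerD2l.
  have h7 : e1 * `|h^-1 *: dyv| <= 1 / 2 * `|h^-1 *: dyv| by rewrite ler_wpM2r.
  have h8 : `|h^-1 *: dyv| <= 2 * (`|q| + 1) by lra.
  have h9 : e1 * `|h^-1 *: dyv| <= e / 2.
    apply: (@le_trans _ _ (e1 * (2 * (`|q| + 1)))); first by rewrite ler_pM2l.
    lra.
  rewrite -(subrKA (h^-1 *: dpv)); apply: (le_trans (ler_normD _ _)); lra.
have dyd : is_derive t0 1 (fun t => f (y t)) ('D_(v *m P) f u0).
  by rewrite -y0; apply: der_diff => //; rewrite y0.
exists y, (v *m P); split=> //.
apply: der_uniq dyd _; apply: der_near dx.
by apply: filterS ynear => t [].
Unshelve. all: by end_near. Qed.

Lemma tangent_curve (S : set 'rV[R]_3) U f u0 (x : R -> 'rV[R]_3) (t0 : R) v :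
  parametrization S U f -> U u0 -> f u0 = x t0 ->
  (\forall t \near t0, S (x t)) -> is_derive t0 1 x v ->
  exists w, 'D_w f u0 = v.
Proof.
move=> pf Uu fu Sx dx.
by have [y [w [_ _ _ _ h]]] := lift_curve pf Uu fu Sx dx; exists w.
Qed.

Lemma curve_tangent (S : set 'rV[R]_3) (x : R -> 'rV[R]_3) (t0 : R) v :
  surface S -> (\forall t \near t0, S (x t)) -> is_derive t0 1 x v ->
  tangent S (x t0) v.
Proof.
move=> sS Sx dx; have [U [f [u [pf Uu fu]]]] := sS _ (nbhs_singleton Sx).
have [w h] := tangent_curve pf Uu fu Sx dx.
by exists U, f, u, w; split.
Qed.

(** Chart independence of the tangent plane: a straight line in the other chart gives a curve on the
    surface, and this curve lifts to the given chart. *)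
Lemma tangent_in_chart (S : set 'rV[R]_3) U f u v :
  parametrization S U f -> U u -> tangent S (f u) v -> exists w, 'D_w f u = v.
Proof.
move=> pf Uu [U' [f' [u' [w' [pf' Uu' fu ->]]]]].
have [oU' fsm' _ _ fo'] := pf'.
pose x (t : R) := f' (t *: w' + u').
have x0 : f u = x 0 by rewrite /x scale0r add0r.
have dl : is_derive (0 : R) (1 : R) (fun t : R => t *: w' + u') w'.
  have d1 := der_scale (derI (0 : R)) (derC w' (0 : R) 1).
  apply: der_eq (derD d1 (derC u' (0 : R) 1)) _.
  by rewrite scaler0 !addr0 scale1r.
have E : 0 *: w' + u' = u' by rewrite scale0r add0r.
have dx : is_derive (0 : R) 1 x ('D_w' f' u').
  rewrite -[in X in is_derive _ _ _ X]E; apply: (der_diff (y := fun t => t *: w' + u')) => //.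
  by rewrite E; exact: (fsm' [::] u' Uu').
have Sx : \forall t \near (0 : R), S (x t).
  have [W oW fW] := fo' U' oU' (@subset_refl _ _).
  have : \forall t \near (0 : R), U' (t *: w' + u').
    apply: (der_cont dl); rewrite E; exact: open_nbhs_nbhs.
  apply: filterS => t Ut; have : (f' @` U') (x t) by exists (t *: w' + u').
  by rewrite fW => -[].
exact: tangent_curve pf Uu x0 Sx dx.
Qed.

End InverseParametrization.

(** * Collars and rims in Euclidean terms *)

Section Collars.
Variable R : realType.
Implicit Types (S A : set 'rV[R]_3) (p q : 'rV[R]_3) (g : R -> 'rV[R]_3).

Lemma cont_enorm (T : topologicalType) (f : T -> 'rV[R]_3) (x : T) :
  {for x, continuous f} -> {for x, continuous (fun y => enorm (f y))}.
Proof.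
move=> hf; have hd := cont_dot hf hf.
exact: (@continuous_comp _ _ _ _ (@Num.sqrt R) _ hd (@sqrt_continuous R _)).
Qed.

(** The component of the velocity along the unit vector [e] of the chord integrates to the length of
    the chord. *)
Lemma path_length_chord S p q g : C1_path S p q g ->
  ((enorm (q - p))%:E <= path_length g)%E.
Proof.
move=> [dg cg _ g0 g1]; set w := q - p.
have [w0|w0] := eqVneq w 0.
  rewrite w0 /enorm dot0l sqrtr0; apply: integral_ge0 => t _.
  by rewrite lee_fin enorm_ge0.
have wp : 0 < enorm w.
  rewrite lt_def enorm_ge0 andbT; apply: contra_neq w0 => h.
  by apply: dot_eq0; rewrite -enorm_sqr h expr0n.
pose e := (enorm w)^-1 *: w.
have e1 : enorm e = 1 by rewrite enormZ gtr0_norm ?invr_gt0// mulVf// gt_eqF.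
have we : dot w e = enorm w by rewrite dotZr -enorm_sqr; field; rewrite gt_eqF.
have dge (t : R) : is_derive t (1 : R) g (derive1 g t).
  by rewrite derive1E; exact: derivableP.
pose F t := dot (g t) e; pose f t := dot (derive1 g t) e.
have dF (t : R) : is_derive t (1 : R) F (f t).
  by apply: der_eq (der_dot (dge t) (derC e t 1)) _; rewrite dot0r addr0.
have cf : continuous f.
  by move=> t; apply: cont_dot; [exact: cg|exact: cst_continuous].
have ce : continuous (fun t => enorm (derive1 g t)) by move=> t; apply: cont_enorm; exact: cg.
have int (h : R -> R) : continuous h ->
    (@lebesgue_measure R).-integrable `[0, 1] (EFin \o h).
  move=> ch; apply: continuous_compact_integrable; first exact: segment_compact.
  exact: continuous_subspaceT.
have FTC : (\int[@lebesgue_measure R]_(t in `[0%R, 1%R]) (f t)%:E =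
    (F 1)%:E - (F 0)%:E)%E.
  apply: continuous_FTC2 => //.
  - exact: continuous_subspaceT.
  - split.
    + by move=> t _; case: (dF t).
    + by apply: cvg_at_right_filter; exact: (der_cont (dF 0)).
    + by apply: cvg_at_left_filter; exact: (der_cont (dF 1)).
  - by move=> t _; rewrite derive1E; case: (dF t).
have FE : F 1 - F 0 = enorm w by rewrite /F g0 g1 -dotNl -dotDl -/w.
rewrite -FE EFinB -FTC; apply: le_integral => //.
- exact: (int _ cf).
- exact: (int _ ce).
move=> t _; rewrite lee_fin; apply: (le_trans (ler_norm _)).
by apply: (le_trans (cauchy_schwarz _ _)); rewrite e1 mulr1.
Qed.

Lemma collar_near S A (d : R) q : collar S A d q ->
  exists2 p, A p & enorm (q - p) < d.
Proof.
move=> [_ /ereal_inf_lt [_ [p Ap <-]] /ereal_inf_lt [_ [g gp <-]] h].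
exists p => //; rewrite -lte_fin; apply: le_lt_trans h.
exact: path_length_chord gp.
Qed.

Lemma collar_unit_speed S A (d s : R) (g dg ddg : R -> 'rV[R]_3) :
  (forall t : R, is_derive t 1 g (dg t)) -> (forall t : R, is_derive t 1 dg (ddg t)) ->
  (forall t, S (g t)) -> (forall t, enorm (dg t) = 1) -> A (g 0) -> `|s| < d ->
  collar S A d (g s).
Proof.
move=> hg hdg Sg g1 Ag sd; split=> //.
pose h t := g (s * t).
have hm (t : R) : is_derive t (1 : R) (fun t => s * t) s.
  by apply: der_eq (derM (derC s t 1) (derI t)) _; rewrite mul0r add0r mulr1.
have dh (t : R) : is_derive t (1 : R) h (s *: dg (s * t)).
  apply: der_mx => i j; rewrite mxE mulrC.
  exact: (der_comp (f := fun t => g t i j) (der_coord i j (hg _)) (hm t)).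
have h1E : derive1 h = (fun t => s *: dg (s * t)).
  by apply/funext => t; rewrite derive1E; case: (dh t).
have C1 : C1_path S (g 0) (g s) h.
  split.
  - by move=> t; case: (dh t).
  - rewrite h1E => t.
    have dd : is_derive t (1 : R) (fun t => dg (s * t)) (s *: ddg (s * t)).
      apply: der_mx => i j; rewrite mxE mulrC.
      exact: (der_comp (f := fun t => dg t i j) (der_coord i j (hdg _)) (hm t)).
    exact: (der_cont (der_scale (derC s t 1) dd)).
  - by move=> t _; exact: Sg.
  - by rewrite /h mulr0.
  - by rewrite /h mulr1.
have L : path_length h = `|s|%:E.
  rewrite /path_length h1E.
  under eq_integral do rewrite enormZ g1 mulr1.
  rewrite integral_cst//= lebesgue_measure_itv /= lte_fin ltr01 oppr0 adde0.
  by rewrite mule1.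
apply: (@le_lt_trans _ _ (`|s|%:E)); last by rewrite lte_fin.
rewrite -L; apply: (@le_trans _ _ (surface_dist S (g 0) (g s))).
  by apply: ereal_inf_lbound; exists (g 0).
by apply: ereal_inf_lbound; exists h.
Qed.

Lemma dot_unit_bound (u v : 'rV[R]_3) : enorm u = 1 -> enorm v = 1 ->
  -1 <= dot u v <= 1.
Proof.
by move=> u1 v1; rewrite -ler_norml (le_trans (cauchy_schwarz u v))// u1 v1 mulr1.
Qed.

Lemma acos_lt (x r : R) : -1 <= x <= 1 -> 0 <= r <= pi ->
  (acos x < r) = (cos r < x).
Proof.
move=> hx hr; have [/andP[a0 ap] ax] := acos_def hx.
by rewrite -[in RHS]ax ltr_cos ?in_itv /= ?a0.
Qed.

Lemma sphere_disk_rim (c e : 'rV[R]_3) (r : R) : 0 < r < pi / 2 ->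
  enorm c = 1 -> enorm e = 1 -> dot c e = 0 ->
  disk_boundary c r (cos r *: c + sin r *: e).
Proof.
move=> hr c1 e1 ce; have pi0 := pi_gt0 R.
have cc : dot c c = 1 by rewrite -enorm_sqr c1 expr1n.
have ee : dot e e = 1 by rewrite -enorm_sqr e1 expr1n.
pose q (t : R) := cos t *: c + sin t *: e.
have q1 t : enorm (q t) = 1.
  rewrite /enorm; have -> : dot (q t) (q t) = cos t ^+ 2 + sin t ^+ 2.
    by rewrite /q !(dotDl, dotDr, dotZl, dotZr) (dotC e c) cc ee ce; ring.
  by rewrite cos2Dsin2 sqrtr1.
have cq t : dot c (q t) = cos t by rewrite !(dotDr, dotZr) cc ce; ring.
have dq (t : R) : is_derive t (1 : R) q (- sin t *: c + cos t *: e).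
  have d1 := der_scale (is_derive_cos t) (derC c t 1).
  have d2 := der_scale (is_derive_sin t) (derC e t 1).
  by apply: der_eq (derD d1 d2) _; rewrite !scaler0 !addr0.
rewrite -/(q r); split; last first.
  by case; rewrite cq cosK ?ltxx// in_itv /=; lra.
move=> B /= Bq; have := der_cont (dq r) Bq => /nbhs_ballP [d /= d0 hd].
pose t := Num.max (r - d / 2) (r / 2).
have [t0 tr td] : [/\ 0 < t, t < r & r - d < t].
  by rewrite /t; split; rewrite ?lt_max ?gt_max; lra.
exists (q t); split.
  split; first exact: q1.
  by rewrite cq cosK// in_itv /=; lra.
by apply: hd; rewrite /= /ball /= gtr0_norm; lra.
Qed.

Lemma disk_boundaryP (c q : 'rV[R]_3) (r : R) : 0 < r < pi / 2 -> enorm c = 1 ->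
  disk_boundary c r q -> enorm q = 1 /\ dot c q = cos r.
Proof.
move=> hr c1 [clq nq]; have pi0 := pi_gt0 R.
have hr' : 0 <= r <= pi by lra.
have near_disk (e : R) : 0 < e -> exists p, [/\ enorm p = 1, cos r < dot c p,
    `|enorm q - enorm p| < e & `|dot q c - dot p c| < e].
  move=> e0.
  have c1q : {for q, continuous (fun p : 'rV[R]_3 => enorm p)}.
    by apply: cont_enorm; exact: cvg_id.
  have c2q : {for q, continuous (fun p : 'rV[R]_3 => dot p c)}.
    by apply: cont_dot; [exact: cvg_id|exact: cst_continuous].
  have := clq _ (filterI ((cvgrPdist_lt _ _).1 c1q _ e0) ((cvgrPdist_lt _ _).1 c2q _ e0)).
  move=> [p [[p1 ap] [h1 h2]]]; exists p; split=> //.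
  by rewrite -acos_lt//; exact: dot_unit_bound.
have q1 : enorm q = 1.
  apply/eqP; rewrite -subr_eq0 -normr_le0; apply/ler_addgt0Pr => e e0.
  by have [p [-> _ h _]] := near_disk e e0; rewrite add0r ltW.
split=> //; apply/eqP; rewrite eq_le; apply/andP; split.
  rewrite leNgt; apply/negP => h; apply: nq; split=> //.
  by rewrite acos_lt//; exact: dot_unit_bound.
apply/ler_addgt0Pr => e e0.
have [p [_ h1 _ h]] := near_disk e e0.
by move: h; rewrite ltr_norml (dotC q) (dotC p) => /andP[h2 h3]; lra.
Qed.

End Collars.

(** * Orthonormal frames and rotations about an axis *)

Record frame (R : realType) (e1 e2 e3 : 'rV[R]_3) : Prop := Frame {
  fr11 : dot e1 e1 = 1; fr22 : dot e2 e2 = 1; fr33 : dot e3 e3 = 1;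
  fr12 : dot e1 e2 = 0; fr13 : dot e1 e3 = 0; fr23 : dot e2 e3 = 0 }.

Section Frames.
Variable R : realType.
Implicit Types u v w : 'rV[R]_3.

Lemma dot3E u v : dot u v =
  u ord0 (inord 0) * v ord0 (inord 0) + u ord0 (inord 1) * v ord0 (inord 1) +
  u ord0 (inord 2) * v ord0 (inord 2).
Proof.
rewrite /dot !big_ord_recr big_ord0 /= add0r.
by do ![congr (_ + _)|congr (_ * _)|congr (_ _ _)]; apply/val_inj; rewrite /= inordK.
Qed.

(** [e1] is taken with third coordinate 0, with a separate choice when [e3] is vertical, and [e2] is
    the cross product of [e3] and [e1]. *)
Lemma frame_exists (e3 : 'rV[R]_3) : dot e3 e3 = 1 ->
  exists e1 e2 : 'rV[R]_3, frame e1 e2 e3.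
Proof.
pose row3 (x y z : R) : 'rV[R]_3 := \row_i [:: x; y; z]`_i.
have r3 x y z : [/\ row3 x y z ord0 (inord 0) = x, row3 x y z ord0 (inord 1) = y &
    row3 x y z ord0 (inord 2) = z] by rewrite !mxE !inordK.
set x := e3 ord0 (inord 0); set y := e3 ord0 (inord 1); set z := e3 ord0 (inord 2).
move=> h; have {}h : x * x + y * y + z * z = 1 by rewrite -h dot3E.
have [e1 h11 h13] : exists2 e1 : 'rV[R]_3, dot e1 e1 = 1 & dot e1 e3 = 0.
  have [h0|h0] := eqVneq (x ^+ 2 + y ^+ 2) 0.
    exists (row3 1 0 0); rewrite dot3E; case: (r3 1 0 0) => -> -> ->; first by ring.
    by have : x = 0 by [nra]; rewrite -/x => ->; ring.
  have hp : 0 < x ^+ 2 + y ^+ 2 by rewrite lt_def h0 addr_ge0 ?sqr_ge0.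
  pose n := Num.sqrt (x ^+ 2 + y ^+ 2).
  have n2 : n ^+ 2 = x ^+ 2 + y ^+ 2 by rewrite sqr_sqrtr// ltW.
  have n0 : n != 0 by rewrite gt_eqF// sqrtr_gt0.
  exists (row3 (- y / n) (x / n) 0); rewrite dot3E.
    case: (r3 (- y / n) (x / n) 0) => -> -> ->.
    have -> : - y / n * (- y / n) + x / n * (x / n) + 0 * 0 = (x ^+ 2 + y ^+ 2) / n ^+ 2.
      by field.
    by rewrite n2 divff.
  by case: (r3 (- y / n) (x / n) 0) => -> -> ->; rewrite -/x -/y; ring.
pose a := e1 ord0 (inord 0); pose b := e1 ord0 (inord 1); pose c := e1 ord0 (inord 2).
move: h11 h13; rewrite !dot3E -/a -/b -/c -/x -/y -/z => h11 h13.
pose e2 := row3 (y * c - z * b) (z * a - x * c) (x * b - y * a).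
have [e20 e21 e22] : [/\ e2 ord0 (inord 0) = y * c - z * b,
   e2 ord0 (inord 1) = z * a - x * c & e2 ord0 (inord 2) = x * b - y * a] := r3 _ _ _.
exists e1, e2; split; rewrite dot3E ?e20 ?e21 ?e22 -/a -/b -/c -/x -/y -/z //.
- have -> : (y * c - z * b) * (y * c - z * b) + (z * a - x * c) * (z * a - x * c) +
      (x * b - y * a) * (x * b - y * a) =
      (x * x + y * y + z * z) * (a * a + b * b + c * c) - (a * x + b * y + c * z) ^+ 2.
    by ring.
  by rewrite h h11 h13 expr0n /= mulr1 subr0.
- by ring.
- by ring.
Qed.

Section OneFrame.
Variables e1 e2 e3 : 'rV[R]_3.
Hypothesis fr : frame e1 e2 e3.

Let P : 'M[R]_3 := \matrix_(i, j) [:: e1; e2; e3]`_i ord0 j.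

Let coords (x y z : R) : 'rV[R]_3 := \row_i [:: x; y; z]`_i.

Let coordsP x y z : coords x y z *m P = x *: e1 + y *: e2 + z *: e3.
Proof.
apply/rowP => i; rewrite !mxE !big_ord_recr big_ord0 /= !mxE /= add0r.
by rewrite ord1.
Qed.

Let PPt : P *m P^T = 1%:M.
Proof.
apply/matrixP => i j; rewrite !mxE.
have -> : \sum_k P i k * P^T k j = dot [:: e1; e2; e3]`_i [:: e1; e2; e3]`_j.
  by apply: eq_bigr => k _; rewrite !mxE.
case: fr => h11 h22 h33 h12 h13 h23.
case: i => [[|[|[|//]]] hi]; case: j => [[|[|[|//]]] hj] //=;
  by rewrite ?h11 ?h22 ?h33 ?h12 ?h13 ?h23 // dotC ?h12 ?h13 ?h23.
Qed.

Let PtP : P^T *m P = 1%:M. Proof. exact: mulmx1C. Qed.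

Lemma frame_expand v : v = dot v e1 *: e1 + dot v e2 *: e2 + dot v e3 *: e3.
Proof.
rewrite -coordsP -[LHS]mulmx1 -PtP mulmxA; congr (_ *m P).
apply/rowP => i; rewrite !mxE.
have -> : \sum_j v 0 j * P^T j i = dot v [:: e1; e2; e3]`_i.
  by apply: eq_bigr => k _; rewrite !mxE.
by case: i => [[|[|[|//]]] hi].
Qed.

Let Q (t : R) : 'M[R]_3 := \matrix_(i, j)
  (nth [::] [:: [:: cos t; sin t; 0]; [:: - sin t; cos t; 0]; [:: 0; 0; 1]] i)`_j.

Let rot t := P^T *m Q t *m P.

Let vec_rot t x y z : (x *: e1 + y *: e2 + z *: e3) *m rot t =
  (x * cos t - y * sin t) *: e1 + (x * sin t + y * cos t) *: e2 + z *: e3.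
Proof.
rewrite -!coordsP /rot !mulmxA -[_ *m P *m P^T]mulmxA PPt mulmx1; congr (_ *m P).
apply/rowP => i; rewrite !mxE !big_ord_recr big_ord0 /= !mxE /=.
by case: i => [[|[|[|//]]] hi] /=; rewrite ?(mulr0, mulr1, addr0, add0r, mulrN).
Qed.

Let QQ t : Q t *m (Q t)^T = 1%:M.
Proof.
apply/matrixP => i j; rewrite !mxE !big_ord_recr big_ord0 /= !mxE /=.
have h := cos2Dsin2 t; rewrite !expr2 in h.
case: i => [[|[|[|//]]] hi]; case: j => [[|[|[|//]]] hj] //=;
  rewrite ?(mulr0, mulr1, mul0r, addr0, add0r, mulrN, mulNr, opprK) //;
  by rewrite ?(mulrC (sin t) (cos t)) ?addNr // addrC.
Qed.

(** Halving the angle exhibits the determinant as a square, which orthogonality makes equal to 1,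
    without expanding it. *)
Let QD t : Q t = Q (t / 2) *m Q (t / 2).
Proof.
have -> : t = t / 2 + t / 2 by lra.
have -> : (t / 2 + t / 2) / 2 = t / 2 by lra.
apply/matrixP => i j; rewrite !mxE !big_ord_recr big_ord0 /= !mxE /=.
case: i => [[|[|[|//]]] hi]; case: j => [[|[|[|//]]] hj] //=;
  rewrite ?(mulr0, mulr1, mul0r, addr0, add0r, mulrN, mulNr, cosD, sinD) //;
  [exact: addrC | exact: opprD | exact: addrC].
Qed.

Let rot_about t : rotation_about e3 (rot t).
Proof.
split.
- rewrite /rot !trmx_mul trmxK !mulmxA -[_ *m P *m P^T]mulmxA PPt mulmx1.
  by rewrite -[P^T *m _ *m _]mulmxA QQ mulmx1 PtP.
- rewrite !det_mulmx mulrAC -det_mulmx PtP det1 mul1r QD det_mulmx.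
  by rewrite -[in X in _ * X]det_tr -det_mulmx QQ det1.
- have := vec_rot t 0 0 1; rewrite !scale0r !add0r scale1r => ->.
  by rewrite !mul0r subr0 addr0 !scale0r !add0r.
Qed.

Lemma rotation_orbit V (t : R) v : rotation_invariant e3 V -> V v ->
  V ((dot v e1 * cos t - dot v e2 * sin t) *: e1 +
     (dot v e1 * sin t + dot v e2 * cos t) *: e2 + dot v e3 *: e3).
Proof.
move=> inv Vv; rewrite -(inv _ (rot_about t)); exists v => //.
by rewrite {1}[v]frame_expand vec_rot.
Qed.

End OneFrame.
End Frames.

(** * Meridian geodesics *)

Section Meridian.
Variable R : realType.
Variables (Sigma A : set 'rV[R]_3) (e1 e2 e3 : 'rV[R]_3) (delta sr cr : R).
Variable gam : R -> 'rV[R]_3.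
Hypothesis fr : frame e1 e2 e3.
Hypothesis surf : surface Sigma.
Hypothesis rotA : rotation_invariant e3 (collar Sigma A delta).
Hypothesis delta0 : 0 < delta.
Hypothesis sr0 : 0 < sr.
Hypothesis srcr : sr ^+ 2 + cr ^+ 2 = 1.
Let p0 := sr *: e1 + cr *: e3.
Hypothesis Ap0 : A p0.
Hypothesis gam_geo : geodesic Sigma setT gam.
Hypothesis gam0 : gam 0 = p0.
Hypothesis dgam0 : derive1 gam 0 = p0.

Let gam1 := derive1 gam.
Let gam2 := derive1 gam1.

Lemma meridian_der (t : R) : is_derive t (1 : R) gam (gam1 t).
Proof.
have [_ [h _] _ _] := gam_geo (I : setT t).
by rewrite /gam1 derive1E; exact: derivableP.
Qed.

Lemma meridian_der1 (t : R) : is_derive t (1 : R) gam1 (gam2 t).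
Proof.
have [_ [_ h] _ _] := gam_geo (I : setT t).
by rewrite /gam2 derive1E; exact: derivableP.
Qed.

Lemma meridian_in t : Sigma (gam t).
Proof. by have [h _ _ _] := gam_geo (I : setT t). Qed.

Let acc v t : tangent Sigma (gam t) v -> dot (gam2 t) v = 0.
Proof. by have [_ _ _ h] := gam_geo (I : setT t); exact: h. Qed.

Let gam_tan t : tangent Sigma (gam t) (gam1 t).
Proof.
apply: curve_tangent => //; last exact: meridian_der.
by near=> s; exact: meridian_in.
Unshelve. all: by end_near. Qed.

Let dots := (dotDl, dotDr, dotZl, dotZr, dotNl, dotNr,
  fr11 fr, fr22 fr, fr33 fr, fr12 fr, fr13 fr, fr23 fr,
  dotC e2 e1, dotC e3 e1, dotC e3 e2).

Lemma meridian_unit_speed t : enorm (gam1 t) = 1.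
Proof.
have d (s : R) : is_derive s (1 : R) (fun s => dot (gam1 s) (gam1 s)) 0.
  apply: der_eq (der_dot (meridian_der1 s) (meridian_der1 s)) _.
  by rewrite (dotC (gam1 s)) (acc (gam_tan s)) addr0.
rewrite /enorm (is_derive_0_is_cst _ 0 d) /gam1 dgam0.
have -> : dot p0 p0 = sr ^+ 2 + cr ^+ 2 by rewrite /p0 !dots; ring.
by rewrite srcr sqrtr1.
Qed.

Lemma meridian_collar s : `|s| < delta -> collar Sigma A delta (gam s).
Proof.
apply: (collar_unit_speed meridian_der meridian_der1 meridian_in meridian_unit_speed).
by rewrite gam0.
Qed.

Let x s := dot (gam s) e1.
Let y s := dot (gam s) e2.

Let dcoord e (s : R) : is_derive s (1 : R) (fun s => dot (gam s) e) (dot (gam1 s) e).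
Proof. by apply: der_eq (der_dot (meridian_der s) (derC e s 1)) _; rewrite dot0r addr0. Qed.

Let dcoord1 e (s : R) : is_derive s (1 : R) (fun s => dot (gam1 s) e) (dot (gam2 s) e).
Proof. by apply: der_eq (der_dot (meridian_der1 s) (derC e s 1)) _; rewrite dot0r addr0. Qed.

(** This vector is the value of the Killing field, the velocity of the rotation orbit of [gam s],
    which stays in the collar and hence on the surface. *)
Let killing_tangent s : `|s| < delta -> tangent Sigma (gam s) (x s *: e2 - y s *: e1).
Proof.
move=> hs; pose c (t : R) := (x s * cos t - y s * sin t) *: e1 +
  (x s * sin t + y s * cos t) *: e2 + dot (gam s) e3 *: e3.
have c0 : c 0 = gam s.
  by rewrite /c cos0 sin0 !mulr0 !mulr1 subr0 add0r -(frame_expand fr).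
have dc : is_derive (0 : R) (1 : R) c (x s *: e2 - y s *: e1).
  have dx := derC (x s) (0 : R) 1; have dy := derC (y s) (0 : R) 1.
  have dcos := is_derive_cos (0 : R); have dsin := is_derive_sin (0 : R).
  have d1 := der_scale (derB (derM dx dcos) (derM dy dsin)) (derC e1 (0 : R) 1).
  have d2 := der_scale (derD (derM dx dsin) (derM dy dcos)) (derC e2 (0 : R) 1).
  apply: der_eq (derD (derD d1 d2) (derC _ (0 : R) 1)) _.
  rewrite sin0 cos0 !scaler0 !addr0 oppr0 !(mulr0, mulr1, mul0r, add0r, addr0).
  by rewrite scaleNr addrC.
rewrite -c0; apply: curve_tangent dc => //.
near=> t; have := meridian_collar hs.
by move=> /(rotation_orbit fr t rotA) [].
Unshelve. all: by end_near. Qed.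

Let sigma0 := Num.min delta sr.

Let sigma_gt0 : 0 < sigma0. Proof. by rewrite lt_min delta0. Qed.

Lemma meridian_off_axis s : 0 < sr - `|s| -> 0 < dot (gam s) e1.
Proof.
rewrite -/(x s) => hs; have x1 t : `|dot (gam1 t) e1| <= 1.
  apply: (le_trans (cauchy_schwarz _ _)); rewrite meridian_unit_speed mul1r.
  by rewrite /enorm (fr11 fr) sqrtr1.
have x0 : x 0 = sr by rewrite /x gam0 /p0 !dots; ring.
suff : `|x s - x 0| <= `|s| by rewrite x0 ler_norml => /andP[]; lra.
have [s0|s0|->] := ltgtP s 0; last by rewrite subrr normr0.
  have [u _ e] := mvt s0 (fun t _ => dcoord e1 t).
  rewrite distrC e normrM sub0r normrN ler_piMl//.
have [u _ e] := mvt s0 (fun t _ => dcoord e1 t).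
by rewrite e normrM subr0 ler_piMl.
Qed.

(** Clairaut's integral [l], the product of the velocity with the Killing field, is constant because
    the acceleration is normal to the surface, and it vanishes at 0. So [y / x], of derivative
    [l / x ^+ 2], keeps its initial value 0. *)
Lemma meridian_planar s : `|s| < sigma0 -> dot (gam s) e2 = 0.
Proof.
move=> hs; pose l s := x s * dot (gam1 s) e2 - dot (gam1 s) e1 * y s.
have sd t : - sigma0 < t < sigma0 -> `|t| < delta /\ 0 < sr - `|t|.
  by rewrite -ltr_norml lt_min subr_gt0 => /andP[].
have dl t : - sigma0 < t < sigma0 -> is_derive t 1 l 0.
  move=> /sd [td _]; have d1 := derM (dcoord e1 t) (dcoord1 e2 t).
  have d2 := derM (dcoord1 e1 t) (dcoord e2 t).
  apply: der_eq (derB d1 d2) _.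
  have := acc (killing_tangent td); rewrite /x /y !dots; lra.
have l0 t : - sigma0 < t < sigma0 -> l t = 0.
  move=> ht; have s0 := sigma_gt0; rewrite (der0_const dl ht (_ : _ < 0 < _)); last lra.
  by rewrite /l /x /y gam0 /gam1 dgam0 /p0 !dots; ring.
have dq t : - sigma0 < t < sigma0 -> is_derive t 1 (fun t => y t / x t) 0.
  move=> ht; have [_ /meridian_off_axis xt] := sd _ ht.
  have xn : x t != 0 by rewrite gt_eqF.
  apply: der_eq (der_div (f := y) (g := x) xn (dcoord e2 t) (dcoord e1 t)) _.
  by have := l0 t ht; rewrite /l => h; apply/eqP; rewrite mulf_eq0; apply/orP; left; apply/eqP; lra.
have hs' : - sigma0 < s < sigma0 by rewrite -ltr_norml.
have [_ /meridian_off_axis xs] := sd _ hs'; have s0 := sigma_gt0.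
have y0 : y 0 = 0 by rewrite /y gam0 /p0 !dots !mulr0 addr0.
have := der0_const dq hs' (_ : _ < 0 < _); rewrite y0 mul0r.
move=> /(_ ltac:(lra)) /eqP.
by rewrite mulf_eq0 invr_eq0 (gt_eqF xs) orbF => /eqP.
Qed.

End Meridian.

(** * Surfaces of revolution *)

Section Charts.
Variable R : realType.

Lemma dot_comb (u v w : 'rV[R]_3) (x y : R) :
  dot (x *: u + y *: v) w = x * dot u w + y * dot v w.
Proof. by rewrite dotDl !dotZl. Qed.

Variables (S : set 'rV[R]_3) (U : set 'rV[R]_2) (f : 'rV[R]_2 -> 'rV[R]_3).
Hypothesis pf : parametrization S U f.

Lemma chart_diff u : U u -> differentiable f u.
Proof. by case: pf => _ h _ _ _ /(h [::]). Qed.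

Lemma chart_diff_partial i u : U u -> differentiable ('D_(delta_mx ord0 i) f) u.
Proof. by case: pf => _ h _ _ _ /(h [:: i]). Qed.

Lemma chart_diff_partial2 i j u : U u ->
  differentiable ('D_(delta_mx ord0 j) ('D_(delta_mx ord0 i) f)) u.
Proof. by case: pf => _ h _ _ _ /(h [:: j; i]). Qed.

Lemma derive_lin (g : 'rV[R]_2 -> 'rV[R]_3) u (x y : R) v w (gv gw : 'rV[R]_3) :
  differentiable g u -> 'D_v g u = gv -> 'D_w g u = gw ->
  'D_(x *: v + y *: w) g u = x *: gv + y *: gw.
Proof. by move=> dg <- <-; rewrite !deriveE// linearD !linearZ. Qed.

Lemma dot_derive_lin (g : 'rV[R]_2 -> 'rV[R]_3) u (x y : R) v w nu (l l' : R) :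
  differentiable g u -> dot ('D_v g u) nu = l -> dot ('D_w g u) nu = l' ->
  dot ('D_(x *: v + y *: w) g u) nu = x * l + y * l'.
Proof.
move=> dg <- <-; move: (derive_lin x y dg (erefl ('D_v g u)) (erefl ('D_w g u))).
by move: ('D_v g u) ('D_w g u) => gv gw ->; exact: dot_comb.
Qed.

Lemma derive_scale (g : 'rV[R]_2 -> 'rV[R]_3) u (x : R) v (gv : 'rV[R]_3) :
  differentiable g u -> 'D_v g u = gv -> 'D_(x *: v) g u = x *: gv.
Proof. by move=> dg <-; rewrite !deriveE// linearZ. Qed.

Lemma rV2_expand (w : 'rV[R]_2) :
  w = w ord0 0 *: delta_mx ord0 0 + w ord0 1 *: delta_mx ord0 1.
Proof.
rewrite {1}(row_sum_delta w) !big_ord_recr big_ord0 /= add0r.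
by congr (w _ _ *: delta_mx _ _ + w _ _ *: delta_mx _ _); apply/val_inj.
Qed.

Lemma chart_tangent u w : U u -> tangent S (f u) ('D_w f u).
Proof. by move=> Uu; exists U, f, u, w. Qed.

(** Weingarten's identity, by differentiating the zero product of a tangent vector and the normal
    along a curve. It trades second derivatives of an arbitrary chart for the derivative of the
    normal, which is explicit on a surface of revolution. *)
Lemma second_form (y : R -> 'rV[R]_2) (nu : R -> 'rV[R]_3) (t0 : R) w nu' i :
  (\forall t \near t0, U (y t)) ->
  (\forall t \near t0, forall v, tangent S (f (y t)) v -> dot v (nu t) = 0) ->
  is_derive t0 1 y w -> is_derive t0 1 nu nu' ->
  dot ('D_w ('D_(delta_mx ord0 i) f) (y t0)) (nu t0) =
  - dot ('D_(delta_mx ord0 i) f (y t0)) nu'.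
Proof.
move=> Uy tan dy dnu; have Uy0 := nbhs_singleton Uy.
have d1 := der_dot (der_diff (chart_diff_partial i Uy0) dy) dnu.
have d0 : is_derive t0 1
    (fun t => dot ('D_(delta_mx ord0 i) f (y t)) (nu t)) 0.
  apply: der_near (derC 0 t0 1); near=> t; apply/esym.
  have ht : forall v, tangent S (f (y t)) v -> dot v (nu t) = 0 by near: t.
  by apply: ht; apply: chart_tangent; near: t.
by apply/eqP; rewrite -addr_eq0; apply/eqP/(der_uniq d1 d0).
Unshelve. all: by end_near. Qed.

(** Their images being independent, [a] and [b] form a basis of the plane; the coordinates of [w]
    are read off after the differential has mapped it to an orthonormal pair. *)
Lemma chart_span u a b w (va vb : 'rV[R]_3) : U u ->
  'D_a f u = va -> 'D_b f u = vb ->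
  dot va va = 1 -> dot vb vb = 1 -> dot va vb = 0 ->
  w = dot ('D_w f u) va *: a + dot ('D_w f u) vb *: b.
Proof.
move=> Uu Da Db aa bb ab; have df := chart_diff Uu.
have [_ _ finj _ _] := pf.
have Ea (x y : R) : dot (x *: va + y *: vb) va = x.
  by rewrite dotDl !dotZl aa (dotC vb) ab mulr1 mulr0 addr0.
have Eb (x y : R) : dot (x *: va + y *: vb) vb = y.
  by rewrite dotDl !dotZl bb ab mulr1 mulr0 add0r.
have comb0 x y : x *: a + y *: b = 0 -> x = 0 /\ y = 0.
  move=> h; have := derive_lin x y df Da Db; rewrite h derive0 => E.
  by split; [rewrite -(Ea x y)|rewrite -(Eb x y)]; rewrite -E dot0l.
have eq2 (v v' : 'rV[R]_2) : v ord0 0 = v' ord0 0 -> v ord0 1 = v' ord0 1 -> v = v'.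
  by move=> h0 h1; rewrite (rV2_expand v) h0 h1 -rV2_expand.
pose det := a ord0 0 * b ord0 1 - a ord0 1 * b ord0 0.
have det0 : det != 0.
  apply/negP => /eqP h.
  have [b0 a0] : b ord0 0 = 0 /\ - a ord0 0 = 0.
    apply: comb0; apply: eq2; rewrite !mxE mulNr; first by rewrite mulrC subrr.
    by rewrite -[RHS]oppr0 -h /det opprB addrC mulrC addrC (mulrC (b _ _)).
  have [b1 a1] : b ord0 1 = 0 /\ - a ord0 1 = 0.
    apply: comb0; apply: eq2; rewrite !mxE mulNr; last by rewrite mulrC subrr.
    by rewrite -h /det (mulrC (b _ _)).
  have [] : (1 : R) = 0 /\ (0 : R) = 0; last by move=> /eqP; rewrite oner_eq0.
  apply: comb0; rewrite scale0r addr0 scale1r (rV2_expand a).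
  move: a0 a1 => /eqP; rewrite oppr_eq0 => /eqP -> /eqP; rewrite oppr_eq0 => /eqP ->.
  by rewrite !scale0r addr0.
pose x := (w ord0 0 * b ord0 1 - w ord0 1 * b ord0 0) / det.
pose y := (a ord0 0 * w ord0 1 - a ord0 1 * w ord0 0) / det.
have wE : w = x *: a + y *: b.
  by apply: eq2; rewrite !mxE /x /y; move: det0; rewrite /det => h; field; exact: h.
have -> : 'D_w f u = x *: va + y *: vb by rewrite wE; exact: derive_lin.
by rewrite Ea Eb -wE.
Qed.

End Charts.

(** The formula of [gauss_curvature] with chart and normal as arguments, so that its dependence on
    the point can be studied. *)
Definition chart_curvature (R : realType) (f : 'rV[R]_2 -> 'rV[R]_3) u nu : R :=
  let d0 : 'rV[R]_2 := delta_mx ord0 0 in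
  let d1 : 'rV[R]_2 := delta_mx ord0 1 in
  let E := dot ('D_d0 f u) ('D_d0 f u) in
  let F := dot ('D_d0 f u) ('D_d1 f u) in
  let G := dot ('D_d1 f u) ('D_d1 f u) in
  let L := dot ('D_d0 ('D_d0 f) u) nu in
  let M := dot ('D_d0 ('D_d1 f) u) nu in
  let N := dot ('D_d1 ('D_d1 f) u) nu in
  (L * N - M ^+ 2) / (E * G - F ^+ 2).

Section FrameAlgebra.
Variable R : realType.
Implicit Types r a c : 'rV[R]_3.

Lemma frame_dotE r a c (x y z x' y' z' : R) : frame r a c ->
  dot (x *: r + y *: a + z *: c) (x' *: r + y' *: a + z' *: c) =
  x * x' + y * y' + z * z'.
Proof.
move=> [rr aa cc ra rc ac].
by rewrite !(dotDl, dotDr, dotZl, dotZr) (dotC a r) (dotC c r) (dotC c a)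
  rr aa cc ra rc ac; ring.
Qed.

Lemma frame_meridian r a c (x z : R) : frame r a c -> x ^+ 2 + z ^+ 2 = 1 ->
  [/\ dot (x *: r + z *: c) (x *: r + z *: c) = 1, dot (x *: r + z *: c) a = 0,
      dot (z *: r - x *: c) (z *: r - x *: c) = 1,
      dot (x *: r + z *: c) (z *: r - x *: c) = 0 & dot a (z *: r - x *: c) = 0].
Proof.
move=> [rr aa cc ra rc ac] h.
rewrite !(dotDl, dotDr, dotZl, dotZr, dotNl, dotNr) (dotC a r) (dotC c r) (dotC c a)
  rr cc ra rc ac.
by split; try (by ring); rewrite -[RHS]h; ring.
Qed.

Lemma frame_tangent r a c (x z al be ga : R) : frame r a c ->
  x ^+ 2 + z ^+ 2 = 1 -> al * z = ga * x ->
  let v := al *: r + be *: a + ga *: c in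
  v = dot v (x *: r + z *: c) *: (x *: r + z *: c) + dot v a *: a.
Proof.
move=> fr u h v; have [rr aa cc ra rc ac] := fr.
have -> : dot v (x *: r + z *: c) = al * x + ga * z.
  rewrite /v !(dotDl, dotDr, dotZl, dotZr) (dotC c r) (dotC a r) rr cc ra rc ac.
  by ring.
have -> : dot v a = be.
  by rewrite /v !(dotDl, dotZl) (dotC c a) aa ra ac; ring.
rewrite scalerDr !scalerA; have -> : (al * x + ga * z) * x = al.
  have -> : (al * x + ga * z) * x = al * x ^+ 2 + z * (ga * x) by ring.
  by rewrite -h -[RHS]mulr1 -u; ring.
have -> : (al * x + ga * z) * z = ga.
  have -> : (al * x + ga * z) * z = x * (al * z) + ga * z ^+ 2 by ring.
  by rewrite h -[RHS]mulr1 -u; ring.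
by rewrite /v addrAC.
Qed.

Lemma frame_normal r a c (x z al be ga l l' : R) : frame r a c ->
  al * x + ga * z = 0 -> be = 0 ->
  dot (al *: r + be *: a + ga *: c) (l *: (x *: r + z *: c) + l' *: a) = 0.
Proof.
move=> [rr aa cc ra rc ac] h ->.
have -> : dot (al *: r + 0 *: a + ga *: c) (l *: (x *: r + z *: c) + l' *: a) =
    l * (al * x + ga * z).
  rewrite !(dotDl, dotDr, dotZl, dotZr) (dotC c r) (dotC c a) (dotC a r) rr aa cc ra rc ac.
  by ring.
by rewrite h mulr0.
Qed.

End FrameAlgebra.

Section Revolution.
Variable R : realType.
Variables (S : set 'rV[R]_3) (e1 e2 e3 : 'rV[R]_3) (sigma : R).
Variables (rho rho1 rho2 z z1 z2 : R -> R).
Hypothesis fr : frame e1 e2 e3.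
Hypothesis surf : surface S.
Hypothesis drho : forall s, - sigma < s < sigma -> is_derive s 1 rho (rho1 s).
Hypothesis drho1 : forall s, - sigma < s < sigma -> is_derive s 1 rho1 (rho2 s).
Hypothesis dz : forall s, - sigma < s < sigma -> is_derive s 1 z (z1 s).
Hypothesis dz1 : forall s, - sigma < s < sigma -> is_derive s 1 z1 (z2 s).
Hypothesis rho_gt0 : forall s, - sigma < s < sigma -> 0 < rho s.
Hypothesis unit_speed : forall s, - sigma < s < sigma -> rho1 s ^+ 2 + z1 s ^+ 2 = 1.

Definition radial (t : R) := cos t *: e1 + sin t *: e2.
Definition angular (t : R) := - sin t *: e1 + cos t *: e2.
Definition revolve s t := rho s *: radial t + z s *: e3.
Definition meridian_dir s t := rho1 s *: radial t + z1 s *: e3.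
Definition unit_normal s t := z1 s *: radial t - rho1 s *: e3.

Hypothesis revolve_in : forall s t, - sigma < s < sigma -> S (revolve s t).

Lemma radial_frame t : frame (radial t) (angular t) e3.
Proof.
have h := cos2Dsin2 t; have fE := frame_dotE _ _ _ _ _ _ fr.
have re : radial t = cos t *: e1 + sin t *: e2 + 0 *: e3 by rewrite scale0r addr0.
have ae : angular t = - sin t *: e1 + cos t *: e2 + 0 *: e3 by rewrite scale0r addr0.
have ce : e3 = 0 *: e1 + 0 *: e2 + 1 *: e3 by rewrite !scale0r !add0r scale1r.
split; [rewrite re|rewrite ae|exact: fr33 fr|rewrite re ae|
  rewrite [in dot _ e3]ce re|rewrite [in dot _ e3]ce ae];
  rewrite fE; try (by ring); rewrite -[RHS]h; ring.
Qed.

Lemma revolve_coords s t :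
  revolve s t = rho s *: radial t + 0 *: angular t + z s *: e3.
Proof. by rewrite scale0r addr0. Qed.

Lemma meridian_dir_coords s t :
  meridian_dir s t = rho1 s *: radial t + 0 *: angular t + z1 s *: e3.
Proof. by rewrite scale0r addr0. Qed.

Lemma angular_coords t :
  angular t = 0 *: radial t + 1 *: angular t + 0 *: e3.
Proof. by rewrite !scale0r addr0 add0r scale1r. Qed.

Lemma der_radial (t : R) : is_derive t (1 : R) radial (angular t).
Proof.
have d1 := der_scale (is_derive_cos t) (derC e1 t 1).
have d2 := der_scale (is_derive_sin t) (derC e2 t 1).
by apply: der_eq (derD d1 d2) _; rewrite !scaler0 !addr0.
Qed.

Lemma der_angular (t : R) : is_derive t (1 : R) angular (- radial t).
Proof.
have d1 := der_scale (derN (is_derive_sin t)) (derC e1 t 1).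
have d2 := der_scale (is_derive_cos t) (derC e2 t 1).
by apply: der_eq (derD d1 d2) _; rewrite !scaler0 !addr0 /radial opprD !scaleNr.
Qed.

Let dscale (g : R -> R) (v : 'rV[R]_3) (s l : R) :
  is_derive s (1 : R) g l -> is_derive s (1 : R) (fun s => g s *: v) (l *: v).
Proof.
by move=> h; apply: der_eq (der_scale h (derC v s 1)) _; rewrite scaler0 addr0.
Qed.

Let dom s := - sigma < s < sigma.

Let near_dom s : dom s -> \forall t \near s, dom t.
Proof. exact: near_itv. Qed.

Lemma chart_basis U f u s t : parametrization S U f -> U u -> dom s ->
  f u = revolve s t ->
  exists a b ya yb, [/\ 'D_a f u = meridian_dir s t /\ 'D_b f u = angular t,
    [/\ ya s = u, {for s, continuous ya}, is_derive s 1 ya a &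
       \forall r \near s, U (ya r) /\ f (ya r) = revolve r t] &
    [/\ yb t = u, is_derive t 1 yb (rho s *: b) &
       \forall r \near t, U (yb r) /\ f (yb r) = revolve s r]].
Proof.
move=> pf Uu ds fu.
have dFs : is_derive s 1 (fun s => revolve s t) (meridian_dir s t).
  exact: derD (dscale _ (drho ds)) (dscale _ (dz ds)).
have dFt : is_derive t 1 (revolve s) (rho s *: angular t).
  apply: der_eq (derD (der_scale (derC (rho s) t 1) (der_radial t)) (derC _ t 1)) _.
  by rewrite scale0r add0r addr0.
have near_s : \forall r \near s, S (revolve r t).
  by apply: filterS (near_dom ds) => r; exact: revolve_in.
have near_t : \forall r \near t, S (revolve s r) by near=> r; exact: revolve_in.
have [ya [a [ya0 cya yaN dya Da]]] :=
  lift_curve (x := fun r => revolve r t) pf Uu fu near_s dFs.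
have [yb [b [yb0 cyb ybN dyb Db]]] :=
  lift_curve (x := revolve s) pf Uu fu near_t dFt.
have rn : rho s != 0 by rewrite gt_eqF// rho_gt0.
exists a, ((rho s)^-1 *: b), ya, yb; split=> //.
  split=> //; rewrite (derive_scale _ (chart_diff pf Uu) Db).
  by rewrite scalerA mulVf// scale1r.
by rewrite scalerA divff// scale1r.
Unshelve. all: by end_near. Qed.

Lemma surface_frame s t : dom s ->
  [/\ dot (meridian_dir s t) (meridian_dir s t) = 1,
      dot (meridian_dir s t) (angular t) = 0,
      dot (unit_normal s t) (unit_normal s t) = 1,
      dot (meridian_dir s t) (unit_normal s t) = 0 &
      dot (angular t) (unit_normal s t) = 0].
Proof.
by move=> /unit_speed h; exact: (frame_meridian (radial_frame t) h).
Qed.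

Lemma tangent_revolve s t v : dom s ->
  tangent S (revolve s t) v <->
  v = dot v (meridian_dir s t) *: meridian_dir s t + dot v (angular t) *: angular t.
Proof.
move=> ds; have [U [f [u [pf Uu fu]]]] := surf (revolve_in t ds).
have [a [b [ya [yb [[Da Db] _ _]]]]] := chart_basis pf Uu ds fu.
have [h1 h2 _ _ _] := surface_frame t ds; have h3 := fr22 (radial_frame t).
rewrite -fu; split => [/(tangent_in_chart pf Uu) [w <-]|->]; last first.
  rewrite -(derive_lin _ _ (chart_diff pf Uu) Da Db).
  exact: (chart_tangent pf _ Uu).
have E := chart_span pf w Uu Da Db h1 h3 h2.
by rewrite {1}E (derive_lin _ _ (chart_diff pf Uu) Da Db).
Qed.

Lemma tangent_normal s t v : dom s ->
  tangent S (revolve s t) v -> dot v (unit_normal s t) = 0.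
Proof.
move=> ds /tangent_revolve -> //; have [_ _ _ h4 h5] := surface_frame t ds.
by rewrite dotDl !dotZl h4 h5 !mulr0 addr0.
Qed.

(** Along the unit meridian and parallel directions the second fundamental form is diagonal with
    entries [- lam] and [- z1 / rho]. The squared determinant of the change of basis appears in the
    numerator and in the denominator and cancels. *)
Lemma chart_curvatureE U f u s t : parametrization S U f -> U u -> dom s ->
  f u = revolve s t -> chart_curvature f u (unit_normal s t) = - rho2 s / rho s /\
  dot ('D_(delta_mx ord0 0) f u) ('D_(delta_mx ord0 0) f u) *
  dot ('D_(delta_mx ord0 1) f u) ('D_(delta_mx ord0 1) f u) -
  dot ('D_(delta_mx ord0 0) f u) ('D_(delta_mx ord0 1) f u) ^+ 2 != 0.
Proof.
move=> pf Uu ds fu.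
have [a [b [ya [yb [[Da Db] [ya0 _ dya yaN] [yb0 dyb ybN]]]]]] := chart_basis pf Uu ds fu.
have [h1 h2 h3 h4 h5] := surface_frame t ds.
have aa := fr22 (radial_frame t).
have fE' := frame_dotE _ _ _ _ _ _ (radial_frame t).
have rn : rho s != 0 by rewrite gt_eqF// rho_gt0.
pose es := meridian_dir s t; pose ep := angular t; pose nu := unit_normal s t.
pose d (i : 'I_2) : 'rV[R]_2 := delta_mx ord0 i.
have [p pE] : exists p : 'I_2 -> R, forall i, p i = dot ('D_(d i) f u) es by eexists.
have [q qE] : exists q : 'I_2 -> R, forall i, q i = dot ('D_(d i) f u) ep by eexists.
have fE i : 'D_(d i) f u = p i *: es + q i *: ep.
  by rewrite pE qE; apply/(tangent_revolve t _ ds); rewrite -fu; exact: (chart_tangent pf _ Uu).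
have dE i : d i = p i *: a + q i *: b.
  by rewrite pE qE; exact: (chart_span pf (d i) Uu Da Db h1 aa h2).
have [lam lamE] : exists lam, lam = z2 s * rho1 s - rho2 s * z1 s by eexists.
have dpf i : differentiable ('D_(d i) f) u := chart_diff_partial pf i Uu.
have Ba i : dot ('D_a ('D_(d i) f) u) nu = - (p i * lam).
  have dnu : is_derive s 1 (fun s => unit_normal s t) (z2 s *: radial t - rho2 s *: e3).
    exact: derB (dscale _ (dz1 ds)) (dscale _ (drho1 ds)).
  have := @second_form _ _ _ _ pf ya (fun s => unit_normal s t) s a _ i _ _ dya dnu.
  rewrite ya0 -/nu -/(d i) => ->.
  - have -> : z2 s *: radial t - rho2 s *: e3 =
        z2 s *: radial t + 0 *: angular t + (- rho2 s) *: e3.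
      by rewrite scale0r addr0 scaleNr.
    rewrite fE dotDl !dotZl.
    have -> : dot es (z2 s *: radial t + 0 *: angular t + - rho2 s *: e3) = lam.
      by rewrite /es meridian_dir_coords fE' lamE; ring.
    have -> : dot ep (z2 s *: radial t + 0 *: angular t + - rho2 s *: e3) = 0.
      by rewrite /ep [X in dot X _]angular_coords fE'; ring.
    by ring.
  - by apply: filterS yaN => r [].
  - near=> r => v; have [_ ->] : U (ya r) /\ f (ya r) = revolve r t by near: r.
    by apply: tangent_normal; near: r; exact: near_dom.
have Bb i : dot ('D_b ('D_(d i) f) u) nu = - (q i * (z1 s / rho s)).
  have dnu : is_derive t 1 (unit_normal s) (z1 s *: angular t).
    apply: der_eq (derB (der_scale (derC (z1 s) t 1) (der_radial t)) (derC _ t 1)) _.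
    by rewrite scale0r add0r subr0.
  have := @second_form _ _ _ _ pf yb (unit_normal s) t _ _ i _ _ dyb dnu.
  rewrite yb0 -/nu -/(d i) => E.
  have {E} : dot ('D_(rho s *: b) ('D_(d i) f) u) nu = - dot ('D_(d i) f u) (z1 s *: angular t).
    apply: E.
    - by apply: filterS ybN => r [].
    - near=> r => v; have [_ ->] : U (yb r) /\ f (yb r) = revolve s r by near: r.
      exact: tangent_normal.
  rewrite (derive_scale _ (dpf i) erefl) dotZl.
  rewrite fE dotDl !dotZl !dotZr -/ep (dotC es) (dotC ep es) h2 aa.
  move=> E; apply: (mulfI rn); rewrite E; field; exact: rn.
have B i j : dot ('D_(d j) ('D_(d i) f) u) nu =
    - (p j * p i * lam + q j * q i * (z1 s / rho s)).
  have -> : 'D_(d j) ('D_(d i) f) u = 'D_(p j *: a + q j *: b) ('D_(d i) f) u.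
    by rewrite -dE.
  apply: etrans (dot_derive_lin (p j) (q j) (dpf i) (Ba i) (Bb i)) _.
  by rewrite !mulrN -opprD !mulrA.
have cE v i : dot ('D_(d i) f u) v = p i * dot es v + q i * dot ep v.
  by rewrite fE; exact: dot_comb.
have I i j : dot ('D_(d i) f u) ('D_(d j) f u) = p i * p j + q i * q j.
rewrite cE (dotC es ('D_(d j) f u)) (dotC ep ('D_(d j) f u)) !cE.
  rewrite (dotC ep es) (h1 : dot es es = 1) (h2 : dot es ep = 0) (aa : dot ep ep = 1).
  by rewrite !mulr0 !mulr1 addr0 add0r.
have pq : p 0 * q 1 - p 1 * q 0 != 0.
  have e00 := congr1 (fun v : 'rV[R]_2 => v ord0 0) (dE 0).
  have e01 := congr1 (fun v : 'rV[R]_2 => v ord0 1) (dE 0).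
  have e10 := congr1 (fun v : 'rV[R]_2 => v ord0 0) (dE 1).
  have e11 := congr1 (fun v : 'rV[R]_2 => v ord0 1) (dE 1).
  move: e00 e01 e10 e11; rewrite /d !mxE !eqxx /= => e00 e01 e10 e11.
  apply/negP => /eqP E.
  have : (p 0 * q 1 - p 1 * q 0) * (a ord0 0 * b ord0 1 - a ord0 1 * b ord0 0) = 1.
    have -> : (p 0 * q 1 - p 1 * q 0) * (a ord0 0 * b ord0 1 - a ord0 1 * b ord0 0) =
      (p 0 * a ord0 0 + q 0 * b ord0 0) * (p 1 * a ord0 1 + q 1 * b ord0 1) -
      (p 0 * a ord0 1 + q 0 * b ord0 1) * (p 1 * a ord0 0 + q 1 * b ord0 0) by ring.
    by rewrite -e00 -e01 -e10 -e11 mulr1 mul0r subr0.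
  by rewrite E mul0r => /eqP; rewrite eq_sym oner_eq0.
(* Frenet's relation for the profile, whose signed curvature is [lam], from differentiating
   [rho1 ^+ 2 + z1 ^+ 2 = 1]. *)
have lamz : lam * z1 s = - rho2 s.
  have h : is_derive s 1 (fun s => rho1 s * rho1 s + z1 s * z1 s) _ :=
    derD (derM (drho1 ds) (drho1 ds)) (derM (dz1 ds) (dz1 ds)).
  have h0 : is_derive s 1 (fun s => rho1 s * rho1 s + z1 s * z1 s) 0.
    apply: der_near (derC (1 : R) s 1); near=> r.
    by rewrite -!expr2 unit_speed//; near: r; exact: near_dom.
  have := der_uniq h h0 => E.
  have -> : lam * z1 s = rho1 s * (z1 s * z2 s) - rho2 s * z1 s ^+ 2.
    by rewrite lamE; ring.
  have -> : z1 s * z2 s = - (rho1 s * rho2 s) by lra.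
  by rewrite -[RHS]mulr1 -(unit_speed ds); ring.
have det : (p 0 * p 0 + q 0 * q 0) * (p 1 * p 1 + q 1 * q 1) -
    (p 0 * p 1 + q 0 * q 1) ^+ 2 = (p 0 * q 1 - p 1 * q 0) ^+ 2 by ring.
pose b2 i j := - (p j * p i * lam + q j * q i * (z1 s / rho s)).
pose i2 i j := p i * p j + q i * q j.
have K : chart_curvature f u nu =
    (b2 0 0 * b2 1 1 - b2 1 0 ^+ 2) / (i2 0 0 * i2 1 1 - i2 0 1 ^+ 2).
  rewrite /chart_curvature; congr ((_ * _ - _ ^+ 2) / (_ * _ - _ ^+ 2)).
  - exact: (B 0 0).
  - exact: (B 1 1).
  - exact: (B 1 0).
  - exact: (I 0 0).
  - exact: (I 1 1).
  - exact: (I 0 1).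
have {}det : i2 0 0 * i2 1 1 - i2 0 1 ^+ 2 = (p 0 * q 1 - p 1 * q 0) ^+ 2 by exact: det.
split; last first.
  apply: (@eq_ind_r _ (i2 0 0 * i2 1 1 - i2 0 1 ^+ 2) (fun x => x != 0)).
    by rewrite det expf_neq0.
  by congr (_ * _ - _ ^+ 2); [exact: (I 0 0)|exact: (I 1 1)|exact: (I 0 1)].
rewrite -/nu K det /b2 -lamz.
move: pq rn; move: (p 0) (p 1) (q 0) (q 1) (rho s) (z1 s) => p0 p1 q0 q1 r zz pq rn.
by field; rewrite pq rn.
Unshelve. all: by end_near. Qed.

Lemma gauss_revolve s t : dom s ->
  gauss_curvature S (revolve s t) (- rho2 s / rho s).
Proof.
move=> ds; have [U [f [u [pf Uu fu]]]] := surf (revolve_in t ds).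
exists U, f, u, (unit_normal s t); split=> //.
- have [_ _ h _ _] := surface_frame t ds; rewrite /enorm h sqrtr1; split=> // v.
  exact: tangent_normal.
- by have [<- _] := chart_curvatureE pf Uu ds fu.
Qed.

(** [rho2 = - K * rho], and near [s] the curvature [K] is computed from a single smooth chart along
    a continuous lift of the profile. *)
Lemma rho2_continuous s : dom s -> {for s, continuous rho2}.
Proof.
move=> ds; have [U [f [u [pf Uu fu]]]] := surf (revolve_in 0 ds).
have [a [b [ya [yb [_ [ya0 cya _ yaN] _]]]]] := chart_basis pf Uu ds fu.
pose K r := chart_curvature f (ya r) (unit_normal r 0).
have [_ nz] := chart_curvatureE pf Uu ds fu.
have cy (g : 'rV[R]_2 -> 'rV[R]_3) : differentiable g u -> {for s, continuous (g \o ya)}.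
  move=> dg; apply: continuous_comp; first exact: cya.
  by rewrite ya0; exact: differentiable_continuous.
have cnu : {for s, continuous (fun r => unit_normal r 0)}.
  exact: der_cont (derB (dscale _ (dz1 ds)) (dscale _ (drho1 ds))).
have c1 i := cy _ (chart_diff_partial pf i Uu).
have c2 i j := cy _ (chart_diff_partial2 pf i j Uu).
have csq (g : R -> R) : {for s, continuous g} -> {for s, continuous (fun r => g r ^+ 2)}.
  move=> cg; apply: (@continuous_comp _ _ _ g (fun x : R => x ^+ 2)) => //.
  exact: exprn_continuous.
have d1 i k := cont_dot (c1 i) (c1 k).
have d2 i k := cont_dot (c2 i k) cnu.
have cK : {for s, continuous K}.
  have cnum := continuousB (continuousM (d2 0 0) (d2 1 1)) (csq _ (d2 1 0)).
  have cden := continuousB (continuousM (d1 0 0) (d1 1 1)) (csq _ (d1 0 1)).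
  apply: (continuousM cnum); apply: continuousV cden.
  by move: nz; rewrite -ya0.
have KE : \forall r \near s, - (K r * rho r) = rho2 r.
  near=> r; have [Uy fy] : U (ya r) /\ f (ya r) = revolve r 0 by near: r.
  have dr : dom r by near: r; exact: near_dom.
  have [e _] := chart_curvatureE pf Uy dr fy.
  by rewrite /K e divfK ?gt_eqF ?rho_gt0// opprK.
have c : {for s, continuous (fun r => - (K r * rho r))}.
  apply: continuousN; apply: continuousM => //; exact: der_cont (drho ds).
have c' : - (K r * rho r) @[r --> s] --> rho2 s.
  by rewrite -(nbhs_singleton KE); exact: c.
by apply: cvg_trans c'; exact: near_eq_cvg.
Unshelve. all: by end_near. Qed.

End Revolution.

Lemma der_derive1 (R : realType) (V : normedModType R) (f : R -> V) (x : R) (l : V) :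
  is_derive x 1 f l -> derive1 f x = l.
Proof. by move=> h; rewrite derive1E; case: h. Qed.

(** * Geodesics of a surface of revolution and their Jacobi fields *)

Section RevolutionGeodesics.
Variable R : realType.
Variables (S : set 'rV[R]_3) (e1 e2 e3 : 'rV[R]_3) (sigma : R).
Variables (rho rho1 rho2 z z1 z2 : R -> R).
Hypothesis fr : frame e1 e2 e3.
Hypothesis surf : surface S.
Hypothesis drho : forall s, - sigma < s < sigma -> is_derive s 1 rho (rho1 s).
Hypothesis drho1 : forall s, - sigma < s < sigma -> is_derive s 1 rho1 (rho2 s).
Hypothesis dz : forall s, - sigma < s < sigma -> is_derive s 1 z (z1 s).
Hypothesis dz1 : forall s, - sigma < s < sigma -> is_derive s 1 z1 (z2 s).
Hypothesis rho_gt0 : forall s, - sigma < s < sigma -> 0 < rho s.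
Hypothesis unit_speed : forall s, - sigma < s < sigma -> rho1 s ^+ 2 + z1 s ^+ 2 = 1.

Let F := revolve e1 e2 e3 rho z.
Let rad := radial e1 e2.
Let ang := angular e1 e2.

Hypothesis revolve_in : forall s t, - sigma < s < sigma -> S (F s t).

Lemma meridian_curvature_normal s : - sigma < s < sigma ->
  rho1 s * rho2 s + z1 s * z2 s = 0.
Proof.
move=> ds; have h := derD (derM (drho1 ds) (drho1 ds)) (derM (dz1 ds) (dz1 ds)).
have h0 : is_derive s 1 (fun s => rho1 s * rho1 s + z1 s * z1 s) 0.
  apply: der_near (derC (1 : R) s 1); near=> r.
  by rewrite -!expr2 unit_speed//; near: r; exact: near_itv.
by have := der_uniq h h0; lra.
Unshelve. all: by end_near. Qed.

Section OneGeodesic.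
(** [C] is Clairaut's constant and [k = rho * s']. With [k] as an unknown of its own, the system
    stays regular at turning points, where Clairaut's relation alone does not determine the
    motion. *)
Variables (T1 T2 C : R) (s phi k : R -> R).
Hypothesis s_dom : forall t, T1 < t < T2 -> - sigma < s t < sigma.
Hypothesis ds : forall t, T1 < t < T2 -> is_derive t 1 s (k t / rho (s t)).
Hypothesis dphi : forall t, T1 < t < T2 -> is_derive t 1 phi (C / rho (s t) ^+ 2).
Hypothesis dk : forall t, T1 < t < T2 -> is_derive t 1 k (rho1 (s t)).
Hypothesis clairaut : forall t, T1 < t < T2 -> k t ^+ 2 + C ^+ 2 = rho (s t) ^+ 2.

Let moving (al be ga : R -> R) t :=
  al t *: rad (phi t) + be t *: ang (phi t) + ga t *: e3.

(** The rotation of the frame, with angular speed [phi' = C / rho ^+ 2], adds terms that exchange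
    the radial and angular components. *)
Let der_moving al be ga t al' be' ga' : T1 < t < T2 ->
  is_derive t 1 al al' -> is_derive t 1 be be' -> is_derive t 1 ga ga' ->
  is_derive t 1 (moving al be ga)
   ((al' - be t * (C / rho (s t) ^+ 2)) *: rad (phi t) +
    (be' + al t * (C / rho (s t) ^+ 2)) *: ang (phi t) + ga' *: e3).
Proof.
move=> ht da db dg.
have comp (w : R -> 'rV[R]_3) (l : 'rV[R]_3) : is_derive (phi t) 1 w l ->
    is_derive t 1 (fun t => w (phi t)) ((C / rho (s t) ^+ 2) *: l).
  move=> hw; apply: der_mx => i j; rewrite mxE mulrC.
  exact: (der_comp (f := fun t => w t i j) (der_coord i j hw) (dphi ht)).
have dr := comp _ _ (der_radial e1 e2 (phi t)).
have dn := comp _ _ (der_angular e1 e2 (phi t)).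
apply: der_eq (derD (derD (der_scale da dr) (der_scale db dn)) (der_scale dg (derC e3 t 1))) _.
rewrite scaler0 addr0 -/rad -/ang !scalerN !scalerA scalerBl scalerDl.
congr (_ + _); rewrite [X in _ + X = _]addrC addrACA; congr (_ + _).
exact: addrC.
Qed.

Definition spiral t := F (s t) (phi t).

Let drs t : T1 < t < T2 -> is_derive t 1 (fun t => rho (s t)) (rho1 (s t) * (k t / rho (s t))).
Proof. by move=> ht; exact: der_comp (drho (s_dom ht)) (ds ht). Qed.

Let dr1s t : T1 < t < T2 -> is_derive t 1 (fun t => rho1 (s t)) (rho2 (s t) * (k t / rho (s t))).
Proof. by move=> ht; exact: der_comp (drho1 (s_dom ht)) (ds ht). Qed.

Let dzs t : T1 < t < T2 -> is_derive t 1 (fun t => z (s t)) (z1 (s t) * (k t / rho (s t))).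
Proof. by move=> ht; exact: der_comp (dz (s_dom ht)) (ds ht). Qed.

Let dz1s t : T1 < t < T2 -> is_derive t 1 (fun t => z1 (s t)) (z2 (s t) * (k t / rho (s t))).
Proof. by move=> ht; exact: der_comp (dz1 (s_dom ht)) (ds ht). Qed.

Let r_neq0 t : T1 < t < T2 -> rho (s t) != 0.
Proof. by move=> ht; rewrite gt_eqF// rho_gt0// s_dom. Qed.

Let v1 t := rho1 (s t) * (k t / rho (s t)).
Let v2 t := C / rho (s t).
Let v3 t := z1 (s t) * (k t / rho (s t)).

Lemma der_spiral t : T1 < t < T2 -> is_derive t 1 spiral (moving v1 v2 v3 t).
Proof.
move=> ht; have := der_moving ht (drs ht) (derC 0 t 1) (dzs ht).
have -> : moving (fun t => rho (s t)) (fun=> 0) (fun t => z (s t)) = spiral.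
  by apply/funext => r; rewrite /moving scale0r addr0.
move=> h; apply: der_eq h _; rewrite mul0r subr0 add0r /moving.
congr (_ + _ *: _ + _); rewrite /v2; field; exact: r_neq0.
Qed.

(* Coordinates of the unit conormal of the geodesic. It is parallel, so that a
   multiple [j] of it is a Jacobi field when [j'' + K j = 0]. *)
Let n1 t := - (C / rho (s t)) * rho1 (s t).
Let n2 t := k t / rho (s t).
Let n3 t := - (C / rho (s t)) * z1 (s t).

Definition conormal t := moving n1 n2 n3 t.

Let dot_moving al be ga al' be' ga' t :
  dot (moving al be ga t) (moving al' be' ga' t) =
  al t * al' t + be t * be' t + ga t * ga' t.
Proof. exact: frame_dotE (radial_frame fr (phi t)). Qed.

Lemma conormal_unit t : T1 < t < T2 -> dot (conormal t) (conormal t) = 1.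
Proof.
move=> ht; have rn := r_neq0 ht; have u := unit_speed (s_dom ht).
have cl := clairaut ht; rewrite dot_moving /n1 /n2 /n3.
have -> : - (C / rho (s t)) * rho1 (s t) * (- (C / rho (s t)) * rho1 (s t)) +
    k t / rho (s t) * (k t / rho (s t)) +
    - (C / rho (s t)) * z1 (s t) * (- (C / rho (s t)) * z1 (s t)) =
    (k t ^+ 2 + C ^+ 2 * (rho1 (s t) ^+ 2 + z1 (s t) ^+ 2)) / rho (s t) ^+ 2.
  by field.
by rewrite u mulr1 cl divff// expf_neq0.
Qed.

Let tangent_moving al be ga t : T1 < t < T2 ->
  al t * z1 (s t) = ga t * rho1 (s t) -> tangent S (spiral t) (moving al be ga t).
Proof.
move=> ht h; apply/(tangent_revolve fr surf drho dz rho_gt0 unit_speed revolve_in _ _ (s_dom ht)).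
exact: (frame_tangent _ (radial_frame fr _) (unit_speed (s_dom ht)) h).
Qed.

Let tangent_dot al be ga t v : T1 < t < T2 -> tangent S (spiral t) v ->
  al t * rho1 (s t) + ga t * z1 (s t) = 0 -> be t = 0 ->
  dot (moving al be ga t) v = 0.
Proof.
move=> ht /(tangent_revolve fr surf drho dz rho_gt0 unit_speed revolve_in _ _ (s_dom ht)) ->.
by move=> h b0; exact: (frame_normal _ _ (radial_frame fr _) h b0).
Qed.

(** The acceleration has no angular component, by conservation of [C], and none along the meridian,
    by [meridian_curvature_normal] and Clairaut's relation; so it is normal. *)
Lemma spiral_geodesic : geodesic S [set` `]T1, T2[] spiral.
Proof.
move=> t /=; rewrite in_itv /= => ht.
have st := s_dom ht; have rn := r_neq0 ht; have u := unit_speed st.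
have un := meridian_curvature_normal st; have cl := clairaut ht.
have d1E : \forall r \near t, moving v1 v2 v3 r = derive1 spiral r.
  near=> r; have hr : T1 < r < T2 by near: r; exact: near_itv.
  by rewrite derive1E; case: (der_spiral hr) => _ ->.
pose dkr := (rho1 (s t) * rho (s t) - k t * (rho1 (s t) * (k t / rho (s t)))) / rho (s t) ^+ 2.
have dkr' : is_derive t 1 (fun t => k t / rho (s t)) dkr by exact: der_div rn (dk ht) (drs ht).
have dv2 : is_derive t 1 v2 _ := der_div rn (derC C t 1) (drs ht).
have dv := der_moving ht (derM (dr1s ht) dkr') dv2 (derM (dz1s ht) dkr').
have dd := der_near d1E dv.
split.
- exact: revolve_in.
- by split; [case: (der_spiral ht)|case: dd].
- rewrite -(nbhs_singleton d1E); apply/negP => /eqP E.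
  have := dot_moving v1 v2 v3 v1 v2 v3 t; rewrite E dot0l /v1 /v2 /v3 => /esym.
  have -> : rho1 (s t) * (k t / rho (s t)) * (rho1 (s t) * (k t / rho (s t))) +
    C / rho (s t) * (C / rho (s t)) +
    z1 (s t) * (k t / rho (s t)) * (z1 (s t) * (k t / rho (s t))) =
    ((rho1 (s t) ^+ 2 + z1 (s t) ^+ 2) * k t ^+ 2 + C ^+ 2) / rho (s t) ^+ 2.
    by field.
  by rewrite u mul1r cl divff ?expf_neq0// => /eqP; rewrite oner_eq0.
- move=> v tv; rewrite derive1E; case: dd => _ ->.
  set X := (X in X *: rad _ + _); set Y := (X in _ + X *: ang _ + _).
  set Z := (X in _ + X *: e3).
  apply: (@tangent_dot (fun=> X) (fun=> Y) (fun=> Z)) => //.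
    have C2 : C ^+ 2 = rho (s t) ^+ 2 - k t ^+ 2 by lra.
    have -> : X * rho1 (s t) + Z * z1 (s t) =
      (rho1 (s t) * rho2 (s t) + z1 (s t) * z2 (s t)) * k t ^+ 2 / rho (s t) ^+ 2
      + rho1 (s t) * ((rho1 (s t) ^+ 2 + z1 (s t) ^+ 2) * (rho (s t) ^+ 2 - k t ^+ 2)
         - C ^+ 2) / rho (s t) ^+ 3.
      by rewrite /X /Z /dkr /v2; field.
    by rewrite un u C2 mul1r subrr mul0r mul0r mulr0 mul0r addr0.
  by rewrite /Y /v1; field.
Unshelve. all: by end_near. Qed.

Variables (j j1 : R -> R).
Hypothesis dj : forall t, T1 < t < T2 -> is_derive t 1 j (j1 t).
Hypothesis dj1 : forall t, T1 < t < T2 ->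
  is_derive t 1 j1 (rho2 (s t) / rho (s t) * j t).

(** The velocity being a unit vector orthogonal to the conormal, the vector equation reduces to the
    scalar one for [j] with curvature [- rho2 / rho]. *)
Lemma spiral_jacobi :
  jacobi_field S [set` `]T1, T2[] spiral (fun t => j t *: conormal t).
Proof.
have nmov (h : R -> R) t : h t *: conormal t =
    moving (fun t => h t * n1 t) (fun t => h t * n2 t) (fun t => h t * n3 t) t.
  by rewrite /conormal /moving !scalerDr !scalerA.
have ntan (h : R -> R) t : T1 < t < T2 -> tangent S (spiral t) (h t *: conormal t).
  by move=> ht; rewrite nmov; apply: tangent_moving => //; rewrite /n1 /n3; ring.
have cov (h h' : R -> R) : (forall t, T1 < t < T2 -> is_derive t 1 h (h' t)) ->
    covariant_derivative S [set` `]T1, T2[] spiral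
      (fun t => h t *: conormal t) (fun t => h' t *: conormal t).
  move=> dh t /=; rewrite in_itv /= => ht.
  have st := s_dom ht; have rn := r_neq0 ht; have u := unit_speed st.
  have un := meridian_curvature_normal st; have cl := clairaut ht.
  have dcr := derN (der_div rn (derC C t 1) (drs ht)).
  have dkr := der_div rn (dk ht) (drs ht).
  have dN := der_moving ht (derM dcr (dr1s ht)) dkr (derM dcr (dz1s ht)).
  have dX := der_scale (dh t ht) dN.
  split; [by case: dX|exact: ntan|move=> v tv].
  rewrite (der_derive1 dX) -/(moving n1 n2 n3 t) -/(conormal t) addrC addKr dotZl.
  set X := (X in X *: rad _ + _); set Y := (X in _ + X *: ang _ + _).
  set Z := (X in _ + X *: e3).
  suff -> : dot (X *: rad (phi t) + Y *: ang (phi t) + Z *: e3) v = 0 by rewrite mulr0.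
  apply: (@tangent_dot (fun=> X) (fun=> Y) (fun=> Z)) => //.
    have -> : X * rho1 (s t) + Z * z1 (s t) =
      C * k t / rho (s t) ^+ 3 * rho1 (s t) * (rho1 (s t) ^+ 2 + z1 (s t) ^+ 2 - 1)
      - C * k t / rho (s t) ^+ 2 * (rho1 (s t) * rho2 (s t) + z1 (s t) * z2 (s t)).
      by rewrite /X /Z; field.
    by rewrite un u subrr !mulr0 subr0.
  have -> : Y = rho1 (s t) * (rho (s t) ^+ 2 - (k t ^+ 2 + C ^+ 2)) / rho (s t) ^+ 3.
    by rewrite /Y; field.
  by rewrite cl subrr mulr0 mul0r.
split; first by move=> t /=; rewrite in_itv /= => ht; exact: ntan.
exists (fun t => j1 t *: conormal t),
  (fun t => (rho2 (s t) / rho (s t) * j t) *: conormal t); split.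
- exact: cov.
- exact: cov.
move=> t /=; rewrite in_itv /= => ht.
have st := s_dom ht; have rn := r_neq0 ht; have u := unit_speed st.
have cl := clairaut ht.
exists (- rho2 (s t) / rho (s t)).
  exact: (gauss_revolve fr surf drho drho1 dz dz1 rho_gt0 unit_speed revolve_in).
have -> : derive1 spiral t = moving v1 v2 v3 t.
  by rewrite derive1E; case: (der_spiral ht) => _ ->.
have -> : dot (moving v1 v2 v3 t) (moving v1 v2 v3 t) = 1.
  rewrite dot_moving /v1 /v2 /v3.
  have -> : rho1 (s t) * (k t / rho (s t)) * (rho1 (s t) * (k t / rho (s t))) +
    C / rho (s t) * (C / rho (s t)) +
    z1 (s t) * (k t / rho (s t)) * (z1 (s t) * (k t / rho (s t))) =
    ((rho1 (s t) ^+ 2 + z1 (s t) ^+ 2) * k t ^+ 2 + C ^+ 2) / rho (s t) ^+ 2.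
    by field.
  by rewrite u mul1r cl divff ?expf_neq0.
have -> : dot (j t *: conormal t) (moving v1 v2 v3 t) = 0.
  rewrite dotZl dot_moving /v1 /v2 /v3 /n1 /n2 /n3.
  have -> : - (C / rho (s t)) * rho1 (s t) * (rho1 (s t) * (k t / rho (s t))) +
    k t / rho (s t) * (C / rho (s t)) +
    - (C / rho (s t)) * z1 (s t) * (z1 (s t) * (k t / rho (s t))) =
    C * k t / rho (s t) ^+ 2 * (1 - (rho1 (s t) ^+ 2 + z1 (s t) ^+ 2)).
    by field.
  by rewrite u subrr !mulr0.
rewrite scale0r subr0 scale1r scalerA -scalerDl.
have -> : rho2 (s t) / rho (s t) * j t + - rho2 (s t) / rho (s t) * j t = 0 by field.
by rewrite scale0r.
Qed.

End OneGeodesic.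
End RevolutionGeodesics.

(** * Conjugate points from a focusing profile *)

Section FocusingConjugate.
Variable R : realType.

Lemma locally_injective (f df : R -> R) (s : R) (a b : R) : a < s < b ->
  (forall t, a < t < b -> is_derive t 1 f (df t)) ->
  {for s, continuous df} -> df s != 0 ->
  exists2 e, 0 < e & forall t t', s - e < t -> t < t' -> t' < s + e -> f t != f t'.
Proof.
move=> hs hd cdf ds.
have dn : \forall t \near s, df t != 0.
  have ds' : 0 < `|df s| by rewrite normr_gt0.
  have H : \forall t \near s, `|df s - df t| < `|df s|.
    exact: (cvgrPdist_lt _ _).1 cdf _ ds'.
  near=> t; have : `|df s - df t| < `|df s| by near: t.
  by apply: contraTneq => ->; rewrite subr0 ltxx.
have : \forall t \near s, df t != 0 /\ a < t < b.
  near=> t; split; near: t => //; exact: near_itv.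
move=> /nbhs_ballP [e /= e0 he]; exists e => // t t' h1 h2 h3.
have inb x : t <= x <= t' -> df x != 0 /\ a < x < b.
  move=> hx; apply: he; rewrite /ball /= ltr_norml; lra.
have [x|x hx E] := @mvt R f df t t' h2; first by move=> /inb [_]; exact: hd.
rewrite eq_sym -subr_eq0 E mulf_neq0 ?subr_eq0 ?(gt_eqF h2)//.
by have [] := inb x ltac:(lra).
Unshelve. all: by end_near. Qed.

Variables (S : set 'rV[R]_3) (e1 e2 e3 : 'rV[R]_3) (sigma : R).
Variables (rho rho1 rho2 z z1 z2 : R -> R).
Hypothesis fr : frame e1 e2 e3.
Hypothesis surf : surface S.
Hypothesis drho : forall s, - sigma < s < sigma -> is_derive s 1 rho (rho1 s).
Hypothesis drho1 : forall s, - sigma < s < sigma -> is_derive s 1 rho1 (rho2 s).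
Hypothesis dz : forall s, - sigma < s < sigma -> is_derive s 1 z (z1 s).
Hypothesis dz1 : forall s, - sigma < s < sigma -> is_derive s 1 z1 (z2 s).
Hypothesis rho_gt0 : forall s, - sigma < s < sigma -> 0 < rho s.
Hypothesis unit_speed : forall s, - sigma < s < sigma -> rho1 s ^+ 2 + z1 s ^+ 2 = 1.
Hypothesis revolve_in : forall s t, - sigma < s < sigma ->
  S (revolve e1 e2 e3 rho z s t).

(** By unit speed, [rho1] and [z1] do not vanish together, and the coordinate with nonzero
    derivative is injective nearby. *)
Lemma meridian_locally_injective s : - sigma < s < sigma ->
  exists2 e, 0 < e & forall t t', s - e < t -> t < t' -> t' < s + e ->
    ~ (rho t = rho t' /\ z t = z t').
Proof.
move=> hs; have u := unit_speed hs.
have [r0|r0] := eqVneq (rho1 s) 0.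
  have z0 : z1 s != 0.
    by apply: contra_eq_neq u => ->; rewrite r0 expr0n /= addr0 eq_sym oner_neq0.
  have [e e0 he] := locally_injective hs dz (der_cont (dz1 hs)) z0.
  by exists e => // t t' h1 h2 h3 [_ E]; have := he t t' h1 h2 h3; rewrite E eqxx.
have [e e0 he] := locally_injective hs drho (der_cont (drho1 hs)) r0.
by exists e => // t t' h1 h2 h3 [E _]; have := he t t' h1 h2 h3; rewrite E eqxx.
Qed.

Lemma revolve_inj s t s' t' : - sigma < s < sigma -> - sigma < s' < sigma ->
  revolve e1 e2 e3 rho z s t = revolve e1 e2 e3 rho z s' t' ->
  rho s = rho s' /\ z s = z s'.
Proof.
move=> hs hs' E.
have coordE x r : dot (revolve e1 e2 e3 rho z x r) e3 = z x /\
    dot (revolve e1 e2 e3 rho z x r) (revolve e1 e2 e3 rho z x r) = rho x ^+ 2 + z x ^+ 2.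
  have f := radial_frame fr r; rewrite revolve_coords.
  have e3E : e3 = 0 *: radial e1 e2 r + 0 *: angular e1 e2 r + 1 *: e3.
    by rewrite !scale0r !add0r scale1r.
  split; last by rewrite (frame_dotE _ _ _ _ _ _ f); ring.
  by rewrite [X in dot _ X]e3E (frame_dotE _ _ _ _ _ _ f); ring.
have [c1 d1] := coordE s t; have [c2 d2] := coordE s' t'.
have zz : z s = z s' by rewrite -c1 -c2 E.
split=> //; have : rho s ^+ 2 = rho s' ^+ 2.
  by apply: (addIr (z s ^+ 2)); rewrite [in RHS]zz -d1 -d2 E.
move=> /eqP; rewrite eqrXn2 ?ltW ?rho_gt0// => /eqP //.
Qed.

Lemma focusing_conjugate : focusing rho rho1 rho2 sigma -> has_conjugate_points S.
Proof.
move=> [a [b [G [k [j [j1 [x0 [[hab bs] [W0 rgt] fam [hx0 jx0]]]]]]]]].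
have ab : a < b by lra.
set X := Num.sqrt (b - a) in fam hx0.
have X0 : 0 < X by rewrite sqrtr_gt0; lra.
have X2 : X ^+ 2 = b - a by rewrite sqr_sqrtr; lra.
have dom x : - X < x < X -> - sigma < a + x ^+ 2 < sigma.
  rewrite -ltr_norml => hx; have : `|x| ^+ 2 < X ^+ 2.
    by rewrite ltr_pXn2r// nnegrE ltW.
  by rewrite real_normK ?num_real//; have := sqr_ge0 x; rewrite X2; lra.
have [xs hxs_ zeros] := focusing_zeros fam W0 hx0 jx0.
have hxs : 0 < xs < X := hxs_.
have xsX : - X < xs < X by lra.
have [e0 e00 inj] := meridian_locally_injective (dom xs xsX).
(* As [|x ^+ 2 - xs ^+ 2| < e * (2 * X)], the first bound keeps [a + x ^+ 2] where the profile is
   injective. The second keeps [x2] below [X1], in the range of the time change. *)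
pose e := Num.min (e0 / (4 * X)) ((X - xs) / 2).
have [ee1 ee2 ee3] : [/\ 0 < e, e * (4 * X) <= e0 & e <= (X - xs) / 2].
  split.
  - by rewrite lt_min !divr_gt0 ?mulr_gt0 ?subr_gt0//; lra.
  - by rewrite -ler_pdivlMr ?mulr_gt0// ge_min lexx.
  - by rewrite ge_min lexx orbT.
have [x1 [x2 [eps [hx1 hx2_ [x1e x2e] jx2 jx1]]]] := zeros e ee1.
have hx2 : xs < x2 < X := hx2_.
have close x : 0 < x < X -> xs - e < x -> x < xs + e ->
    a + xs ^+ 2 - e0 < a + x ^+ 2 /\ a + x ^+ 2 < a + xs ^+ 2 + e0.
  move=> hx h1 h2; have h3 : `|(x - xs) * (x + xs)| < e * (2 * X).
    rewrite normrM ltr_pM//; first by rewrite ltr_norml; lra.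
    by rewrite gtr0_norm; lra.
  have h4 : (x - xs) * (x + xs) = x ^+ 2 - xs ^+ 2 by ring.
  by move: h3; rewrite h4 ltr_norml; lra.
pose X1 := (xs + X) / 2; have hX1 : 0 < X1 < X by rewrite /X1; lra.
have [T1 [T2 [y [yP yS]]]] := time_change hX1 (tf_Gc fam) (tf_G0 fam) (tf_Ge fam).
pose C := rho a.
(* The derivative of the angle in the coordinate [x], that is, [phi' * dt/dx]. *)
pose h x := C / rho (a + x ^+ 2) ^+ 2 * G x.
have dSx (x : R) : is_derive x (1 : R) (fun x => a + x ^+ 2) (2 * x).
  apply: der_eq (derD (derC a x 1) (derM (derI x) (derI x))) _.
  by rewrite add0r mul1r mulr1; ring.
have drs x : - X < x < X ->
    is_derive x 1 (fun x => rho (a + x ^+ 2)) (rho1 (a + x ^+ 2) * (2 * x)).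
  by move=> hx; exact: (der_comp (f := rho) (g := fun x => a + x ^+ 2) (drho (dom x hx)) (dSx x)).
have rn x : - X < x < X -> rho (a + x ^+ 2) != 0.
  by move=> hx; rewrite gt_eqF// rho_gt0// dom.
have ch x : - X < x < X -> {for x, continuous h}.
  move=> hx; apply: continuousM; last exact: (tf_Gc fam).
  have r2 : rho (a + x ^+ 2) * rho (a + x ^+ 2) != 0 by rewrite mulf_neq0 ?rn.
  have c := der_cont (der_div (g := fun x => rho (a + x ^+ 2) * rho (a + x ^+ 2))
    r2 (derC C x 1) (derM (drs x hx) (drs x hx))).
  have -> : (fun x => C / rho (a + x ^+ 2) ^+ 2) =
      (fun x => C / (rho (a + x ^+ 2) * rho (a + x ^+ 2))).
    by apply/funext => u; rewrite expr2.
  exact: c.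
have [|Phi [dPhi _]] := primitive_odd X0 ch.
  by move=> x; rewrite /h sqrrN (tf_Ge fam).
pose s t := a + y t ^+ 2; pose phi t := Phi (y t); pose kk t := k (y t).
pose jj t := j (y t) + eps * k (y t).
pose jj1 t := j1 (y t) + eps * rho1 (s t).
have yX t : T1 < t < T2 -> - X < y t < X by move=> /yP [hy _]; lra.
have dy t : T1 < t < T2 -> is_derive t 1 y (G (y t))^-1 by move=> /yP [].
have Gn t : T1 < t < T2 -> G (y t) != 0 by move=> /yX/(tf_G0 fam)/lt0r_neq0.
have s_dom t : T1 < t < T2 -> - sigma < s t < sigma by move=> /yX/dom.
have rsn t : T1 < t < T2 -> rho (s t) != 0 by move=> /yX/rn.
have ds t : T1 < t < T2 -> is_derive t 1 s (kk t / rho (s t)).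
  move=> ht; apply: der_eq (der_comp (f := fun x => a + x ^+ 2) (dSx (y t)) (dy t ht)) _.
  have E := tf_Gk fam (yX t ht).
  apply: (mulIf (rsn t ht)); rewrite divfK ?rsn//.
  by apply: (mulfI (Gn t ht)); rewrite /kk E /s; field; exact: Gn.
have dphi t : T1 < t < T2 -> is_derive t 1 phi (C / rho (s t) ^+ 2).
  move=> ht; apply: der_eq (der_comp (dPhi _ (yX t ht)) (dy t ht)) _.
  by rewrite /h -mulrA divff ?mulr1// Gn.
have dk t : T1 < t < T2 -> is_derive t 1 kk (rho1 (s t)).
  move=> ht; apply: der_eq (der_comp (tf_dk fam (yX t ht)) (dy t ht)) _.
  by rewrite mulrAC divff ?mul1r// Gn.
have cl t : T1 < t < T2 -> kk t ^+ 2 + C ^+ 2 = rho (s t) ^+ 2.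
  by move=> ht; rewrite /kk (tf_k2 fam (yX t ht)) subrK.
have djj t : T1 < t < T2 -> is_derive t 1 jj (jj1 t).
  move=> ht; have d1 := der_comp (tf_dj fam (yX t ht)) (dy t ht).
  apply: der_eq (derD d1 (derM (derC eps t 1) (dk t ht))) _.
  by rewrite mulrAC divff ?Gn// mul1r mul0r add0r.
have djj1 t : T1 < t < T2 -> is_derive t 1 jj1 (rho2 (s t) / rho (s t) * jj t).
  move=> ht; have d1 := der_comp (tf_dj1 fam (yX t ht)) (dy t ht).
  have d2 := der_comp (drho1 (s_dom t ht)) (ds t ht).
  apply: der_eq (derD d1 (derM (derC eps t 1) d2)) _.
  rewrite mul0r add0r mulrAC divff ?Gn// mul1r -/(s t) /jj /kk; field; exact: rsn.
have [tm htm ytm] := yS (- x1) ltac:(rewrite /X1; lra).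
have [tp htp ytp] := yS x2 ltac:(rewrite /X1; lra).
have [t0 ht0 yt0] := yS 0 ltac:(rewrite /X1; lra).
exists [set` `]T1, T2[], (spiral e1 e2 e3 rho z s phi), tm, tp; split.
- by split; [exact: interval_open|exact: interval_is_interval].
- exact: (spiral_geodesic fr surf drho drho1 dz dz1 rho_gt0 unit_speed revolve_in
    s_dom ds dphi dk cl).
- by split; rewrite /= in_itv.
- apply/negP => /eqP E.
  have [r_eq z_eq] := revolve_inj (s_dom _ htm) (s_dom _ htp) E.
  move: r_eq z_eq; rewrite /s ytm ytp sqrrN => r_eq z_eq.
  have hx1' : 0 < x1 < X by lra.
  have hx2' : 0 < x2 < X by lra.
  have [c1 _] := close x1 hx1' ltac:(lra) ltac:(lra).
  have [_ c2] := close x2 hx2' ltac:(lra) ltac:(lra).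
  apply: (inj _ _ c1 _ c2 (conj r_eq z_eq)).
  by rewrite ltrD2l ltr_pXn2r // ?nnegrE; lra.
exists (fun t => jj t *: conormal e1 e2 e3 rho rho1 z1 C s phi kk t); split.
- exact: (spiral_jacobi fr surf drho drho1 dz dz1 rho_gt0 unit_speed revolve_in
    s_dom ds dphi dk cl djj djj1).
- exists t0; first by rewrite /= in_itv.
  have k00 : k 0 = 0.
    by apply/eqP; have := tf_ko fam 0; rewrite oppr0 => /eqP; rewrite -addr_eq0 -mulr2n mulrn_eq0.
  have n1 := conormal_unit fr rho_gt0 unit_speed phi s_dom cl ht0.
  rewrite /jj yt0 (tf_j0 fam) k00 mulr0 addr0 scale1r.
  by apply: contra_eq_neq n1 => ->; rewrite dot0l eq_sym oner_neq0.
- have hx1X : - X < x1 < X by lra.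
  by rewrite /jj ytm (tf_je fam hx1X) (tf_ko fam) mulrN jx1 scale0r.
- by rewrite /jj ytp jx2 scale0r.
Qed.

End FocusingConjugate.

(** * The rim of an obstacle *)

Section Rim.
Variable R : realType.
Implicit Types (S A : set 'rV[R]_3) (p q c : 'rV[R]_3).

Lemma collar_refl S A (d : R) p : S p -> A p -> 0 < d -> collar S A d p.
Proof.
move=> Sp Ap d0; split=> //; pose g (t : R) := p.
have dg (t : R) : is_derive t (1 : R) g 0 by exact: derC.
have g1E : derive1 g = (fun=> 0) by apply/funext => t; exact: der_derive1 (dg t).
have gC : C1_path S p p g.
  by split=> //; rewrite g1E; exact: cst_continuous.
have L : path_length g = 0%E.
  rewrite /path_length g1E; under eq_integral do rewrite /enorm dot0l sqrtr0.
  by rewrite integral0.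
apply: (@le_lt_trans _ _ 0%E); last by rewrite lte_fin.
apply: (@le_trans _ _ (surface_dist S p p)).
  by apply: ereal_inf_lbound; exists p.
by rewrite -L; apply: ereal_inf_lbound; exists g.
Qed.

Lemma der_min0 (h : R -> R) (x l : R) : is_derive x 1 h l ->
  (\forall y \near x, h x <= h y) -> l = 0.
Proof.
move=> dh hn; have dhN := derN dh.
have far : ~ exists y, h y < h x /\ h x <= h y by move=> [y []]; lra.
apply: contrapT => /eqP; rewrite neq_lt => /orP[l0|l0].
  have l0' : 0 < - l by lra.
  have h1 := der_gt0_right dhN l0'.
  have h2 : \forall y \near x^'+, h x <= h y by apply: cvg_within; exact: hn.
  have [||y _ [h3 h4]] := @near_right_ex R (fun y => - h x < - h y /\ h x <= h y) x (x + 1).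
  - lra.
  - exact: (filterI h1 h2).
  lra.
have l0' : - l < 0 by lra.
have h1 := der_gt0_left dhN l0'.
have h2 : \forall y \near x^'-, h x <= h y by apply: cvg_within; exact: hn.
have [||y _ [h3 h4]] := @near_left_ex R (fun y => - h x < - h y /\ h x <= h y) x (x - 1).
- lra.
- exact: (filterI h1 h2).
lra.
Qed.

Lemma chart_in S U f u : parametrization S U f -> U u -> S (f u).
Proof.
move=> [oU _ _ _ fo] Uu; have [W oW fW] := fo U oU (@subset_refl _ _).
by have : (S `&` W) (f u) by [rewrite -fW; exists u]; case.
Qed.

Lemma chart_line S U f u w : parametrization S U f -> U u ->
  (\forall t \near (0 : R), U (t *: w + u)) /\
  is_derive (0 : R) 1 (fun t => f (t *: w + u)) ('D_w f u).
Proof.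
move=> pf Uu; have [oU _ _ _ _] := pf.
have d1 := der_scale (derI (0 : R)) (derC w (0 : R) 1).
have dl : is_derive (0 : R) (1 : R) (fun t : R => t *: w + u) w.
  by apply: der_eq (derD d1 (derC u (0 : R) 1)) _; rewrite scaler0 !addr0 scale1r.
have E : 0 *: w + u = u by rewrite scale0r add0r.
split.
  by apply: (der_cont dl); rewrite E; exact: open_nbhs_nbhs.
rewrite -[in X in is_derive _ _ _ X]E; apply: (der_diff (y := fun t => t *: w + u)) => //.
by rewrite E; exact: chart_diff pf _ Uu.
Qed.

(** Some direction [w] of the chart leaves [p0] within the plane of [e1] and [e3]. As the surface
    stays outside the cone over the obstacle, [h] has a minimum at [p0] along the corresponding
    curve. Its zero derivative makes the velocity tangent to the cone, hence a multiple of [p0]. *)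
Lemma radial_tangent S (e1 e2 e3 : 'rV[R]_3) (sr cr : R) :
  frame e1 e2 e3 -> surface S -> 0 < sr -> 0 < cr -> sr ^+ 2 + cr ^+ 2 = 1 ->
  let p0 := sr *: e1 + cr *: e3 in
  S p0 -> tangent S p0 e2 ->
  (forall q, S q -> dot e3 q <= cr * enorm q) -> tangent S p0 p0.
Proof.
move=> fr surf sr0 cr0 srcr p0 Sp0 te2 out.
have [U [f [u [pf Uu fu]]]] := surf _ Sp0.
have [b Db] : exists b, 'D_b f u = e2 by apply: (tangent_in_chart pf Uu); rewrite fu.
have df := chart_diff pf Uu; have [_ _ finj _ _] := pf.
pose f0 := 'D_(delta_mx ord0 0) f u; pose f1 := 'D_(delta_mx ord0 1) f u.
(* The coefficients cancel the component along [e2]; they are not both 0 because [e2] is itself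
   tangent. *)
pose w : 'rV[R]_2 := dot f1 e2 *: delta_mx ord0 0 + (- dot f0 e2) *: delta_mx ord0 1.
have Dw : 'D_w f u = dot f1 e2 *: f0 + (- dot f0 e2) *: f1 by exact: derive_lin.
have be2 : dot e2 e2 = b ord0 0 * dot f0 e2 + b ord0 1 * dot f1 e2.
  by rewrite -{1}Db {1}(rV2_expand b); exact: dot_derive_lin.
clearbody f0 f1.
have we2 : dot ('D_w f u) e2 = 0 by rewrite Dw dot_comb mulrC mulNr subrr.
have wn0 : w != 0.
  apply/negP => /eqP w0.
  have h0 := congr1 (fun v : 'rV[R]_2 => v ord0 0) w0.
  have h1 := congr1 (fun v : 'rV[R]_2 => v ord0 1) w0.
  move: h0 h1; rewrite !mxE !eqxx /= !(mulr0, mulr1, addr0, add0r) => h1 h0.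
  have {}h0 : dot f0 e2 = 0 by rewrite -[LHS]opprK h0 oppr0.
  by move: be2; rewrite h0 h1 (fr22 fr) !mulr0 addr0 => /eqP; rewrite oner_eq0.
set v := 'D_w f u in Dw we2.
have vn0 : v != 0 by apply: contra_neq wn0; exact: finj.
have [Ul dl] := chart_line w pf Uu.
pose x (t : R) := f (t *: w + u).
have x0 : x 0 = p0 by rewrite /x scale0r add0r.
have e3p0 : dot e3 p0 = cr.
  by rewrite /p0 dotDr !dotZr (dotC e3 e1) (fr13 fr) (fr33 fr); ring.
(* The cone condition, squared to be differentiable; squaring is legitimate near [p0], where the
   product with [e3] is positive. *)
pose h t := cr ^+ 2 * dot (x t) (x t) - dot (x t) e3 * dot (x t) e3.
have dh := derB (derM (derC (cr ^+ 2) (0 : R) 1) (der_dot dl dl))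
  (derM (der_dot dl (derC e3 (0 : R) 1)) (der_dot dl (derC e3 (0 : R) 1))).
have p0p0 : dot p0 p0 = 1.
  rewrite {2}/p0 dotDr !dotZr (dotC p0 e3) e3p0 /p0 dotDl !dotZl (dotC e3 e1).
  by rewrite (fr11 fr) (fr13 fr) mulr0 addr0 mulr1 -!expr2.
have h0 : h 0 = 0 by rewrite /h x0 (dotC p0 e3) e3p0 p0p0; ring.
have pos : \forall t \near (0 : R), 0 < dot (x t) e3.
  have c : {for (0 : R), continuous (fun t => dot (x t) e3)}.
    by apply: cont_dot; [exact: der_cont dl|exact: cst_continuous].
  by apply: (cvgr_gt _ c); rewrite x0 dotC e3p0.
have hmin : \forall t \near (0 : R), h 0 <= h t.
  near=> t; rewrite h0 subr_ge0 -!expr2 -enorm_sqr -exprMn.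
  have Ut : U (t *: w + u) by near: t.
  have p : 0 < dot (x t) e3 by near: t.
  rewrite ler_pXn2r ?nnegrE ?(ltW p) ?mulr_ge0 ?enorm_ge0 ?(ltW cr0)//.
  by rewrite dotC; apply: out; exact: (chart_in pf Ut).
have := der_min0 dh hmin; rewrite -/(x 0) x0 dot0r !addr0 mul0r add0r.
rewrite -/v (dotC p0 v) (dotC p0 e3) e3p0.
have vE := frame_expand fr v; rewrite we2 scale0r addr0 in vE.
pose v1 := dot v e1; pose v3 := dot v e3.
have vp0 : dot v p0 = sr * v1 + cr * v3 by rewrite /p0 dotDr !dotZr.
rewrite vp0 -/v3 => E.
have cv : cr * v1 = sr * v3.
  have E1 : cr ^+ 2 * (sr * v1 + cr * v3) = cr * v3 by lra.
  have E2 : cr * (sr * v1 + cr * v3) = v3.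
    by apply: (mulfI (lt0r_neq0 cr0)); rewrite -[RHS]E1; ring.
  apply: (mulfI (lt0r_neq0 sr0)).
  transitivity (cr * (sr * v1 + cr * v3) - cr ^+ 2 * v3); first by ring.
  transitivity ((sr ^+ 2 + cr ^+ 2) * v3 - cr ^+ 2 * v3); last by ring.
  by rewrite E2 srcr mul1r.
pose kap := sr * v1 + cr * v3.
have vk : v = kap *: p0.
  rewrite vE -/v1 -/v3 /p0 scalerDr !scalerA /kap; congr (_ *: _ + _ *: _).
    transitivity (sr ^+ 2 * v1 + cr * (sr * v3)); last by ring.
    by rewrite -cv -{1}[v1]mul1r -srcr; ring.
  transitivity (sr * (cr * v1) + cr ^+ 2 * v3); last by ring.
  by rewrite cv -{1}[v3]mul1r -srcr; ring.
have kn : kap != 0 by apply: contra_neq vn0 => k0; rewrite vk k0 scale0r.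
exists U, f, u, (kap^-1 *: w); split=> //.
by rewrite (derive_scale _ df (erefl v)) vk scalerA mulVf// scale1r.
Unshelve. all: by end_near. Qed.

Lemma rV_norm_le_enorm (u : 'rV[R]_3) : `|u| <= enorm u.
Proof.
rewrite [leLHS]/Num.Def.normr/= mx_normrE; apply: bigmax_le => /=.
  exact: enorm_ge0.
move=> [i j] _ /=; rewrite -(ler_pXn2r (n := 2)) ?nnegrE ?enorm_ge0//.
rewrite real_normK ?num_real// enorm_sqr /dot (bigD1 j) //= ord1 expr2 lerDl.
by apply: sumr_ge0 => k _; rewrite -expr2 sqr_ge0.
Qed.

(** [p] lies outside the other closed disks, which are finite in number, so all small enough [e]
    work for all of them. *)
Lemma rims_separated n (c : 'I_n.+1 -> 'rV[R]_3) (r : 'I_n.+1 -> R) i p :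
  circular_obstacles c r -> disk_boundary (c i) (r i) p ->
  exists2 e, 0 < e & forall j, j != i -> forall q,
    disk_boundary (c j) (r j) q -> e <= enorm (p - q).
Proof.
move=> [_ _ disj] [clp _].
have sep j : \forall e \near (0 : R)^'+, j != i -> forall q,
    disk_boundary (c j) (r j) q -> e <= enorm (p - q).
  have [->|ji] := eqVneq j i; first by near=> e; rewrite ?eqxx.
  have npj : ~ closure (sphere_disk (c j) (r j)) p.
    move=> h; have := disj i j; rewrite eq_sym ji => /(_ isT) E.
    by have : set0 p by rewrite -E.
  have [B [Bp Be]] : exists B, nbhs p B /\ ~ (sphere_disk (c j) (r j) `&` B !=set0).
    by move: npj => /existsNP[B /not_implyP [Bp Be]]; exists B.
  have [e0 /= e00 he] := (nbhs_ballP _ _).1 Bp.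
  have small : \forall e \near (0 : R)^'+, e < e0 by exact: nbhs_right_lt.
  near=> e => _ q [clq _]; rewrite leNgt; apply/negP => h.
  have pq : ball p e0 q.
    rewrite -ball_normE /=; apply: (le_lt_trans (rV_norm_le_enorm _)).
    by apply: lt_trans h _; near: e.
  have : nbhs q (ball p e0) by apply: open_nbhs_nbhs; split=> //; exact: ball_open.
  move=> /clq [x [hx bx]]; apply: Be; exists x; split=> //; exact: he.
have := filter_forall _ sep => hall.
near ((0 : R)^'+) => e; exists e; first by near: e; exact: nbhs_right_gt.
by near: e; exact: hall.
Unshelve. all: by end_near. Qed.

(** [q] and [w] stand for a position and a velocity on the sphere, [p] and [t] for those on the
    surface. Since [enorm w <= 2], the product [dot p t] differs from [dot q w = 0] by at most
    [e + 2 * e]. *)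
Lemma near_unit_vector (p q t w : 'rV[R]_3) e : 0 < e -> e <= 1 / 2 ->
  enorm q = 1 -> enorm t = 1 -> dot q w = 0 ->
  enorm (p - q) <= e -> enorm (t - w) <= e * enorm w ->
  dot p p <= (1 + e) ^+ 2 /\ `|dot p t| <= 3 * e.
Proof.
move=> e0 e1 q1 t1 qw pq tw.
have wle : enorm w <= 2.
  have : enorm w <= enorm t + enorm (t - w).
    by rewrite (enormB w t) addrC -{1}[w](subrK t); exact: enormD.
  by have := enorm_ge0 w; rewrite t1; nra.
split.
  rewrite -enorm_sqr ler_pXn2r ?nnegrE ?enorm_ge0//; last lra.
  rewrite -[p](subrK q); apply: (le_trans (enormD _ _)); rewrite q1; lra.
have -> : dot p t = dot (p - q) t + dot q (t - w).
  by rewrite !(dotDl, dotDr, dotNl, dotNr) qw; ring.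
apply: (le_trans (ler_normD _ _)).
have h1 := cauchy_schwarz (p - q) t; have h2 := cauchy_schwarz q (t - w).
by rewrite t1 in h1; rewrite q1 in h2; nra.
Qed.

Lemma close_to_sphere S U f1 f2 u e v :
  parametrization S U f1 -> parametrization (@sphere R) U f2 -> U u ->
  C2_dist_le e f1 f2 u -> 0 < e -> e <= 1 / 2 -> enorm ('D_v f1 u) = 1 ->
  dot (f1 u) (f1 u) <= (1 + e) ^+ 2 /\ `|dot (f1 u) ('D_v f1 u)| <= 3 * e.
Proof.
move=> pf1 pf2 Uu [c0 c1 _] e0 e1 v1.
apply: (near_unit_vector e0 e1 (chart_in pf2 Uu) v1 _ c0 (c1 v)).
have [Ul dl] := chart_line v pf2 Uu.
have d := der_dot dl dl; rewrite scale0r add0r in d.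
have d0 : is_derive (0 : R) 1 (fun t => dot (f2 (t *: v + u)) (f2 (t *: v + u))) 0.
  apply: der_near (derC (1 : R) (0 : R) 1); near=> s.
  have : sphere (f2 (s *: v + u)) by apply: (chart_in pf2); near: s.
  by rewrite -enorm_sqr /sphere /= => ->; rewrite expr1n.
have := der_uniq d d0; rewrite (dotC ('D_v f2 u)); move: (dot _ _) => x; lra.
Unshelve. all: by end_near. Qed.

End Rim.

(** * From the meridian geodesic to its profile *)

Section MeridianConjugate.
Variable R : realType.
Variables (Sigma A : set 'rV[R]_3) (e1 e2 e3 : 'rV[R]_3) (delta sr cr sigma d : R).
Variable gam : R -> 'rV[R]_3.
Hypothesis fr : frame e1 e2 e3.
Hypothesis surf : surface Sigma.
Hypothesis rotA : rotation_invariant e3 (collar Sigma A delta).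
Hypothesis sigma0 : 0 < sigma.
Hypothesis sigma_delta : sigma <= delta.
Hypothesis sigma_sr : sigma <= sr.
Hypothesis cr0 : 0 < cr.
Hypothesis srcr : sr ^+ 2 + cr ^+ 2 = 1.
Let p0 := sr *: e1 + cr *: e3.
Hypothesis Ap0 : A p0.
Hypothesis gam_geo : geodesic Sigma setT gam.
Hypothesis gam0 : gam 0 = p0.
Hypothesis dgam0 : derive1 gam 0 = p0.
Hypothesis d0 : 0 < d.
Hypothesis d_sr : d <= sr / 12.
Hypothesis d_sigma : 2 * d / Num.min sr cr <= sigma / 16.
Hypothesis d_eta : 16 * d * expR (2 / (sr ^+ 2 / 128)) < sigma.
Hypothesis A_rim : forall p, A p -> dot p p = 1 /\ dot p e3 = cr.
Hypothesis far_spherical : forall s, 0 <= s < sigma ->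
  (forall p, A p -> d <= enorm (gam s - p)) ->
  dot (gam s) (gam s) <= (1 + d) ^+ 2 /\ `|dot (gam s) (derive1 gam s)| <= 3 * d.

Let dgam := meridian_der gam_geo.
Let dgam1 := meridian_der1 gam_geo.
Let speed1 t : enorm (derive1 gam t) = 1.
Proof. exact: meridian_unit_speed fr surf srcr gam_geo dgam0 t. Qed.

Let dcoord e (s : R) :
  is_derive s (1 : R) (fun s => dot (gam s) e) (dot (derive1 gam s) e).
Proof. by apply: der_eq (der_dot (dgam s) (derC e s 1)) _; rewrite dot0r addr0. Qed.

Let dcoord1 e (s : R) :
  is_derive s (1 : R) (fun s => dot (derive1 gam s) e) (dot (derive1 (derive1 gam) s) e).
Proof. by apply: der_eq (der_dot (dgam1 s) (derC e s 1)) _; rewrite dot0r addr0. Qed.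

Let coord_lip e s : dot e e = 1 -> 0 <= s -> `|dot (gam s) e - dot (gam 0) e| <= s.
Proof.
move=> ee; rewrite le_eqVlt => /predU1P[<-|s0]; first by rewrite subrr normr0.
have [u _ ->] := mvt s0 (fun t _ => dcoord e t).
rewrite subr0 normrM (gtr0_norm s0) ler_piMl ?(ltW s0)//.
by apply: (le_trans (cauchy_schwarz _ _)); rewrite speed1 mul1r /enorm ee sqrtr1.
Qed.

Let sr0 : 0 < sr. Proof. exact: lt_le_trans sigma0 sigma_sr. Qed.
Let delta0 : 0 < delta. Proof. exact: lt_le_trans sigma0 sigma_delta. Qed.

Let sr1 : sr <= 1.
Proof. by have := sqr_ge0 cr; have := srcr; have := sr0; nra. Qed.

Let cr1 : cr <= 1.
Proof. by have := sqr_ge0 sr; have := srcr; have := cr0; nra. Qed.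

Let planar s : - sigma < s < sigma -> dot (gam s) e2 = 0.
Proof.
move=> hs; apply: (meridian_planar fr surf rotA delta0 sr0 srcr Ap0 gam_geo gam0 dgam0).
apply: (@lt_le_trans _ _ sigma); first by rewrite ltr_norml.
by rewrite le_min sigma_delta.
Qed.

Let planar1 s : - sigma < s < sigma -> dot (derive1 gam s) e2 = 0.
Proof.
move=> hs; apply: (der_uniq (dcoord e2 s)); apply: der_near (derC (0 : R) s 1).
by near=> t; rewrite planar//; near: t; exact: near_itv hs.
Unshelve. all: by end_near. Qed.

Let p0e e : dot p0 e = sr * dot e1 e + cr * dot e3 e.
Proof. exact: dot_comb. Qed.

Lemma meridian_chord s : 0 <= s -> enorm (gam s - p0) <= s.
Proof.
rewrite le_eqVlt => /predU1P[<-|s0]; first by rewrite gam0 subrr /enorm dot0l sqrtr0.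
set w := gam s - p0; have [->|w0] := eqVneq (enorm w) 0; first exact: ltW.
have wp : 0 < enorm w by rewrite lt_def w0 enorm_ge0.
have [u _ E] := mvt s0 (fun t _ => dcoord w t).
rewrite -(ler_pM2l wp) -expr2 enorm_sqr {1}/w dotDl dotNl -gam0 E subr0 ler_pM2r//.
apply: (le_trans (ler_norm _)); apply: (le_trans (cauchy_schwarz _ _)).
by rewrite speed1 mul1r.
Qed.

Lemma meridian_conjugate : has_conjugate_points Sigma.
Proof.
pose rho s := dot (gam s) e1; pose z s := dot (gam s) e3.
pose rho1 s := dot (derive1 gam s) e1; pose z1 s := dot (derive1 gam s) e3.
pose rho2 s := dot (derive1 (derive1 gam) s) e1.
pose z2 s := dot (derive1 (derive1 gam) s) e3.
have s0 := sigma0; have ss := sigma_sr; have s1 := sr1.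
have dom s : 0 <= s < sigma -> - sigma < s < sigma by lra.
have dr (s : R) : - sigma < s < sigma -> is_derive s 1 rho (rho1 s) by move=> _; exact: dcoord.
have dr1 (s : R) : - sigma < s < sigma -> is_derive s 1 rho1 (rho2 s) by move=> _; exact: dcoord1.
have dz (s : R) : - sigma < s < sigma -> is_derive s 1 z (z1 s) by move=> _; exact: dcoord.
have dz1 (s : R) : - sigma < s < sigma -> is_derive s 1 z1 (z2 s) by move=> _; exact: dcoord1.
have gE s : - sigma < s < sigma -> gam s = rho s *: e1 + z s *: e3.
  by move=> hs; rewrite [LHS](frame_expand fr) planar// scale0r addr0.
have g1E s : - sigma < s < sigma -> derive1 gam s = rho1 s *: e1 + z1 s *: e3.
  by move=> hs; rewrite [LHS](frame_expand fr) planar1// scale0r addr0.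
have comb (a b x y : R) : dot (a *: e1 + b *: e3) (x *: e1 + y *: e3) = a * x + b * y.
  rewrite dot_comb !dotDr !dotZr (dotC e3 e1) (fr11 fr) (fr13 fr) (fr33 fr); ring.
have unit s : - sigma < s < sigma -> rho1 s ^+ 2 + z1 s ^+ 2 = 1.
  by move=> hs; rewrite !expr2 -comb -g1E// -enorm_sqr speed1 expr1n.
have r0 s : - sigma < s < sigma -> 0 < rho s.
  move=> hs; apply: (meridian_off_axis fr surf srcr gam_geo gam0 dgam0).
  by rewrite subr_gt0 (lt_le_trans _ ss)// ltr_norml.
have rin s t : - sigma < s < sigma -> Sigma (revolve e1 e2 e3 rho z s t).
  move=> hs; have hsd : `|s| < delta by rewrite (lt_le_trans _ sigma_delta)// ltr_norml.
  have := meridian_collar fr surf srcr Ap0 gam_geo gam0 dgam0 hsd.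
  move=> /(rotation_orbit fr t rotA) [+ _].
  by rewrite planar// !mul0r subr0 addr0 /revolve /radial scalerDr !scalerA.
have c2 := rho2_continuous fr surf dr dr1 dz dz1 r0 unit rin.
apply: (focusing_conjugate fr surf dr dr1 dz dz1 r0 unit rin).
have p1 : dot p0 e1 = sr by rewrite p0e (fr11 fr) (dotC e3) (fr13 fr); ring.
have p3 : dot p0 e3 = cr by rewrite p0e (fr33 fr) (fr13 fr); ring.
apply: (@profile_focusing R sigma d sr cr rho rho1 rho2 z z1) => //.
- by move=> s /dom; exact: dr.
- by move=> s /dom; exact: dr1.
- by move=> s /dom; exact: c2.
- by move=> s /dom; exact: dz.
- by move=> s /dom /dz1; exact: der_cont.
- by move=> s /dom; exact: unit.
- move=> s hs; rewrite r0 ?dom//=; have /andP[h0 h1] := hs.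
  have := coord_lip (fr11 fr) h0; rewrite gam0 p1 ler_norml -/(rho s); lra.
- move=> s hs; have /andP[h0 h1] := hs; have := coord_lip (fr33 fr) h0.
  have c1 := cr1; have c0 := cr0.
  by rewrite gam0 p3 !ler_norml -/(z s); lra.
- by rewrite /rho gam0.
- by rewrite /z gam0.
- by rewrite /rho1 dgam0.
- by rewrite /z1 dgam0.
- move=> s hs h; have hs' := dom _ hs.
  (* [p0] is the rim point nearest to [gam s], because [rho s > 0] and [dot p e1 <= sr]; being far
     from [p0] is thus being far from the whole rim. *)
  have far p : A p -> d <= enorm (gam s - p).
    move=> /A_rim [pp pe]; rewrite -(ler_pXn2r (n := 2)) ?nnegrE ?enorm_ge0 ?(ltW d0)//.
    apply: (le_trans h); rewrite enorm_sqr.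
    have -> : dot (gam s - p) (gam s - p) = dot (gam s) (gam s) - 2 * dot (gam s) p + dot p p.
      by rewrite !(dotDl, dotDr, dotNl, dotNr) (dotC p); ring.
    have ple : dot p e1 <= sr.
      have : dot p p = dot p e1 ^+ 2 + dot p e2 ^+ 2 + dot p e3 ^+ 2.
        by rewrite {2}(frame_expand fr p) !(dotDr, dotZr) -!expr2.
      rewrite pp pe => E; have := sqr_ge0 (dot p e2); have := srcr => E1 E2.
      apply: (le_trans (ler_norm _)).
      by rewrite -(ler_pXn2r (n := 2)) ?nnegrE ?(ltW sr0)// real_normK ?num_real//; lra.
    have -> : dot (gam s) p = rho s * dot p e1 + z s * cr.
      by rewrite {1}(gE _ hs') dot_comb (dotC e1) (dotC e3) pe.
    rewrite pp (gE _ hs') comb -!expr2 -/(rho s) -/(z s).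
    have : rho s * dot p e1 <= rho s * sr by rewrite ler_pM2l// r0.
    by have := srcr; nra.
  have := far_spherical hs far.
  by rewrite (gE _ (dom _ hs)) (g1E _ (dom _ hs)) !comb -!expr2.
Unshelve. all: by end_near. Qed.

End MeridianConjugate.

Lemma small_gap (R : realType) (mu eta sigma b : R) :
  0 < mu -> 0 < sigma -> 0 < b -> exists d, [/\ 0 < d, d <= b,
    2 * d / mu <= sigma / 16 & 16 * d * expR (2 / eta) < sigma].
Proof.
move=> mu0 s0 b0; have E0 := expR_gt0 (2 / eta); set E := expR _ in E0 *.
exists (Num.min b (Num.min (mu * sigma / 32) (sigma / (32 * E)))).
set d := Num.min _ _; have [h1 [h2 h3]] : d <= b /\ d <= mu * sigma / 32 /\ d <= sigma / (32 * E).
  by rewrite !ge_min !lexx !orbT.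
split=> //.
- by rewrite !lt_min b0 /= !divr_gt0 ?mulr_gt0.
- by rewrite ler_pdivrMr//; lra.
- by move: h3; rewrite ler_pdivlMr ?mulr_gt0// => h3; lra.
Qed.

Lemma billiard_shadow (R : realType) n (c : 'I_n -> 'rV[R]_3) r Sigma i q :
  circular_obstacles c r -> ~ Sigma 0 -> @radial_proj R @` Sigma = billiard c r ->
  Sigma q -> dot (c i) q <= cos (r i) * enorm q.
Proof.
move=> [c1 hr _] n0 proj Sq.
have q0 : 0 < enorm q.
  rewrite lt_def enorm_ge0 andbT; apply/negP => /eqP h; apply: n0.
  by rewrite -(@dot_eq0 _ q) // -enorm_sqr h expr0n.
have [pq1 nd] : billiard c r (radial_proj q) by rewrite -proj; exists q.
have pi0 := pi_gt0 R; have ri := hr i.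
have := dot_unit_bound (c1 i) pq1; set x := dot _ _ => hx.
have xr : x <= cos (r i).
  rewrite leNgt -(acos_lt hx); last lra.
  by apply/negP => h; apply: nd; exists i.
by move: xr; rewrite /x /radial_proj dotZr mulrC ler_pdivrMr.
Qed.

(** The orbit of [p0] is a circle of radius [sr] in the collar, hence on the surface; dividing the
    angle by [sr] gives it the velocity [e2] at [p0]. *)
Lemma rim_orbit_tangent (R : realType) (Sigma A : set 'rV[R]_3) (e1 e2 e3 : 'rV[R]_3)
    (delta sr cr : R) : let p0 := sr *: e1 + cr *: e3 in
  frame e1 e2 e3 -> surface Sigma -> rotation_invariant e3 (collar Sigma A delta) ->
  0 < delta -> 0 < sr -> Sigma p0 -> A p0 -> tangent Sigma p0 e2.
Proof.
move=> p0 fr surf rotA de0 sr0 Sp0 Ap0.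
pose c (t : R) := (sr * cos (t / sr)) *: e1 + (sr * sin (t / sr)) *: e2 + cr *: e3.
have c0 : c 0 = p0 by rewrite /c mul0r cos0 sin0 mulr1 mulr0 scale0r addr0.
have dc : is_derive (0 : R) (1 : R) c e2.
  have dl := derM (derI (0 : R)) (derC (sr^-1) (0 : R) 1).
  have dcos : is_derive (0 : R) (1 : R) (fun t : R => cos (t / sr)) 0.
    apply: der_eq (der_comp (g := fun t => t / sr) (is_derive_cos (0 / sr)) dl) _.
    by rewrite mul0r sin0; lra.
  have dsin : is_derive (0 : R) (1 : R) (fun t : R => sin (t / sr)) sr^-1.
    apply: der_eq (der_comp (g := fun t => t / sr) (is_derive_sin (0 / sr)) dl) _.
    by rewrite mul0r cos0; lra.
  have dk := derC sr (0 : R) 1.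
  apply: der_eq (derD (derD (der_scale (derM dk dcos) (derC e1 (0 : R) 1))
    (der_scale (derM dk dsin) (derC e2 (0 : R) 1))) (derC _ (0 : R) 1)) _.
  rewrite !scaler0 !addr0 !(mulr0, mul0r, addr0, add0r) scale0r add0r.
  by rewrite mulfV ?scale1r// gt_eqF.
rewrite -c0; apply: curve_tangent dc => //.
near=> t; have := collar_refl Sp0 Ap0 de0.
move=> /(rotation_orbit fr (t / sr) rotA) [+ _].
have comb e : dot p0 e = sr * dot e1 e + cr * dot e3 e by exact: dot_comb.
rewrite !comb (fr11 fr) (fr12 fr) (fr13 fr) (fr33 fr) (dotC e3 e1) (dotC e3 e2).
by rewrite (fr13 fr) (fr23 fr) !(mulr0, mulr1, addr0, add0r, subr0, mul0r).
Unshelve. all: by end_near. Qed.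

Theorem theorem2p4 (R : realType) (n : nat)
    (c : 'I_n.+1 -> 'rV[R]_3) (r : 'I_n.+1 -> R)
    (obstacles : circular_obstacles c r)
    (delta1 : R) (delta1_bounds : 0 < delta1 < pi / 2 - rmax r) :
  exists2 delta2 : R, 0 < delta2 &
    forall Sigma : set 'rV[R]_3,
      surface Sigma ->
      geodesically_complete Sigma ->
      ~ Sigma 0 ->
      @radial_proj R @` Sigma = billiard c r ->
      (forall i, disk_boundary (c i) (r i) `<=` Sigma) ->
      (forall i, rotation_invariant (c i)
         (collar Sigma (disk_boundary (c i) (r i)) delta1)) ->
      C2_close delta2 Sigma
        (Sigma `\` \bigcup_i collar Sigma (disk_boundary (c i) (r i)) delta2)
        (billiard c r) ->
      has_conjugate_points Sigma.
Proof.
(* The whole argument takes place near one point of the rim of the obstacle [ord0]. *)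
have [c1 hr _] := obstacles; have /andP[de0 _] := delta1_bounds.
have h3 : enorm (c ord0) = 1 := c1 ord0.
have e33 : dot (c ord0) (c ord0) = 1 by rewrite -enorm_sqr h3 expr1n.
have [e1 [e2 fr]] := frame_exists e33.
have hr0 := hr ord0; have /andP[r0 rpi] := hr0; have pi0 := pi_gt0 R.
have sr0 : 0 < sin (r ord0) by apply: sin_gt0_pihalf; rewrite ?r0.
have cr0 : 0 < cos (r ord0) by apply: cos_gt0_pihalf; lra.
have srcr : sin (r ord0) ^+ 2 + cos (r ord0) ^+ 2 = 1 by rewrite addrC cos2Dsin2.
have Ap0 : disk_boundary (c ord0) (r ord0) (sin (r ord0) *: e1 + cos (r ord0) *: c ord0).
  rewrite addrC; apply: sphere_disk_rim => //; last by rewrite dotC (fr13 fr).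
  by rewrite /enorm (fr11 fr) sqrtr1.
have rim p : disk_boundary (c ord0) (r ord0) p -> dot p p = 1 /\ dot p (c ord0) = cos (r ord0).
  by move=> /(disk_boundaryP hr0 h3) [pp pe]; rewrite -enorm_sqr pp expr1n dotC.
have [e e0 sep] := rims_separated obstacles Ap0.
have shadow Sigma q := @billiard_shadow R _ c r Sigma ord0 q obstacles.
move: (sin (r ord0)) (cos (r ord0)) sr0 cr0 srcr Ap0 rim sep shadow.
move=> sr cr sr0 cr0 srcr Ap0 rim sep shadow.
(* Length of the meridian under study: within the collar, off the axis, and far from the other
   rims. *)
pose sigma := Num.min delta1 (Num.min sr (e / 4)).
have sigma0 : 0 < sigma by rewrite !lt_min de0 sr0 divr_gt0.
have [s1 [s2 s3]] : sigma <= delta1 /\ sigma <= sr /\ sigma <= e / 4.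
  by rewrite !ge_min !lexx !orbT.
clearbody sigma.
have mu0 : 0 < Num.min sr cr by rewrite lt_min sr0.
have b0 : 0 < Num.min (sr / 12) (e / 2) by rewrite lt_min !divr_gt0.
have [d [d0 db d4 d5]] := small_gap (sr ^+ 2 / 128) mu0 sigma0 b0.
have [d1 d2] : d <= sr / 12 /\ d <= e / 2 by move: db; rewrite le_min => /andP[].
have dh : d <= 1 / 2 by have : sr <= 1 by [have := sqr_ge0 cr; nra]; lra.
exists d => // Sigma surf comp S0 proj bd rot close.
have rot0 := rot ord0; have Sp0 := bd ord0 _ Ap0.
have te2 := rim_orbit_tangent fr surf rot0 de0 sr0 Sp0 Ap0.
have tp0 := radial_tangent fr surf sr0 cr0 srcr Sp0 te2 (fun q => shadow Sigma q S0 proj).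
have p0n : sr *: e1 + cr *: c ord0 != 0.
  apply/eqP => h; have := dot_comb e1 (c ord0) e1 sr cr.
  by rewrite h dot0l (fr11 fr) (dotC _ e1) (fr13 fr) => h'; lra.
have [gam [geo g0 dg0]] := comp _ _ Sp0 tp0 p0n.
apply: (meridian_conjugate fr surf rot0 sigma0 s1 s2 cr0 srcr Ap0 geo g0 dg0 d0 d1 d4 d5 rim).
move=> s hs far.
have Sg := meridian_in geo; have dg := meridian_der geo s.
(* A collar point is at Euclidean distance less than [d] from its rim. For [ord0] this contradicts
   [far]; for another rim, [e / 4 + d < e] contradicts the separation. *)
have outside : (Sigma `\` \bigcup_i collar Sigma (disk_boundary (c i) (r i)) d) (gam s).
  split=> // -[j _ /collar_near [p pj ph]].
  have [ji|ji] := eqVneq j ord0.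
    by have := far p; rewrite -ji leNgt ph => /(_ pj).
  have h1 := sep j ji p pj; have /andP[hs0 hs1] := hs.
  have h2 := meridian_chord fr surf srcr geo g0 dg0 hs0.
  have h4 : enorm (sr *: e1 + cr *: c ord0 - p) <=
      enorm (gam s - (sr *: e1 + cr *: c ord0)) + enorm (gam s - p).
    by move: (sr *: e1 + _) => x; rewrite (enormB x); exact: enorm_triangle.
  by move: h1 h2 h4 ph d2 s3 hs1; lra.
have [U [f1 [f2 [pf1 pf2 [u Uu fu] H]]]] := close _ outside.
have [_ C2] : billiard c r (f2 u) /\ C2_dist_le d f1 f2 u by apply: H; rewrite ?fu.
have near_gam : \forall t \near s, Sigma (gam t) by near=> t; exact: Sg.
have [w Dw] := tangent_curve pf1 Uu fu near_gam dg.
have [] := close_to_sphere pf1 pf2 Uu C2 d0 dh (v := w).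
  by rewrite Dw (meridian_unit_speed fr surf srcr geo dg0).
by rewrite fu Dw.
Unshelve. all: by end_near. Qed.
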